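(* Let $\mu\in(0,1)\cup(1,\infty)$ and $w_0\in\mathbb{C}$ with $\operatorname{Im} w_0\ge 0$, and let $\tau:\Pi^+\to\Pi^+$, $\tau(w)=\mu w+w_0$ (a hyperbolic self-map of $\Pi^+$). Then, for every $\alpha\ge -1$, the spectrum of the bounded composition operator $C_\tau:\mathcal{A}^2_\alpha(\Pi^+)\to\mathcal{A}^2_\alpha(\Pi^+)$, $C_\tau F=F\circ\tau$, is i) $\{\lambda\in\mathbb{C}:|\lambda|=\mu^{-(\alpha+2)/2}\}$, when $w_0\in\mathbb{R}$; ii) $\{\lambda\in\mathbb{C}:|\lambda|\le\mu^{-(\alpha+2)/2}\}$, when $w_0\in\Pi^+$. Moreover, in both cases the essential spectrum of $C_\tau$ on $\mathcal{A}^2_\alpha(\Pi^+)$ coincides with the spectrum.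
   Context: $\Pi^+=\{w\in\mathbb{C}:\operatorname{Im} w>0\}$ is the upper half-plane. For $\alpha>-1$ the weighted Bergman space $\mathcal{A}^2_\alpha(\Pi^+)$ consists of the analytic $F:\Pi^+\to\mathbb{C}$ with $$\|F\|_{\mathcal{A}^2_\alpha(\Pi^+)}=\Big(\int_{\Pi^+}|F(x+iy)|^2\,y^\alpha\,dx\,dy\Big)^{1/2}<\infty.$$ For $\alpha=-1$, by convention, $\mathcal{A}^2_{-1}(\Pi^+)$ denotes the Hardy space $H^2(\Pi^+)$, which consists of the analytic $F:\Pi^+\to\mathbb{C}$ with $$\|F\|_{H^2(\Pi^+)}=\sup_{y>0}\Big(\int_{-\infty}^\infty|F(x+iy)|^2\,dx\Big)^{1/2}<\infty.$$ These are complex Hilbert spaces, and $C_\tau$ is a bounded linear operator on each of them for the maps $\tau$ considered. For a bounded linear operator $T$ on a Hilbert space $\mathcal{H}$: the spectrum is $\sigma(T;\mathcal{H})=\{\lambda\in\mathbb{C}: T-\lambda \text{ is not invertible on }\mathcal{H}\}$, and the essential spectrum is $\sigma_{ess}(T;\mathcal{H})=\{\lambda\in\mathbb{C}: T-\lambda\text{ is not a Fredholm operator on }\mathcal{H}\}$. *)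

(* Defs.v *)
From HB Require Import structures.
From mathcomp Require Import all_boot all_order all_algebra.
From mathcomp Require Import all_classical all_reals all_analysis.
From mathcomp Require Import measurable_realfun complex ring lra.

Set Implicit Arguments.
Unset Strict Implicit.
Unset Printing Implicit Defensive.

Import Order.TTheory GRing.Theory Num.Theory.
Import ComplexField Normc.
Import numFieldNormedType.Exports.

Local Open Scope classical_set_scope.
Local Open Scope ring_scope.
Local Open Scope complex_scope.

Section operators.
Context {K : numFieldType} {V : normedModType K}.
Implicit Type T : V -> V.

Definition bounded_operator T : Prop :=
  linear T /\ exists M : K, forall v, `|T v| <= M * `|v|.

(* Invertibility is meant in the algebra of bounded operators. *)
Definition invertible_operator T : Prop :=
  exists S : V -> V, [/\ bounded_operator S, cancel T S & cancel S T].

Definition spectrum T : set K :=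
  [set l | ~ invertible_operator (fun v => T v - l *: v)].

Definition finite_dimensional (W : set V) : Prop :=
  exists n (e : 'I_n -> V), forall w, W w ->
    exists c : 'I_n -> K, w = \sum_i c i *: e i.

(* The quotient V / W is spanned by the classes of finitely many vectors. *)
Definition finite_codimensional (W : set V) : Prop :=
  exists n (e : 'I_n -> V), forall v,
    exists2 w, W w & exists c : 'I_n -> K, v = w + \sum_i c i *: e i.

Definition fredholm T : Prop :=
  [/\ finite_dimensional [set v | T v = 0],
      closed (range T)
    & finite_codimensional (range T)].

Definition essential_spectrum T : set K :=
  [set l | ~ fredholm (fun v => T v - l *: v)].

End operators.

(* mathcomp-analysis puts the topology and the normed structure of a numeric
   field K on the regular module K^o when K is a concrete field such as R[i];
   derivable below is thus complex differentiability. *)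
Notation cplx R := (R[i]^o) (only parsing).

Section spaces.
Context {R : realType}.
Notation C := (cplx R).
Notation leb := (@lebesgue_measure R).

Definition upper_half_plane : set C := [set w | 0 < complex.Im w].

Definition analytic_on (D : set C) (F : C -> C) : Prop :=
  forall w, D w -> derivable F w 1.

(* A function on the upper half-plane is represented by its extension by zero
   to the whole plane, so that Leibniz equality of representatives is equality
   on the half-plane. *)
Definition admissible (F : C -> C) : Prop :=
  analytic_on upper_half_plane F /\
  forall w, ~ upper_half_plane w -> F w = 0.

(* normc is the real-valued modulus of a complex number; the norm of R[i] as a
   numeric field takes its values in R[i]. *)
Definition bergman_norm (alpha : R) (F : C -> C) : \bar R :=
  ((\int[leb \x leb]_(p in [set p | (0 < p.2)%R])
      (normc (F (p.1 +i* p.2)) ^+ 2 * p.2 `^ alpha)%:E) `^ 2^-1)%E.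

Definition hardy_norm (F : C -> C) : \bar R :=
  ereal_sup [set ((\int[leb]_x (normc (F (x +i* y)) ^+ 2)%:E) `^ 2^-1)%E
            | y in [set y : R | 0 < y]].

(* By convention the weight -1 stands for the Hardy space. *)
Definition A2_norm (alpha : R) : (C -> C) -> \bar R :=
  if alpha == -1 then hardy_norm else bergman_norm alpha.

Definition A2_pred (alpha : R) : {pred (C -> C)} :=
  [pred F : C -> C | `[< admissible F /\ (A2_norm alpha F < +oo)%E >] ].

Section L2.
Context d (T : measurableType d) (m : {measure set T -> \bar R}).
Local Open Scope ereal_scope.
Definition L2 (f : T -> R) : \bar R := (\int[m]_x (f x ^+ 2)%:E) `^ 2^-1.

Lemma L2E f : L2 f = 'N[m]_2%:E[EFin \o f].
Proof.
rewrite /L2 unlock /Lnorm; congr (_ `^ _).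
apply: eq_integral => x _ /=.
by rewrite powR_mulrn ?normr_ge0// real_normK ?num_real.
Qed.

Lemma L2_ge0 f : 0 <= L2 f.
Proof. exact: poweR_ge0. Qed.

Lemma le_L2 (f g : T -> R) : measurable_fun setT f -> measurable_fun setT g ->
  (forall x, 0 <= f x <= g x)%R -> L2 f <= L2 g.
Proof.
move=> mf mg fg; apply: gt0_ler_poweR; rewrite ?invr_ge0//.
- by rewrite in_itv/= leey andbT; apply: integral_ge0 => x _;
  rewrite lee_fin sqr_ge0.
- by rewrite in_itv/= leey andbT; apply: integral_ge0 => x _;
  rewrite lee_fin sqr_ge0.
apply: ge0_le_integral => //.
- by move=> x _; rewrite lee_fin sqr_ge0.
- by apply/measurable_EFinP; exact: measurable_funX.
- by apply/measurable_EFinP; exact: measurable_funX.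
- move=> x _; rewrite lee_fin; have /andP[f0 fgx] := fg x.
  by rewrite lerXn2r// nnegrE// (le_trans f0).
Qed.

Lemma L2D (f g h : T -> R) : measurable_fun setT f -> measurable_fun setT g ->
  measurable_fun setT h -> (forall x, 0 <= h x <= f x + g x)%R ->
  L2 h <= L2 f + L2 g.
Proof.
move=> mf mg mh hfg; apply: (@le_trans _ _ (L2 (f \+ g)%R)).
  by apply: le_L2 => //; exact: measurable_funD.
by rewrite !L2E; apply: minkowski_EFin; rewrite ?ler1n.
Qed.

Lemma L2Z (c : R) (f : T -> R) : (0 <= c)%R -> measurable_fun setT f ->
  L2 (fun x => c * f x)%R = c%:E * L2 f.
Proof.
move=> c0 mf; rewrite /L2.
under eq_integral do rewrite exprMn EFinM.
rewrite ge0_integralZl_EFin ?sqr_ge0//; last 2 first.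
- by move=> x _; rewrite lee_fin sqr_ge0.
- by apply/measurable_EFinP; exact: measurable_funX.
rewrite poweRM ?lee_fin ?sqr_ge0//; last first.
  by apply: integral_ge0 => x _; rewrite lee_fin sqr_ge0.
by rewrite /= -powR_mulrn// -powRrM mulfV ?pnatr_eq0// powRr1.
Qed.

Lemma L2_eq0 (f : T -> R) : measurable_fun setT f -> L2 f = 0 ->
  {ae m, forall x, f x = 0%R}.
Proof.
move=> mf; rewrite L2E => /Lnorm_eq0_eq0; case.
- by exact/measurable_EFinP.
- by rewrite lte_fin.
- move=> N [mN N0 sub]; exists N; split=> // x /= fx; apply: sub => /= /(_ I)[].
  exact: fx.
Qed.

End L2.



Lemma open_measurable_prod (U : set (R * R)) : open U -> measurable U.
Proof.
move=> oU.
pose B (q : rat * rat * rat) : set (R * R) :=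
  ball (ratr q.1.1 : R) (ratr q.2) `*` ball (ratr q.1.2 : R) (ratr q.2).
have mB q : measurable (B q).
  by apply: measurableX; exact: measurable_ball.
have -> : U = \bigcup_(q in [set q | B q `<=` U]) B q.
  apply/seteqP; split=> [[x y] Uxy|p [q]]; last exact.
  move: oU; rewrite openE => /(_ _ Uxy); rewrite /interior/= -nbhs_ballE.
  move=> [e /= e0 eU].
  have e40 : 0 < e / 4 by rewrite divr_gt0.
  have [r /andP[r1 r2]] : exists r : rat, e / 4 < ratr r < e / 2.
    have [|r] := @rat_in_itvoo R (e / 4) (e / 2); first by lra.
    by rewrite in_itv/= => rr; exists r.
  have rat_near (z : R) : exists q : rat, `|z - ratr q| < ratr r.
    have [|q] := @rat_in_itvoo R (z - ratr r) (z + ratr r); first by lra.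
    by rewrite in_itv/= => /andP[q1 q2]; exists q; rewrite ltr_norml; lra.
  have [a xa] := rat_near x; have [b yb] := rat_near y.
  exists (a, b, r) => /=; last first.
    by split; rewrite /ball/= distrC.
  move=> [u v] [/= au bv]; apply: eU; split => /=.
    move: au; rewrite /ball/= => au;
      rewrite (_ : x - u = (x - ratr a) + (ratr a - u)); last by ring.
    by rewrite (le_lt_trans (ler_normD _ _))//; lra.
  move: bv; rewrite /ball/= => bv;
    rewrite (_ : y - v = (y - ratr b) + (ratr b - v)); last by ring.
  by rewrite (le_lt_trans (ler_normD _ _))//; lra.
rewrite bigcup_mkcond; apply: countable_bigcupT_measurable.
  exact: countableP.
by move=> q; case: ifPn.
Qed.

Lemma continuous_measurable_prod (D : set (R * R)) (f : R * R -> R) :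
  open D -> (forall p, D p -> {for p, continuous f}) -> measurable_fun D f.
Proof.
move=> oD cf; apply: (measurability _ (RGenOpens.measurableE R)).
move=> _ [_ [a [b ->] <-]]; apply: open_measurable_prod.
rewrite openE => p [Dp fp]; apply: filterI.
  by move: oD; rewrite openE; exact.
by apply: (cf p Dp); apply: open_nbhs_nbhs; split=> //; exact: interval_open.
Qed.


Lemma ae_eq0_line (f : R -> R) (x : R) : {for x, continuous f} ->
  {ae leb, forall x, f x = 0} -> f x = 0.
Proof.
move=> cf [N [mN N0 sub]]; apply/eqP/negPn/negP => fx0.
have /nbhs_ballP[e /= e0 eN] : nbhs x
  [set y | f y != 0] by exact: cvgr_neq0 cf fx0.
have : (leb (ball x e) <= leb N)%E.
  apply: le_measure; rewrite ?inE//; first exact: measurable_ball.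
  by move=> y /eN/eqP fy; apply: sub.
rewrite N0 lebesgue_measure_ball ?(ltW e0)// leNgt => /negP; apply.
by rewrite lte_fin pmulrn_lgt0.
Qed.

Lemma ae_eq0_plane (f : R * R -> R) (p : R * R) : {for p, continuous f} ->
  {ae (leb \x leb)%E, forall x, f x = 0} -> f p = 0.
Proof.
move=> cf [N [mN N0 sub]]; apply/eqP/negPn/negP => fx0.
have /nbhs_ballP[e /= e0 eN] : nbhs p
  [set y | f y != 0] by exact: cvgr_neq0 cf fx0.
have : ((leb \x leb) (ball p.1 e `*` ball p.2 e) <= (leb \x leb) N)%E.
  apply: le_measure; rewrite ?inE//.
    by apply: measurableX; exact: measurable_ball.
  by move=> y [y1 y2]; apply: sub; apply/eqP; apply: eN.
rewrite N0 product_measure1E; [|exact: measurable_ball..].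
rewrite -[X in (X * _)%E]/(lebesgue_measure (ball p.1 e)) -[X in (_ *
  X)%E]/(lebesgue_measure (ball p.2 e)).
rewrite !lebesgue_measure_ball ?(ltW e0)// -EFinM leNgt => /negP; apply.
by rewrite lte_fin mulr_gt0// pmulrn_lgt0.
Qed.

Lemma normcR (z : C) : `|z| = (normc z)%:C.
Proof. by []. Qed.

Lemma normc_ge0 (z : C) : 0 <= normc z.
Proof. by case: z => a b; exact: sqrtr_ge0. Qed.

Lemma normcD (z w : C) : normc (z + w) <= normc z + normc w.
Proof. exact: le_normcD. Qed.

Lemma normc_le (a b : R) : normc (a +i* b) <= `|a| + `|b|.
Proof.
rewrite /normc -[leRHS]ger0_norm ?addr_ge0// -sqrtr_sqr ler_wsqrtr//.
by rewrite -(real_normK (num_real a)) -(real_normK (num_real b)) sqrrD lerD2r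
  lerDl mulrn_wge0// mulr_ge0.
Qed.

Lemma continuous_normc : continuous (fun z : C => normc z).
Proof.
move=> z; apply/(@cvgrPdist_lt _ _ _ (nbhs z)) => e e0; near=> w.
have : `|z - w| < e%:C.
  by near: w; apply: (@cvgr_dist_lt _ _ _ (nbhs z) _ id); rewrite ?ltcR//;
    exact: cvg_id.
rewrite normcR ltcR; apply: le_lt_trans.
have h1 := normcD (z - w) w; have h2 := normcD (w - z) z.
rewrite !subrK in h1 h2; rewrite -[w - z]opprB normcN in h2.
by rewrite ler_norml; apply/andP; split; lra.
Unshelve. all: by end_near. Qed.

Lemma continuous_cplx : continuous (fun p : R * R => p.1 +i* p.2 : C).
Proof.
move=> p; apply/(@cvgrPdist_lt _ _ _ (nbhs p)) => e e0.
have {}e0 : 0 < complex.Re e /\ e = (complex.Re e)%:C.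
  by case: e e0 => a b; rewrite ltcE/= => /andP[/eqP-> ->].
case: e0 => e0 ->; near=> q; rewrite normcR ltcR.
apply: le_lt_trans (_ : `|p.1 - q.1| + `|p.2 - q.2| < _); first exact: normc_le.
rewrite (splitr (complex.Re e)) ltrD//.
  near: q; apply: (@cvgr_dist_lt _ _ _ (nbhs p) _ fst);
    [exact: cvg_fst|exact: divr_gt0].
near: q; apply: (@cvgr_dist_lt _ _ _ (nbhs p) _ snd);
  [exact: cvg_snd|exact: divr_gt0].
Unshelve. all: by end_near. Qed.

Lemma continuous_normc_analytic (F : C -> C) (p : R * R) :
  analytic_on upper_half_plane F -> 0 < p.2 ->
  {for p, continuous (fun q : R * R => normc (F (q.1 +i* q.2)))}.
Proof.
move=> aF p0.
have cF : {for p.1 +i* p.2 : C, continuous F}.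
  by apply: differentiable_continuous; apply/derivable1_diffP; exact: aF.
have h1 := @cvg_comp _ _ _ (fun q : R * R =>
  q.1 +i* q.2 : C) F _ _ _ (@continuous_cplx p) cF.
have h2 := @cvg_comp _ _ _ _ (fun z : C =>
  normc z) _ _ _ h1 (@continuous_normc _).
by refine h2.
Qed.

Lemma continuous_normc_line (F : C -> C) (x y : R) :
  analytic_on upper_half_plane F -> 0 < y ->
  {for x, continuous (fun t : R => normc (F (t +i* y)))}.
Proof.
move=> aF y0.
have h : (fun t : R => (t, y)) @ x --> (x, y).
  by apply: (@cvg_pair _ _ _ (nbhs x) (nbhs x) (nbhs y) _ _ _ id (cst y));
    [exact: cvg_id|exact: cvg_cst].
have h2 := @continuous_normc_analytic F (x, y) aF y0.
have h3 := (@cvg_comp _ _ _ (fun t : R => (t, y)) _ _ _ _ h h2).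
by refine h3.
Qed.

Lemma open_upper : open [set p : R * R | 0 < p.2].
Proof.
have : open ((@snd R R) @^-1` [set y : R | y > 0]).
  by apply: open_comp; [move=> p _; exact: cvg_snd|exact: open_gt].
exact.
Qed.

Lemma admissible0 : admissible 0.
Proof. by split=> // w _; exact: derivable_cst. Qed.

Lemma admissibleD F G : admissible F -> admissible G -> admissible (F + G).
Proof.
move=> [aF F0] [aG G0]; split=> w Pw; first by apply: derivableD;
  [exact: aF|exact: aG].
by rewrite addrfctE F0// G0// addr0.
Qed.

Lemma admissibleZ (c : C) F : admissible F -> admissible (c *: F).
Proof.
move=> [aF F0]; split=> w Pw; first by apply: derivableZ; exact: aF.
by rewrite scalrfctE F0// scaler0.
Qed.

Let mag (F : C -> C) (p : R * R) : R := normc (F (p.1 +i* p.2)).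
Let wmag (alpha : R) (F : C -> C) (p : R * R) : R := mag F p * p.2 `^ (alpha /
  2).
Let lmag (y : R) (F : C -> C) (x : R) : R := normc (F (x +i* y)).

Lemma mag_out F p : admissible F -> ~ 0 < p.2 -> mag F p = 0.
Proof. by move=> [_ F0] p0; rewrite /mag F0 ?normc0. Qed.

Lemma measurable_mag F : admissible F -> measurable_fun setT (mag F).
Proof.
move=> aF.
have -> : mag F = mag F \_ [set p | 0 < p.2].
  apply/funext => p; rewrite patchE; case: ifPn => //.
  by rewrite notin_setE => /(mag_out aF).
apply/(measurable_restrictT _ _).1.
  by apply: open_measurable_prod; exact: open_upper.
apply: continuous_measurable_prod; first exact: open_upper.
by move=> p p0; apply: continuous_normc_analytic => //; case: aF.
Qed.

Lemma measurable_wmag alpha F : admissible F -> measurable_fun setT (wmag alpha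
  F).
Proof.
move=> aF; apply: measurable_funM; first exact: measurable_mag.
by apply: (measurableT_comp (measurable_powR _)); exact: measurable_snd.
Qed.

Lemma measurable_lmag y F : admissible F -> 0 < y -> measurable_fun setT (lmag
  y F).
Proof.
move=> [aF _] y0; apply: continuous_measurable_fun => x.
exact: continuous_normc_line.
Qed.

Lemma bergmanE alpha F : admissible F ->
  bergman_norm alpha F = L2 (leb \x leb)%E (wmag alpha F).
Proof.
move=> aF; rewrite /bergman_norm integral_mkcond /L2; congr (_ `^ _)%E.
apply: eq_integral => p _; rewrite patchE; case: ifPn => [|].
  rewrite inE/= => p0; rewrite /wmag exprMn; congr ((_ * _)%:E).
  by rewrite -powR_mulrn ?powR_ge0// -powRrM divfK// pnatr_eq0.
by rewrite notin_setE /wmag => /(mag_out aF) ->; rewrite mul0r expr0n.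
Qed.

Lemma bergman_normD alpha F G : admissible F -> admissible G ->
  (bergman_norm alpha (F + G)%R <= bergman_norm alpha F + bergman_norm alpha
    G)%E.
Proof.
move=> aF aG; have aFG := admissibleD aF aG.
rewrite !bergmanE//; apply: L2D; [exact: measurable_wmag..|] => p.
rewrite /wmag -mulrDl mulr_ge0 ?powR_ge0 ?normc_ge0//=.
by rewrite ler_wpM2r ?powR_ge0//; exact: normcD.
Qed.

Lemma bergman_normZ alpha (c : C) F : admissible F ->
  bergman_norm alpha (c *: F) = ((normc c)%:E * bergman_norm alpha F)%E.
Proof.
move=> aF; have acF := admissibleZ c aF.
rewrite !bergmanE// -L2Z ?normc_ge0//; last exact: measurable_wmag.
congr L2; apply/funext => p.
by rewrite /wmag /mag scalrfctE normcM mulrA.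
Qed.

Lemma bergman_norm_eq0 alpha F : admissible F -> bergman_norm alpha F = 0%E ->
  F = 0.
Proof.
move=> aF; rewrite bergmanE// => /L2_eq0 => /(_ (measurable_wmag _ aF)) w0.
apply/funext => -[x y]; have [y0|y0] := ltP 0 y; last first.
  by case: aF => _ -> //=; rewrite /upper_half_plane/= ltNge y0.
apply: eq0_normc; apply: (@ae_eq0_plane (mag F) (x, y)).
  by apply: continuous_normc_analytic => //; case: aF.
apply: filterS w0 => p; have [p0|p0] := ltP 0 p.2; last first.
  by move=> _; rewrite mag_out// ltNge p0.
by move=> /eqP; rewrite mulf_eq0 (gt_eqF (powR_gt0 _ p0)) orbF => /eqP.
Qed.

Lemma hardy_normD F G : admissible F -> admissible G ->
  (hardy_norm (F + G)%R <= hardy_norm F + hardy_norm G)%E.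
Proof.
move=> aF aG; have aFG := admissibleD aF aG.
apply: ge_ereal_sup => _ [y /= y0 <-].
apply: (@le_trans _ _ (L2 leb (lmag y F) + L2 leb (lmag y G))%E).
  apply: L2D; [exact: measurable_lmag..|] => x.
  by rewrite normc_ge0//=; exact: normcD.
by apply: leeD; apply: ereal_sup_ubound; exists y.
Qed.

Lemma hardy_normZ (c : C) F : admissible F ->
  hardy_norm (c *: F) = ((normc c)%:E * hardy_norm F)%E.
Proof.
move=> aF; rewrite /hardy_norm -ereal_supZl ?normc_ge0//; last first.
  by apply/set0P; exists (L2 leb (lmag 1 F)), 1 => /=.
congr ereal_sup; rewrite image_comp; apply: eq_imagel => y /= y0.
rewrite -[RHS]L2Z ?normc_ge0//; last exact: measurable_lmag.
by congr L2; apply/funext => x; rewrite /lmag scalrfctE normcM.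
Qed.

Lemma hardy_norm_ge0 F : (0 <= hardy_norm F)%E.
Proof.
apply: (le_trans (L2_ge0 leb (lmag 1 F))).
by apply: ereal_sup_ubound; exists 1 => /=. Qed.

Lemma hardy_norm_eq0 F : admissible F -> hardy_norm F = 0%E -> F = 0.
Proof.
move=> aF F0.
apply/funext => w; have [w0|w0] := pselect (upper_half_plane w);
  last by case: aF => _ ->.
apply: eq0_normc; case: w w0 => x y /= y0.
apply: (@ae_eq0_line (lmag y F)); first by apply: continuous_normc_line => //;
  case: aF.
apply: L2_eq0; first exact: measurable_lmag.
apply/eqP; rewrite eq_le L2_ge0 andbT -F0.
by apply: ereal_sup_ubound; exists y.
Qed.

End spaces.

Section bergman_space.
Context {R : realType} (alpha : R).
Notation C := (cplx R).

Lemma A2_norm_ge0 (F : C -> C) : (0 <= A2_norm alpha F)%E.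
Proof. by rewrite /A2_norm; case: ifP => _;
  [exact: hardy_norm_ge0|exact: poweR_ge0]. Qed.

Lemma A2_normD (F G : C -> C) : admissible F -> admissible G ->
  (A2_norm alpha (F + G)%R <= A2_norm alpha F + A2_norm alpha G)%E.
Proof. by rewrite /A2_norm; case: ifP => _;
  [exact: hardy_normD|exact: bergman_normD]. Qed.

Lemma A2_normZ (c : R[i]) (F : C -> C) : admissible F ->
  A2_norm alpha (c *: F) = ((normc c)%:E * A2_norm alpha F)%E.
Proof. by rewrite /A2_norm; case: ifP => _;
  [exact: hardy_normZ|exact: bergman_normZ]. Qed.

Lemma A2_norm_eq0 (F : C -> C) : admissible F -> A2_norm alpha F = 0%E -> F = 0.
Proof. by rewrite /A2_norm; case: ifP => _;
  [exact: hardy_norm_eq0|exact: bergman_norm_eq0]. Qed.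

Lemma A2_predP (F : C -> C) :
  reflect (admissible F /\ (A2_norm alpha F < +oo)%E) (F \in A2_pred alpha).
Proof. exact: asboolP. Qed.

Lemma A2_submod_closed : submod_closed (A2_pred alpha).
Proof.
split=> [|c F G /A2_predP[aF Foo] /A2_predP[aG Goo]].
  apply/A2_predP; split; first exact: admissible0.
  by rewrite -(scale0r 0) A2_normZ ?normc0 ?mul0e//; exact: admissible0.
have acF := admissibleZ c aF.
apply/A2_predP; split; first exact: admissibleD.
apply: (le_lt_trans (A2_normD acF aG)); rewrite lte_add_pinfty// A2_normZ//.
by rewrite lte_mul_pinfty// lee_fin normc_ge0.
Qed.

HB.instance Definition _ := GRing.isSubmodClosed.Build _ _ (A2_pred alpha)
  A2_submod_closed.

Record A2_space : Type := MkA2 {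
  A2_fun :> C -> C ;
  A2_funP : A2_fun \in A2_pred alpha }.

HB.instance Definition _ := [isSub for A2_fun].
HB.instance Definition _ := [Choice of A2_space by <:].
HB.instance Definition _ := [SubChoice_isSubLmodule of A2_space by <:].

Lemma A2_admissible (F : A2_space) : admissible F.
Proof. by have /A2_predP[] := A2_funP F. Qed.

Lemma A2_norm_fin (F : A2_space) : A2_norm alpha F \is a fin_num.
Proof. by rewrite ge0_fin_numE ?A2_norm_ge0//;
  have /A2_predP[] := A2_funP F. Qed.

Let norm (F : A2_space) : R[i] := (fine (A2_norm alpha F))%:C.

Let normD (F G : A2_space) : norm (F + G) <= norm F + norm G.
Proof.
rewrite /norm -rmorphD/= lecR -fineD ?A2_norm_fin//.
apply: fine_le; [exact: (A2_norm_fin (F + G))|by rewrite fin_numD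
  !A2_norm_fin|].
exact: (A2_normD (A2_admissible F) (A2_admissible G)).
Qed.

Let normZ (c : R[i]) (F : A2_space) : norm (c *: F) = `|c| * norm F.
Proof.
rewrite /norm normcR -rmorphM; congr (_%:C).
by rewrite -[_ (A2_norm _ _)]/(fine (A2_norm alpha (c *: A2_fun F))) (A2_normZ
  c (A2_admissible F)) fineM// A2_norm_fin.
Qed.

Let norm_eq0 (F : A2_space) : norm F = 0 -> F = 0.
Proof.
case=> F0.
apply/val_inj/A2_norm_eq0; first exact: A2_admissible.
by rewrite -(fineK (A2_norm_fin F)) F0.
Qed.

HB.instance Definition _ :=
  Lmodule_isNormed.Build R[i] A2_space normD normZ norm_eq0.

Lemma A2_normE (F : A2_space) : `|F| = (fine (A2_norm alpha F))%:C.
Proof. by []. Qed.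

Definition composition_operator (tau : C -> C) (T : A2_space -> A2_space) :=
  forall F w, upper_half_plane w -> T F w = F (tau w).

End bergman_space.

(* Main.v *)
(** Cauchy's theorem on squares bounds |F(w)|^2 by an integral mean, which gives
    bounded point evaluations, completeness, and the estimate
    ||C_tau|| <= K mu^{-(alpha+2)/2} with K independent of mu and w_0. Applied to
    the iterates of C_tau (and of its inverse when w_0 is real), it confines the
    spectrum by Neumann series.

    Let w* = w_0/(1 - mu) be the fixed point of tau, and let P_s(w) be a power of
    4u/(1+u)^2 with u = -is(w - w* )/c: along the half-line above w* it peaks
    sharply at height c/s, and C_tau P_s = P_{mu s}. On the critical circle, sums
    of the P_s over an orbit of the dilation, with tent-shaped coefficients, have
    unbounded norms while their images under C_tau - lambda are bounded. If w_0 is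
    not real, then lambda = 0 is treated with poles approaching the real axis from
    below. For 0 < |lambda| < mu^{-(alpha+2)/2} and mu > 1, w* lies below the axis
    and the sums of lambda^m P_{mu^{-m} s} over m are almost eigenvectors,
    independent for different s, so that the kernel is infinite-dimensional. For
    mu < 1, w* lies in the half-plane, the functionals summing
    lambda^{-m} F(w* + iy mu^m), with F replaced by a difference of high order,
    nearly annihilate the range of C_tau - lambda, and the codimension is
    infinite. *)

Require Import Defs.
From mathcomp Require Import all_boot all_order all_algebra.
From mathcomp Require Import all_classical all_reals all_analysis.
From mathcomp Require Import measurable_realfun complex ring lra zify.

Set Implicit Arguments.
Unset Strict Implicit.
Unset Printing Implicit Defensive.

Import Order.TTheory GRing.Theory Num.Theory.
Import ComplexField Normc.
Import numFieldNormedType.Exports.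

Local Open Scope classical_set_scope.
Local Open Scope ring_scope.
Local Open Scope complex_scope.

(** * Cauchy's estimate on squares *)

Section complex_derivative.
Context {R : realType}.
Notation C := (cplx R).

Lemma normc_normr (x : R) : normc x%:C = `|x|.
Proof. by rewrite /= expr0n/= addr0 sqrtr_sqr. Qed.

Lemma normcB (z w : C) : normc (z - w) = normc (w - z).
Proof. by rewrite -normcN opprB. Qed.

Lemma normc_eq0 (z : C) : (normc z == 0) = (z == 0).
Proof.
by apply/eqP/eqP => [/eq0_normc//|->]; exact: normc0.
Qed.

Lemma normc_gt0 (z : C) : (0 < normc z) = (z != 0).
Proof. by rewrite lt_neqAle normc_ge0 andbT eq_sym normc_eq0. Qed.

Lemma normcX (z : C) n : normc (z ^+ n) = normc z ^+ n.
Proof.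
by elim: n => [|n ih]; rewrite ?expr0 ?normc1// !exprS normcM ih.
Qed.

Lemma normc_sum (I : Type) (s : seq I) (P : pred I) (f : I -> C) :
  normc (\sum_(i <- s | P i) f i) <= \sum_(i <- s | P i) normc (f i).
Proof.
elim/big_rec2: _ => [|i x y _ ih]; first by rewrite normc0.
by rewrite (le_trans (normcD _ _))// lerD2l.
Qed.

Lemma normr_Re_le (z : C) : `|complex.Re z| <= normc z.
Proof.
case: z => a b /=.
by rewrite -(sqrtr_sqr a) ler_wsqrtr// lerDl sqr_ge0.
Qed.

Lemma normr_Im_le (z : C) : `|complex.Im z| <= normc z.
Proof.
case: z => a b /=.
by rewrite -(sqrtr_sqr b) ler_wsqrtr// lerDr sqr_ge0.
Qed.

Lemma normc_le_ReIm (z : C) : normc z <= `|complex.Re z| + `|complex.Im z|.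
Proof. by case: z => a b; exact: normc_le. Qed.

Definition has_cderiv (F : C -> C) (z D : C) := forall e : R, 0 < e ->
  exists2 d : R, 0 < d &
    forall h : C, normc h < d -> normc (F (z + h) - F z - D * h) <= e * normc h.

Lemma posc_ex (e : R[i]) : 0 < e -> exists2 r : R, 0 < r & e = r%:C.
Proof.
by case: e => a b; rewrite ltcE/= => /andP[/eqP-> a0]; exists a.
Qed.

Lemma nbhs_cplxP (z : C) (A : set C) : nbhs z A <->
  exists2 d : R, 0 < d & forall h : C, normc h < d -> A (z + h).
Proof.
split=> [/nbhs_ballP[e /posc_ex[d d0 ->] zA]|[d d0 dA]].
  exists d => // h hd; apply: zA; rewrite /ball/= opprD addrA subrr sub0r.
  by rewrite normrN ltcR.
apply/nbhs_ballP; exists d%:C; first by rewrite /= ltcR.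
move=> w; rewrite /ball/= => zw; rewrite -(subrK z w) addrC; apply: dA.
by move: zw; rewrite normcR ltcR normcB.
Qed.

Lemma derivable_cderivP (F : C -> C) z :
  derivable F z 1 <-> exists D, has_cderiv F z D.
Proof.
split.
- move=> /cvg_ex[/= D FD]; exists D => e e0.
  have : \forall h \near (0 : C)^', `|D - h^-1 *: (F (h *: 1 + z) - F z)| <= e%:C.
    by move/cvgrPdist_le : FD; apply; rewrite ltcR.
  rewrite near_withinE => /nbhs_cplxP[d d0 H]; exists d => // h hd.
  have [->|h0] := eqVneq h 0; first by rewrite addr0 subrr mulr0 subr0 normc0 mulr0.
  move: (H h hd); rewrite add0r => /(_ h0); rewrite normcR lecR => He.
  have -> : F (z + h) - F z - D * h =
      - (D - h^-1 *: (F (h *: 1 + z) - F z)) * h.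
    have aux (u : R[i]) : u - D * h = - (D - h^-1 * u) * h by field.
    by rewrite -aux /GRing.scale/= mulr1 (addrC h z).
  by rewrite normcM normcN ler_wpM2r// normc_ge0.
- move=> [D HD]; apply/cvg_ex; exists D; apply/cvgrPdist_le => _ /posc_ex[e e0 ->].
  rewrite near_withinE; apply/nbhs_cplxP; have [d d0 H] := HD e e0.
  exists d => // h hd; rewrite add0r => h0; rewrite normcR lecR.
  have -> : D - h^-1 *: (F (h *: 1 + z) - F z) =
      - ((F (z + h) - F z - D * h) / h).
    have aux (u : R[i]) : D - h^-1 * u = - ((u - D * h) / h) by field.
    by rewrite -aux /GRing.scale/= mulr1 (addrC h z).
  rewrite normcN normcM normcV ler_pdivrMr ?normc_gt0//.
  exact: H.
Qed.

Lemma has_cderiv_continuous (F : C -> C) z D : has_cderiv F z D ->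
  {for z, continuous F}.
Proof.
move=> FD; apply: differentiable_continuous; apply/derivable1_diffP.
by apply/derivable_cderivP; exists D.
Qed.

Lemma continuous_cplxP (F : C -> C) z : {for z, continuous F} <->
  forall e : R, 0 < e -> exists2 d : R, 0 < d &
    forall h, normc h < d -> normc (F (z + h) - F z) <= e.
Proof.
split=> [cF e e0|H].
  have : \forall w \near z, `|F z - F w| <= e%:C.
    by move/(@cvgrPdist_le _ _ _ (nbhs z)) : cF; apply; rewrite ltcR.
  move=> /nbhs_cplxP[d d0 {}H]; exists d => // h hd.
  by have := H h hd; rewrite normcR lecR normcB.
apply/(@cvgrPdist_le _ _ _ (nbhs z)) => _ /posc_ex[e e0 ->].
apply/nbhs_cplxP; have [d d0 {}H] := H e e0; exists d => // h hd.
by rewrite normcR lecR normcB; exact: H.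
Qed.

Lemma continuous_Re : continuous (fun z : C => complex.Re z).
Proof.
move=> z; apply/(@cvgrPdist_le _ _ _ (nbhs z)) => e e0.
apply/nbhs_cplxP; exists e => // h he.
rewrite (_ : complex.Re z - _ = - complex.Re h); last first.
  by case: z h {he} => a b [c d] /=; ring.
by rewrite normrN (le_trans (normr_Re_le h))// ltW.
Qed.

Lemma continuous_Im : continuous (fun z : C => complex.Im z).
Proof.
move=> z; apply/(@cvgrPdist_le _ _ _ (nbhs z)) => e e0.
apply/nbhs_cplxP; exists e => // h he.
rewrite (_ : complex.Im z - _ = - complex.Im h); last first.
  by case: z h {he} => a b [c d] /=; ring.
by rewrite normrN (le_trans (normr_Im_le h))// ltW.
Qed.

End complex_derivative.

Section complex_integral.
Context {R : realType}.
Notation C := (cplx R).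
Notation leb := (@lebesgue_measure R).

Definition cintegral (a b : R) (f : R -> C) : C :=
  (\int[leb]_(x in `[a, b]) complex.Re (f x))%R +i*
  (\int[leb]_(x in `[a, b]) complex.Im (f x))%R.

Arguments cintegral : simpl never.

Definition cont_on (a b : R) (f : R -> C) :=
  forall x, a <= x <= b -> {for x, continuous f}.

Lemma cont_on_Re_integrable a b f : cont_on a b f ->
  leb.-integrable `[a, b] (EFin \o (fun x => complex.Re (f x))).
Proof.
move=> cf; apply: continuous_compact_integrable; first exact: segment_compact.
apply: continuous_in_subspaceT => x; rewrite inE/= in_itv/= => xab.
exact: (cvg_comp _ _ (cf x xab) (@continuous_Re R (f x))).
Qed.

Lemma cont_on_Im_integrable a b f : cont_on a b f ->
  leb.-integrable `[a, b] (EFin \o (fun x => complex.Im (f x))).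
Proof.
move=> cf; apply: continuous_compact_integrable; first exact: segment_compact.
apply: continuous_in_subspaceT => x; rewrite inE/= in_itv/= => xab.
exact: (cvg_comp _ _ (cf x xab) (@continuous_Im R (f x))).
Qed.

Lemma cont_on_normc_integrable a b f : cont_on a b f ->
  leb.-integrable `[a, b] (EFin \o (fun x => normc (f x))).
Proof.
move=> cf; apply: continuous_compact_integrable; first exact: segment_compact.
apply: continuous_in_subspaceT => x; rewrite inE/= in_itv/= => xab.
exact: (cvg_comp _ _ (cf x xab) (@continuous_normc R (f x))).
Qed.

Lemma cont_onB a b f g : cont_on a b f -> cont_on a b g ->
  cont_on a b (fun x => f x - g x).
Proof. by move=> cf cg x xab; apply: cvgB; [exact: cf|exact: cg]. Qed.

Lemma cont_on_cst a b c : cont_on a b (fun=> c).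
Proof. by move=> x _; exact: cvg_cst. Qed.

Lemma eq_cintegral a b f g : (forall x, a <= x <= b -> f x = g x) ->
  cintegral a b f = cintegral a b g.
Proof.
move=> fg; rewrite /cintegral; congr (_ +i* _).
  by apply: eq_Rintegral => x; rewrite inE/= in_itv/= => /fg ->.
by apply: eq_Rintegral => x; rewrite inE/= in_itv/= => /fg ->.
Qed.

Lemma cintegralD a b f g : cont_on a b f -> cont_on a b g ->
  cintegral a b (fun x => f x + g x) = cintegral a b f + cintegral a b g.
Proof.
move=> cf cg; rewrite /cintegral.
rewrite -[RHS]/((_ + _) +i* (_ + _)) -!RintegralD//;
  [|exact: cont_on_Im_integrable..|exact: cont_on_Re_integrable|
   exact: cont_on_Re_integrable].
congr (_ +i* _); apply: eq_Rintegral => x _.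
  by case: (f x) (g x) => ? ? [].
by case: (f x) (g x) => ? ? [].
Qed.

Lemma Rintegral_itv_cst (a b r : R) : a <= b ->
  (\int[leb]_(x in `[a, b]) r)%R = r * (b - a).
Proof.
move=> ab; rewrite Rintegral_cst//= lebesgue_measure_itv/= lte_fin.
by have [->|nab] := eqVneq a b; rewrite ?ltxx ?subrr// lt_neqAle nab ab.
Qed.

Lemma cintegral_cst a b (c : C) : a <= b ->
  cintegral a b (fun=> c) = c * (b - a)%:C.
Proof.
move=> ab; rewrite /cintegral !Rintegral_itv_cst//.
by case: c => p q /=; congr (_ +i* _) => /=; ring.
Qed.

Lemma Rintegral_itv_split (a m b : R) (f : R -> R) : a <= m -> m <= b ->
  leb.-integrable `[a, b] (EFin \o f) ->
  (\int[leb]_(x in `[a, b]) f x =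
   \int[leb]_(x in `[a, m]) f x + \int[leb]_(x in `[m, b]) f x)%R.
Proof.
move=> am mb fi.
have := Rintegral_itvB fi (_ : (BLeft a <= BRight m)%O) (_ : (BRight m <= BRight b)%O).
rewrite !bnd_simp => /(_ am mb) E.
rewrite -(@Rintegral_itv_obnd_cbnd _ m).
  by rewrite -E addrC subrK.
by apply: integrableS fi => //; apply: subset_itvr; rewrite bnd_simp.
Qed.

Lemma cintegral_split a m b f : a <= m -> m <= b -> cont_on a b f ->
  cintegral a b f = cintegral a m f + cintegral m b f.
Proof.
move=> am mb cf; rewrite /cintegral.
rewrite -[RHS]/((_ + _) +i* (_ + _)) -!Rintegral_itv_split//.
  exact: cont_on_Im_integrable.
exact: cont_on_Re_integrable.
Qed.

Lemma normc_cintegral a b f : cont_on a b f ->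
  normc (cintegral a b f) <= 2 * (\int[leb]_(x in `[a, b]) normc (f x))%R.
Proof.
move=> cf; rewrite (le_trans (normc_le _ _))//.
rewrite mulr_natl mulr2n lerD// (le_trans (le_normr_Rintegral _ _))//.
- exact: cont_on_Re_integrable.
- apply: le_Rintegral => //.
  + by apply: (@integrable_norm _ _ _ leb _ _ (cont_on_Re_integrable cf)).
  + exact: cont_on_normc_integrable.
  + by move=> x _; exact: normr_Re_le.
- exact: cont_on_Im_integrable.
- apply: le_Rintegral => //.
  + by apply: (@integrable_norm _ _ _ leb _ _ (cont_on_Im_integrable cf)).
  + exact: cont_on_normc_integrable.
  + by move=> x _; exact: normr_Im_le.
Qed.

Lemma normc_cintegral_le a b f M : a <= b -> cont_on a b f ->
  (forall x, a <= x <= b -> normc (f x) <= M) ->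
  normc (cintegral a b f) <= 2 * (M * (b - a)).
Proof.
move=> ab cf fM; rewrite (le_trans (normc_cintegral cf))// ler_pM2l//.
rewrite -Rintegral_itv_cst//; apply: le_Rintegral => //.
- exact: cont_on_normc_integrable.
- apply: continuous_compact_integrable; first exact: segment_compact.
  by apply: continuous_subspaceT => x; exact: cvg_cst.
Qed.

End complex_integral.

Section rectangles.
Context {R : realType}.
Notation C := (cplx R).

Lemma continuous_hline (c x : R) : {for x, continuous (fun t : R => t +i* c : C)}.
Proof.
have h : (fun t : R => (t, c)) @ x --> (x, c).
  by apply: (@cvg_pair _ _ _ (nbhs x) (nbhs x) (nbhs c) _ _ _ id (cst c));
    [exact: cvg_id|exact: cvg_cst].
have h2 := @cvg_comp _ _ _ _ (fun p : R * R => p.1 +i* p.2 : C) _ _ _ h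
  (@continuous_cplx R (x, c)).
by refine h2.
Qed.

Lemma continuous_vline (c x : R) : {for x, continuous (fun t : R => c +i* t : C)}.
Proof.
have h : (fun t : R => (c, t)) @ x --> (c, x).
  by apply: (@cvg_pair _ _ _ (nbhs x) (nbhs c) (nbhs x) _ _ _ (cst c) id);
    [exact: cvg_cst|exact: cvg_id].
have h2 := @cvg_comp _ _ _ _ (fun p : R * R => p.1 +i* p.2 : C) _ _ _ h
  (@continuous_cplx R (c, x)).
by refine h2.
Qed.

Lemma cont_on_hline (F : C -> C) a b c :
  (forall x, a <= x <= b -> {for x +i* c : C, continuous F}) ->
  cont_on a b (fun t => F (t +i* c)).
Proof.
move=> cF x xab.
have h := @cvg_comp _ _ _ (fun t : R => t +i* c : C) F _ _ _
  (@continuous_hline c x) (cF x xab).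
by refine h.
Qed.

Lemma cont_on_vline (F : C -> C) a c d :
  (forall y, c <= y <= d -> {for a +i* y : C, continuous F}) ->
  cont_on c d (fun t => F (a +i* t)).
Proof.
move=> cF y ycd.
have h := @cvg_comp _ _ _ (fun t : R => a +i* t : C) F _ _ _
  (@continuous_vline a y) (cF y ycd).
by refine h.
Qed.

Definition rect_integral (F : C -> C) (a b c d : R) : C :=
  cintegral a b (fun x => F (x +i* c) - F (x +i* d)) +
  (0 +i* 1) * cintegral c d (fun y => F (b +i* y) - F (a +i* y)).

Arguments rect_integral : simpl never.

Definition cont_hside (F : C -> C) a b c :=
  forall x, a <= x <= b -> {for x +i* c : C, continuous F}.
Definition cont_vside (F : C -> C) a c d :=
  forall y, c <= y <= d -> {for a +i* y : C, continuous F}.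

Lemma cont_on_hdiff F a b c d : cont_hside F a b c -> cont_hside F a b d ->
  cont_on a b (fun x => F (x +i* c) - F (x +i* d)).
Proof.
move=> hc hd; exact: (@cont_onB R a b (fun x => F (x +i* c))
  (fun x => F (x +i* d)) (cont_on_hline hc) (cont_on_hline hd)).
Qed.

Lemma cont_on_vdiff F a b c d : cont_vside F a c d -> cont_vside F b c d ->
  cont_on c d (fun y => F (b +i* y) - F (a +i* y)).
Proof.
move=> va vb; exact: (@cont_onB R c d (fun y => F (b +i* y))
  (fun y => F (a +i* y)) (cont_on_vline vb) (cont_on_vline va)).
Qed.

Lemma rect_integral_splitx F a m b c d : a <= m -> m <= b -> c <= d ->
  cont_hside F a b c -> cont_hside F a b d ->
  cont_vside F a c d -> cont_vside F m c d -> cont_vside F b c d ->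
  rect_integral F a b c d = rect_integral F a m c d + rect_integral F m b c d.
Proof.
move=> am mb cd hc hd va vm vb; rewrite /rect_integral.
rewrite (cintegral_split am mb (cont_on_hdiff hc hd)).
rewrite (@eq_cintegral _ c d _ (fun y => (F (b +i* y) - F (m +i* y)) +
    (F (m +i* y) - F (a +i* y)))); last by move=> y _; rewrite addrA subrK.
rewrite (cintegralD (cont_on_vdiff vm vb) (cont_on_vdiff va vm)).
by rewrite mulrDr [in RHS]addrACA; congr (_ + _); rewrite addrC.
Qed.

Lemma rect_integral_splity F a b c m d : c <= m -> m <= d -> a <= b ->
  cont_vside F a c d -> cont_vside F b c d ->
  cont_hside F a b c -> cont_hside F a b m -> cont_hside F a b d ->
  rect_integral F a b c d = rect_integral F a b c m + rect_integral F a b m d.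
Proof.
move=> cm md ab va vb hc hm hd; rewrite /rect_integral.
rewrite (cintegral_split cm md (cont_on_vdiff va vb)).
rewrite (@eq_cintegral _ a b _ (fun x => (F (x +i* c) - F (x +i* m)) +
    (F (x +i* m) - F (x +i* d)))); last by move=> y _; rewrite addrA subrK.
rewrite (cintegralD (cont_on_hdiff hc hm) (cont_on_hdiff hm hd)).
by rewrite mulrDr [in RHS]addrACA.
Qed.

Lemma normc_rect_integral_le F a b c d (M : R) : a <= b -> c <= d ->
  cont_hside F a b c -> cont_hside F a b d ->
  cont_vside F a c d -> cont_vside F b c d ->
  (forall x, a <= x <= b -> normc (F (x +i* c)) <= M) ->
  (forall x, a <= x <= b -> normc (F (x +i* d)) <= M) ->
  (forall y, c <= y <= d -> normc (F (a +i* y)) <= M) ->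
  (forall y, c <= y <= d -> normc (F (b +i* y)) <= M) ->
  normc (rect_integral F a b c d) <= 4 * M * ((b - a) + (d - c)).
Proof.
move=> ab cd hc hd va vb Mc Md Ma Mb; rewrite (le_trans (normcD _ _))//.
rewrite normcM (_ : normc (0 +i* 1) = 1); last first.
  by rewrite /= expr0n/= add0r expr1n sqrtr1.
rewrite mul1r mulrDr.
have H1 x : a <= x <= b -> normc (F (x +i* c) - F (x +i* d)) <= 2 * M.
  move=> xab; rewrite (le_trans (normcD _ _))// normcN.
  by have := Mc x xab; have := Md x xab; lra.
have H2 y : c <= y <= d -> normc (F (b +i* y) - F (a +i* y)) <= 2 * M.
  move=> ycd; rewrite (le_trans (normcD _ _))// normcN.
  by have := Ma y ycd; have := Mb y ycd; lra.
have := normc_cintegral_le ab (cont_on_hdiff hc hd) H1.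
have := normc_cintegral_le cd (cont_on_vdiff va vb) H2.
by move: (normc _) (normc _) => p q; lra.
Qed.

Lemma nested_intervals (u : nat -> R) (w : R) : (forall n, u n <= u n.+1) ->
  (forall n, u n.+1 + w / 2 ^+ n.+1 <= u n + w / 2 ^+ n) -> 0 <= w ->
  exists x, forall n, u n <= x <= u n + w / 2 ^+ n.
Proof.
move=> u_nd v_ni w0.
have wn0 n : 0 <= w / 2 ^+ n by rewrite divr_ge0// exprn_ge0.
have und m k : u m <= u (m + k)%N.
  by elim: k => [|k ih]; rewrite ?addn0// addnS (le_trans ih).
have vni m k : u (m + k)%N + w / 2 ^+ (m + k) <= u m + w / 2 ^+ m.
  by elim: k => [|k ih]; rewrite ?addn0// addnS (le_trans _ ih).
have uv m n : u m <= u n + w / 2 ^+ n.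
  have [mn|/ltnW nm] := leqP m n.
    rewrite (le_trans (_ : _ <= u n)) ?lerDl//.
    by rewrite -(subnKC mn) und.
  by rewrite -(subnKC nm) (le_trans _ (vni n (m - n)%N))// lerDl.
exists (sup (range u)) => n; apply/andP; split.
  apply: ub_le_sup; last by exists n.
  by exists (u 0 + w / 2 ^+ 0) => _ [m _ <-]; exact: uv.
apply: ge_sup; first by exists (u 0); exists 0%N.
by move=> _ [m _ <-]; exact: uv.
Qed.

Definition cont_rect (F : C -> C) a b c d := forall x y, a <= x <= b ->
  c <= y <= d -> {for x +i* y : C, continuous F}.

Lemma cont_rect_hside F a b c d a' b' y : cont_rect F a b c d ->
  a <= a' -> b' <= b -> c <= y -> y <= d -> cont_hside F a' b' y.
Proof.
move=> cF aa bb cy yd x /andP[ax xb]; apply: cF; last exact/andP.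
by rewrite (le_trans aa)// (le_trans xb).
Qed.

Lemma cont_rect_vside F a b c d c' d' x : cont_rect F a b c d ->
  c <= c' -> d' <= d -> a <= x -> x <= b -> cont_vside F x c' d'.
Proof.
move=> cF cc dd ax xb y /andP[cy yd]; apply: cF; first exact/andP.
by rewrite (le_trans cc)// (le_trans yd).
Qed.

Lemma normc_rect_integral_split F a m b c k d : a <= m -> m <= b -> c <= k ->
  k <= d -> cont_rect F a b c d ->
  normc (rect_integral F a b c d) <=
  normc (rect_integral F a m c k) + normc (rect_integral F m b c k) +
  (normc (rect_integral F a m k d) + normc (rect_integral F m b k d)).
Proof.
move=> am mb ck kd cF.
have ab := le_trans am mb; have cd := le_trans ck kd.
have hs a' b' y := @cont_rect_hside F a b c d a' b' y cF.
have vs c' d' x := @cont_rect_vside F a b c d c' d' x cF.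
rewrite (rect_integral_splity ck kd ab);
  [|exact: vs|exact: vs|exact: hs|exact: hs|exact: hs].
rewrite (rect_integral_splitx am mb ck);
  [|exact: hs|exact: hs|exact: vs|exact: vs|exact: vs].
rewrite (rect_integral_splitx am mb kd);
  [|exact: hs|exact: hs|exact: vs|exact: vs|exact: vs].
by rewrite (le_trans (normcD _ _))// lerD// normcD.
Qed.

Lemma normc_rect_integral_le_in F a b c d (M : R) : a <= b -> c <= d ->
  cont_rect F a b c d ->
  (forall x y, a <= x <= b -> c <= y <= d -> normc (F (x +i* y)) <= M) ->
  normc (rect_integral F a b c d) <= 4 * M * ((b - a) + (d - c)).
Proof.
move=> ab cd cF FM.
have hs a' b' y := @cont_rect_hside F a b c d a' b' y cF.
have vs c' d' x := @cont_rect_vside F a b c d c' d' x cF.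
apply: normc_rect_integral_le => //;
  [exact: hs|exact: hs|exact: vs|exact: vs|..] => z zab; apply: FM => //;
  by rewrite lexx ?ab ?cd.
Qed.

Lemma continuous_sub_affine (F : C -> C) (u v D z : C) :
  {for z, continuous F} ->
  {for z, continuous (fun w : C => F w - u - D * (w - v))}.
Proof.
move=> /continuous_cplxP cF; apply/continuous_cplxP => e e0.
have e20 : 0 < e / 2 by rewrite divr_gt0.
have [d d0 Hd] := cF _ e20.
have D0 := normc_ge0 D.
have D1 : 0 < normc D + 1 by rewrite ltr_wpDl.
exists (Num.min d (e / 2 / (normc D + 1))) => [|h].
  by rewrite lt_min d0/= divr_gt0.
rewrite lt_min => /andP[/Hd hd]; rewrite ltr_pdivlMr// => hD.
have -> : F (z + h) - u - D * (z + h - v) - (F z - u - D * (z - v)) =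
  (F (z + h) - F z) - D * h.
  by move: (F _) (F _) => p q; rewrite !mulrBr !mulrDr !opprB; ring.
rewrite (le_trans (normcD _ _))// normcN normcM [leRHS]splitr lerD//.
rewrite mulrC (le_trans _ (ltW hD))// ler_wpM2l ?normc_ge0// lerDl//.
Qed.

Section goursat.
Variables (F : C -> C) (a b c d : R).
Hypotheses (ab : a <= b) (cd : c <= d).
Hypothesis dF : forall x y, a <= x <= b -> c <= y <= d ->
  exists D, has_cderiv F (x +i* y) D.

Let w n : R := (b - a) / 2 ^+ n.
Let h n : R := (d - c) / 2 ^+ n.
Let I n (p : R * R) : R :=
  normc (rect_integral F p.1 (p.1 + w n) p.2 (p.2 + h n)).

Let step n (p : R * R) : R * R :=
  let p1 := (p.1 + w n.+1, p.2) in
  let p2 := (p.1, p.2 + h n.+1) in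
  let p3 := (p.1 + w n.+1, p.2 + h n.+1) in
  if I n p <= 4 * I n.+1 p then p else
  if I n p <= 4 * I n.+1 p1 then p1 else
  if I n p <= 4 * I n.+1 p2 then p2 else p3.

Let corner := fix corner n := if n is m.+1 then step m (corner m) else (a, c).

Let w_ge0 n : 0 <= w n.
Proof. by rewrite divr_ge0 ?exprn_ge0// subr_ge0. Qed.
Let h_ge0 n : 0 <= h n.
Proof. by rewrite divr_ge0 ?exprn_ge0// subr_ge0. Qed.
Let wS n : w n = w n.+1 + w n.+1.
Proof. by rewrite /w exprS; field. Qed.
Let hS n : h n = h n.+1 + h n.+1.
Proof. by rewrite /h exprS; field. Qed.

Let stepP n p : [/\ p.1 <= (step n p).1, (step n p).1 + w n.+1 <= p.1 + w n,
  p.2 <= (step n p).2 & (step n p).2 + h n.+1 <= p.2 + h n].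
Proof.
have := w_ge0 n.+1; have := h_ge0 n.+1; rewrite (wS n) (hS n) /step => w0 h0.
by do 3![case: ifP => _ /=; first by split; lra]; split; lra.
Qed.

Let cornerP n : [/\ a <= (corner n).1, (corner n).1 + w n <= b,
  c <= (corner n).2 & (corner n).2 + h n <= d].
Proof.
elim: n => [|n [i1 i2 i3 i4]] /=.
  by rewrite /w /h expr0; split; lra.
by have [s1 s2 s3 s4] := stepP n (corner n); split; lra.
Qed.

Let cont_in x y : a <= x <= b -> c <= y <= d -> {for x +i* y : C, continuous F}.
Proof. by move=> xab ycd; have [D /has_cderiv_continuous] := dF xab ycd. Qed.

Let step_I n : I n (corner n) <= 4 * I n.+1 (corner n.+1).
Proof.
rewrite /=; have [i1 i2 i3 i4] := cornerP n.
move: (corner n) i1 i2 i3 i4 => p i1 i2 i3 i4.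
rewrite /step; case: ifPn => //; rewrite -ltNge => H0.
case: ifPn => //; rewrite -ltNge => H1; case: ifPn => //; rewrite -ltNge => H2.
rewrite leNgt; apply/negP => H3.
have : I n p <= I n.+1 p + I n.+1 (p.1 + w n.+1, p.2) +
  (I n.+1 (p.1, p.2 + h n.+1) + I n.+1 (p.1 + w n.+1, p.2 + h n.+1)).
  have w0 := w_ge0 n.+1; have h0 := h_ge0 n.+1.
  have wn := wS n; have hn := hS n.
  have Ex : p.1 + w n = p.1 + w n.+1 + w n.+1 by rewrite wn addrA.
  have Ey : p.2 + h n = p.2 + h n.+1 + h n.+1 by rewrite hn addrA.
  have l1 : p.1 <= p.1 + w n.+1 by rewrite lerDl.
  have l2 : p.1 + w n.+1 <= p.1 + w n by rewrite Ex lerDl.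
  have l3 : p.2 <= p.2 + h n.+1 by rewrite lerDl.
  have l4 : p.2 + h n.+1 <= p.2 + h n by rewrite Ey lerDl.
  have := @normc_rect_integral_split F _ _ _ _ _ _ l1 l2 l3 l4.
  rewrite /I [_.1]/= [_.2]/= -Ex -Ey; apply.
  move=> x y /andP[x1 x2] /andP[y1 y2]; apply: cont_in.
    by rewrite (le_trans i1)//= (le_trans x2).
  by rewrite (le_trans i3)//= (le_trans y2).
move: H0 H1 H2 H3; move: (I n p) (I n.+1 p) (I n.+1 (_ + _, _.2))
  (I n.+1 (_.1, _)) (I n.+1 _) => q q0 q1 q2 q3; lra.
Qed.

Lemma goursat : rect_integral F a b c d = 0.
Proof.
apply/eqP; rewrite -normc_eq0; apply/negPn/negP => I0.
have {}I0 : 0 < I 0 (a, c).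
  have Ex : a + w 0 = b by rewrite /w expr0 divr1 addrC subrK.
  have Ey : c + h 0 = d by rewrite /h expr0 divr1 addrC subrK.
  by rewrite /I [_.1]/= [_.2]/= Ex Ey lt_neqAle eq_sym I0 normc_ge0.
have IN n : I 0 (a, c) <= 4 ^+ n * I n (corner n).
  elim: n => [|n ih]; first by rewrite expr0 mul1r.
  by rewrite (le_trans ih)// exprSr -mulrA ler_wpM2l ?exprn_ge0 ?step_I.
have [x0 x0P] : exists x, forall n, (corner n).1 <= x <= (corner n).1 + w n.
  apply: nested_intervals; rewrite ?subr_ge0//.
    by move=> n; have [] := stepP n (corner n).
  by move=> n; have [] := stepP n (corner n).
have [y0 y0P] : exists y, forall n, (corner n).2 <= y <= (corner n).2 + h n.
  apply: nested_intervals; rewrite ?subr_ge0//.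
    by move=> n; have [] := stepP n (corner n).
  by move=> n; have [] := stepP n (corner n).
have [D HD] : exists D, has_cderiv F (x0 +i* y0) D.
  apply: dF.
    have := x0P 0%N => /=.
    by rewrite /w expr0 divr1 (addrC a) subrK.
  have := y0P 0%N => /=.
  by rewrite /h expr0 divr1 (addrC c) subrK.
pose s := (b - a) + (d - c).
have s0 : 0 <= s by rewrite addr_ge0// subr_ge0.
pose e := I 0 (a, c) / (4 * (s ^+ 2 + 1)) / 2.
have e0 : 0 < e.
  by rewrite divr_gt0// divr_gt0// mulr_gt0// ltr_wpDl// sqr_ge0.
have [del del0 Hdel] := HD e e0.
have [n nd] : exists n, s / 2 ^+ n < del.
  have [n] : exists n : nat, s / del < n%:R.
    exists (Num.truncn (s / del)).+1.
    by have /andP[] := truncn_itv (divr_ge0 s0 (ltW del0)).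
  rewrite ltr_pdivrMr// => sn; exists n; rewrite ltr_pdivrMr ?exprn_gt0//.
  rewrite (lt_le_trans sn)// mulrC ler_pM2l// -natrX ler_nat.
  exact: ltnW (ltn_expl n _).
have [i1 i2 i3 i4] := cornerP n.
have := x0P n; have := y0P n; have := IN n.
move: (corner n) i1 i2 i3 i4 => p i1 i2 i3 i4 In y0n x0n.
have w0 := w_ge0 n; have h0 := h_ge0 n.
pose z0 : C := x0 +i* y0.
pose E (z : C) : C := F z - F z0 - D * (z - z0).
have sn : w n + h n = s / 2 ^+ n by exact: (esym (mulrDl _ _ _)).
have Ele x y : p.1 <= x <= p.1 + w n -> p.2 <= y <= p.2 + h n ->
    normc (E (x +i* y)) <= e * (s / 2 ^+ n).
  move=> /andP[x1 x2] /andP[y1 y2].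
  have dz : normc ((x +i* y : C) - z0) <= s / 2 ^+ n.
    rewrite (le_trans (normc_le _ _))// -sn lerD//.
      by move/andP : x0n => [? ?]; rewrite ler_norml; apply/andP; split; lra.
    by move/andP : y0n => [? ?]; rewrite ler_norml; apply/andP; split; lra.
  rewrite (le_trans _ (_ : e * normc ((x +i* y : C) - z0) <= _))//; last first.
    by rewrite ler_pM2l.
  rewrite /E; have := Hdel ((x +i* y : C) - z0) (le_lt_trans dz nd).
  by rewrite [z0 + _]addrC subrK.
have cE x y : p.1 <= x <= p.1 + w n -> p.2 <= y <= p.2 + h n ->
    {for x +i* y : C, continuous E}.
  move=> /andP[x1 x2] /andP[y1 y2]; apply: continuous_sub_affine.
  apply: cont_in; first by rewrite (le_trans i1)//= (le_trans x2).
  by rewrite (le_trans i3)//= (le_trans y2).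
have EF : rect_integral F p.1 (p.1 + w n) p.2 (p.2 + h n) =
          rect_integral E p.1 (p.1 + w n) p.2 (p.2 + h n).
  have aux (u v t k z z' z'' : R[i]) : u - v =
      u - t - k * (z - z'') - (v - t - k * (z' - z'')) + k * (z - z') by ring.
  have key (k : R[i]) (u v : R) :
      k * (0 +i* (- v)) * u%:C + (0 +i* 1) * (k * (u +i* 0) * v%:C) = 0.
    by case: k => k1 k2; apply/eqP; rewrite eq_complex/=; apply/andP; split;
      apply/eqP; ring.
  rewrite /rect_integral.
  rewrite (@eq_cintegral _ p.1 _ _ (fun x => (E (x +i* p.2) - E (x +i* (p.2 + h n))) +
     D * (0 +i* (- h n)))); last first.
    move=> x _; rewrite /E.
    have -> : (0 +i* (- h n) : C) = (x +i* p.2) - (x +i* (p.2 + h n)).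
      by apply/eqP; rewrite eq_complex/=; apply/andP; split; apply/eqP; ring.
    exact: aux.
  rewrite (@eq_cintegral _ p.2 _ _ (fun y => (E ((p.1 + w n) +i* y) - E (p.1 +i* y)) +
     D * (w n +i* 0))); last first.
    move=> y _; rewrite /E.
    have -> : (w n +i* 0 : C) = ((p.1 + w n) +i* y) - (p.1 +i* y).
      by apply/eqP; rewrite eq_complex/=; apply/andP; split; apply/eqP; ring.
    exact: aux.
  rewrite (cintegralD _ (@cont_on_cst R _ _ _)); last first.
    by apply: cont_on_hdiff => x xp; apply: cE => //; apply/andP; split; rewrite ?lerDl.
  rewrite (cintegralD _ (@cont_on_cst R _ _ _)); last first.
    by apply: cont_on_vdiff => y yp; apply: cE => //; apply/andP; split; rewrite ?lerDl.
  rewrite !cintegral_cst; [|lra|lra].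
  rewrite mulrDr addrACA [p.1 + _ - _]addrAC [p.2 + _ - _]addrAC !subrr !add0r.
  by rewrite key addr0.
have : I n p <= 4 * (e * (s / 2 ^+ n)) * (s / 2 ^+ n).
  have l1 : p.1 <= p.1 + w n by rewrite lerDl.
  have l2 : p.2 <= p.2 + h n by rewrite lerDl.
  have := normc_rect_integral_le_in l1 l2 cE Ele.
  by rewrite /I EF -sn [p.1 + _ - _]addrAC [p.2 + _ - _]addrAC !subrr !add0r.
have -> : 4 * (e * (s / 2 ^+ n)) * (s / 2 ^+ n) = 4 * e * s ^+ 2 / 4 ^+ n.
  rewrite (_ : 4 = 2 * 2 :> R); last by ring.
  rewrite exprMn; field.
  by rewrite expf_neq0.
rewrite ler_pdivlMr ?exprn_gt0// mulrC => /(le_trans In).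
have -> : 4 * e * s ^+ 2 = I 0 (a, c) / 2 * (s ^+ 2 / (s ^+ 2 + 1)).
  rewrite /e; field.
  by rewrite gt_eqF// ltr_wpDl// sqr_ge0.
have : s ^+ 2 / (s ^+ 2 + 1) <= 1.
  by rewrite ler_pdivrMr ?mul1r ?lerDl// ltr_wpDl// sqr_ge0.
move: (s ^+ 2 / _) => q q1; apply/negP; rewrite -ltNge.
by nra.
Qed.

End goursat.
End rectangles.

Section cauchy.
Context {R : realType}.
Notation C := (cplx R).
Notation leb := (@lebesgue_measure R).

Lemma cintegralZl a b (c : C) f : cont_on a b f ->
  cintegral a b (fun x => c * f x) = c * cintegral a b f.
Proof.
move=> cf; rewrite /cintegral.
have iR := cont_on_Re_integrable cf; have iI := cont_on_Im_integrable cf.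
have iZ k (g : R -> R) : leb.-integrable `[a, b] (EFin \o g) ->
    leb.-integrable `[a, b] (EFin \o (fun x => k * g x)).
  by move=> ig; apply: (@integrableZl _ _ _ leb `[a, b] _ k (EFin \o g)).
case: c => p q; rewrite -[RHS]/((_ - _) +i* (_ + _)).
rewrite -!RintegralZl// -RintegralB//; [|exact: iZ..].
rewrite -RintegralD//; [|exact: iZ..].
by congr (_ +i* _); apply: eq_Rintegral => x _; case: (f x).
Qed.

Lemma cont_onZl a b (c : C) f : cont_on a b f -> cont_on a b (fun x => c * f x).
Proof.
move=> cf x xab; have := cf x xab.
move=> /(@cvgrPdist_le _ _ _ (nbhs x)) H.
apply/(@cvgrPdist_le _ _ _ (nbhs x)) => _ /posc_ex[e e0 ->].
have c1 : 0 < normc c + 1 by rewrite ltr_wpDl// normc_ge0.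
have := H (e / (normc c + 1))%:C; rewrite ltcR divr_gt0// => /(_ isT).
apply: filterS => y; rewrite !normcR !lecR -mulrBr normcM => He.
rewrite (@le_trans _ _ ((normc c + 1) * normc (f x - f y)))//.
  by rewrite ler_wpM2r ?normc_ge0// lerDl.
by rewrite mulrC -ler_pdivlMr.
Qed.

Definition cont_sides (F : C -> C) a b c d :=
  [/\ cont_hside F a b c, cont_hside F a b d,
      cont_vside F a c d & cont_vside F b c d].

Lemma rect_integralDZ F G (k : C) a b c d :
  cont_sides F a b c d -> cont_sides G a b c d ->
  rect_integral (fun z => F z + k * G z) a b c d =
  rect_integral F a b c d + k * rect_integral G a b c d.
Proof.
move=> [F1 F2 F3 F4] [G1 G2 G3 G4]; rewrite /rect_integral.
have cF := cont_on_hdiff F1 F2; have cG := @cont_onZl _ _ k _ (cont_on_hdiff G1 G2).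
have cF' := cont_on_vdiff F3 F4; have cG' := @cont_onZl _ _ k _ (cont_on_vdiff G3 G4).
have aux (p q r s l : R[i]) : p + l * q - (r + l * s) = (p - r) + l * (q - s).
  by ring.
rewrite (@eq_cintegral _ a b _ (fun x => (F (x +i* c) - F (x +i* d)) +
  k * (G (x +i* c) - G (x +i* d)))); last by move=> x _; exact: aux.
rewrite (@eq_cintegral _ c d _ (fun y => (F (b +i* y) - F (a +i* y)) +
  k * (G (b +i* y) - G (a +i* y)))); last by move=> x _; exact: aux.
rewrite (cintegralD cF cG) (cintegralD cF' cG').
rewrite (@cintegralZl _ _ k _ (cont_on_hdiff G1 G2)).
rewrite (@cintegralZl _ _ k _ (cont_on_vdiff G3 G4)).
move: (cintegral _ _ _) (cintegral _ _ _) (cintegral _ _ _) (cintegral _ _ _).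
by move=> p q r s; ring.
Qed.

Lemma Im_rect_integral F a b c d :
  complex.Im (rect_integral F a b c d) =
  (\int[leb]_(x in `[a, b]) complex.Im (F (x +i* c) - F (x +i* d)))%R +
  (\int[leb]_(y in `[c, d]) complex.Re (F (b +i* y) - F (a +i* y)))%R.
Proof. by rewrite /rect_integral /cintegral /= mul0r mul1r add0r. Qed.

Section square.
Variables (x0 y0 : R).

Definition punctured t (P : C -> Prop) := forall x y, `|x - x0| <= t ->
  `|y - y0| <= t -> (x != x0) || (y != y0) -> P (x +i* y).

Definition square_integral F t :=
  rect_integral F (x0 - t) (x0 + t) (y0 - t) (y0 + t).

Lemma punctured_sides F t : 0 < t ->
  punctured t (fun z => {for z, continuous F}) ->
  cont_sides F (x0 - t) (x0 + t) (y0 - t) (y0 + t).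
Proof.
move=> t0 cF; split => z /andP[z1 z2]; apply: cF;
  rewrite ?ler_distl ?z1 ?z2//; try (apply/andP; split; lra);
  apply/orP; [right|right|left|left]; apply/eqP; lra.
Qed.

Lemma square_integral_shrink F s t : 0 < s -> s <= t ->
  punctured t (fun z => exists D, has_cderiv F z D) ->
  square_integral F t = square_integral F s.
Proof.
move=> s0 st dF.
have cF x y : x0 - t <= x <= x0 + t -> y0 - t <= y <= y0 + t ->
    (x != x0) || (y != y0) -> {for x +i* y : C, continuous F}.
  move=> xt yt xy; have [] := dF x y _ _ xy; rewrite ?ler_distl//.
  by move=> D; exact: has_cderiv_continuous.
have dF' x y : x0 - t <= x <= x0 + t -> y0 - t <= y <= y0 + t ->
    (x != x0) || (y != y0) -> exists D, has_cderiv F (x +i* y) D.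
  by move=> xt yt; apply: dF; rewrite ler_distl.
have cH a b y : x0 - t <= a -> b <= x0 + t -> y0 - t <= y -> y <= y0 + t ->
    y != y0 -> cont_hside F a b y.
  move=> *; move=> x /andP[? ?]; apply: cF; last by apply/orP; right.
    by apply/andP; split; lra.
  by apply/andP; split; lra.
have cV c d x : y0 - t <= c -> d <= y0 + t -> x0 - t <= x -> x <= x0 + t ->
    x != x0 -> cont_vside F x c d.
  move=> *; move=> y /andP[? ?]; apply: cF; last by apply/orP; left.
    by apply/andP; split; lra.
  by apply/andP; split; lra.
have G0 a b c d : a <= b -> c <= d -> x0 - t <= a -> b <= x0 + t ->
    y0 - t <= c -> d <= y0 + t ->
    (b < x0) || (x0 < a) || (d < y0) || (y0 < c) -> rect_integral F a b c d = 0.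
  move=> ab cd ta tb tc td out; apply: goursat => // x y /andP[ax xb] /andP[cy yd].
  apply: dF'; [apply/andP; split; lra|apply/andP; split; lra|].
  rewrite -negb_and; apply/negP => /andP[/eqP ex /eqP ey].
  move: out; rewrite -ex -ey => /orP[/orP[/orP[]|]|]; lra.
have arith (u : R) : [/\ u - t <= u - s, u - s <= u + s & u + s <= u + t] /\
    [/\ u - t <= u + s, u - s <= u + t, u - t <= u + t, u - s < u & u < u + s] /\
    [/\ u - s != u, u + s != u, u - t != u & u + t != u].
  split; first by split; lra.
  by split; [split; lra|split; apply/eqP; lra].
have [[xa1 xa2 xa3] [[xb1 xb2 xb3 xb4 xb5] [xc1 xc2 xc3 xc4]]] := arith x0.
have [[ya1 ya2 ya3] [[yb1 yb2 yb3 yb4 yb5] [yc1 yc2 yc3 yc4]]] := arith y0.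
rewrite /square_integral.
rewrite (rect_integral_splity ya1 yb2 xb3
  (cV _ _ _ _ _ _ _ xc3) (cV _ _ _ _ _ _ _ xc4)
  (cH _ _ _ _ _ _ _ yc3) (cH _ _ _ _ _ _ _ yc1) (cH _ _ _ _ _ _ _ yc4))//.
rewrite (G0 _ _ (y0 - t) (y0 - s))// ?yb4 ?orbT// add0r.
rewrite (rect_integral_splity ya2 ya3 xb3
  (cV _ _ _ _ _ _ _ xc3) (cV _ _ _ _ _ _ _ xc4)
  (cH _ _ _ _ _ _ _ yc1) (cH _ _ _ _ _ _ _ yc2) (cH _ _ _ _ _ _ _ yc4))//.
rewrite (G0 _ _ (y0 + s) (y0 + t))// ?yb5 ?orbT// addr0.
rewrite (rect_integral_splitx xa1 xb2 ya2
  (cH _ _ _ _ _ _ _ yc1) (cH _ _ _ _ _ _ _ yc2)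
  (cV _ _ _ _ _ _ _ xc3) (cV _ _ _ _ _ _ _ xc1) (cV _ _ _ _ _ _ _ xc4))//.
rewrite (G0 (x0 - t) (x0 - s))// ?xb4 ?orbT// add0r.
rewrite (rect_integral_splitx xa2 xa3 ya2
  (cH _ _ _ _ _ _ _ yc1) (cH _ _ _ _ _ _ _ yc2)
  (cV _ _ _ _ _ _ _ xc1) (cV _ _ _ _ _ _ _ xc2) (cV _ _ _ _ _ _ _ xc4))//.
by rewrite (G0 (x0 + s) (x0 + t))// ?xb5 ?orbT// addr0.
Qed.


End square.
End cauchy.

Section cauchy_formula.
Context {R : realType}.
Notation C := (cplx R).
Notation leb := (@lebesgue_measure R).

Section square.
Variables (x0 y0 : R).
Let w : C := x0 +i* y0.
Local Notation punctured := (punctured x0 y0).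
Local Notation square_integral := (square_integral x0 y0).

Lemma punctured_neq (x y : R) : (x != x0) || (y != y0) -> (x +i* y : C) - w != 0.
Proof.
move=> xy; rewrite subr_eq0 eq_complex/= negb_and//.
Qed.

Lemma derivable_inv_punctured z : z - w != 0 ->
  derivable (fun z : C => (z - w)^-1 : C) z 1.
Proof.
by move=> zw; apply: derivableV.
Qed.

Lemma has_cderiv_quotient F (k : C) z : (exists D, has_cderiv F z D) ->
  z - w != 0 -> exists D, has_cderiv (fun z => (F z - k) * (z - w)^-1) z D.
Proof.
move=> /derivable_cderivP dF zw; apply/derivable_cderivP.
apply: derivableM; last exact: derivable_inv_punctured.
exact: (derivableB dF (derivable_cst k z 1)).
Qed.

Lemma square_integral_quotient F t : 0 < t ->
  punctured t (fun z => exists D, has_cderiv F z D) ->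
  {for w, continuous F} ->
  square_integral (fun z => (F z - F w) * (z - w)^-1) t = 0.
Proof.
move=> t0 dF cF.
set G := fun z => _.
have dG : punctured t (fun z => exists D, has_cderiv G z D).
  move=> x y xt yt xy; apply: has_cderiv_quotient; first exact: dF.
  exact: punctured_neq.
apply/eqP; rewrite -normc_eq0 eq_le normc_ge0 andbT.
apply/ler_addgt0Pl => e e0; rewrite addr0.
have e160 : 0 < e / 16 by rewrite divr_gt0.
have [d d0 Hd] := (continuous_cplxP _ _).1 cF _ e160.
pose s := Num.min t (d / 3).
have s0 : 0 < s by rewrite lt_min t0 divr_gt0.
have st : s <= t by rewrite ge_min lexx.
have sd : s <= d / 3 by rewrite ge_min lexx orbT.
rewrite (square_integral_shrink s0 st dG).
have dGs : punctured s (fun z => exists D, has_cderiv G z D).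
  by move=> x y xs ys; apply: dG; rewrite (le_trans _ st).
have cG : punctured s (fun z => {for z, continuous G}).
  by move=> x y xs ys xy; have [D /has_cderiv_continuous] := dGs x y xs ys xy.
have bG x y : `|x - x0| <= s -> `|y - y0| <= s -> (`|x - x0| = s) \/ (`|y - y0| = s) ->
    normc (G (x +i* y)) <= e / 16 / s.
  move=> xs ys xys; rewrite /G normcM normcV.
  have Fw : normc (F (x +i* y) - F w) <= e / 16.
    have := Hd ((x +i* y : C) - w).
    rewrite (_ : w + ((x +i* y : C) - w) = x +i* y); last by rewrite addrC subrK.
    apply; rewrite (_ : (x +i* y : C) - w = (x - x0) +i* (y - y0))//.
    by rewrite (le_lt_trans (normc_le _ _))//; lra.
  have zw : s <= normc ((x +i* y : C) - w).
    case: xys => <-.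
      exact: (normr_Re_le ((x +i* y : C) - w)).
    exact: (normr_Im_le ((x +i* y : C) - w)).
  rewrite ler_pM ?normc_ge0 ?invr_ge0 ?normc_ge0//.
  by rewrite lef_pV2// posrE (lt_le_trans s0).
have [S1 S2 S3 S4] := punctured_sides s0 cG.
have l1 : x0 - s <= x0 + s by lra.
have l2 : y0 - s <= y0 + s by lra.
have sn : `|s| = s by rewrite gtr0_norm.
have := @normc_rect_integral_le _ G _ _ _ _ (e / 16 / s) l1 l2 S1 S2 S3 S4.
have Ex : x0 + s - x0 = s by ring.
have Ex' : x0 - s - x0 = - s by ring.
have Ey : y0 + s - y0 = s by ring.
have Ey' : y0 - s - y0 = - s by ring.
move=> /(_ _ _ _ _)/le_trans; apply.
- move=> x xs; apply: bG; [by rewrite ler_distl|by rewrite Ey' normrN sn|].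
  by right; rewrite Ey' normrN sn.
- move=> x xs; apply: bG; [by rewrite ler_distl|by rewrite Ey sn|].
  by right; rewrite Ey sn.
- move=> y ys; apply: bG; [by rewrite Ex' normrN sn|by rewrite ler_distl|].
  by left; rewrite Ex' normrN sn.
- move=> y ys; apply: bG; [by rewrite Ex sn|by rewrite ler_distl|].
  by left; rewrite Ex sn.
have -> : x0 + s - (x0 - s) + (y0 + s - (y0 - s)) = 4 * s by ring.
rewrite le_eqVlt; apply/orP; left; apply/eqP.
by field; rewrite gt_eqF.
Qed.

(* This lower bound takes the place of the exact value 2 pi i: [cauchy_estimate]
   only has to hold up to a constant. *)
Lemma square_integral_inv_ge t : 0 < t ->
  4 <= normc (square_integral (fun z => (z - w)^-1) t).
Proof.
move=> t0; apply: le_trans (le_trans (ler_norm _) (normr_Im_le _)).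
rewrite /square_integral Im_rect_integral.
have cI : punctured t (fun z => {for z, continuous (fun z => (z - w)^-1 : C)}).
  move=> x y xt yt xy; apply: differentiable_continuous; apply/derivable1_diffP.
  by apply: derivable_inv_punctured; exact: punctured_neq.
have [S1 S2 S3 S4] := punctured_sides t0 cI.
have bnd (s : R) : - t <= s <= t -> t^-1 <= 2 * (t / (s ^+ 2 + t ^+ 2)).
  move=> /andP[ts st]; have t20 : 0 < s ^+ 2 + t ^+ 2.
    by rewrite ltr_wpDl ?sqr_ge0// exprn_gt0.
  rewrite mulrA ler_pdivlMr// mulrC ler_pdivrMr//.
  by nra.
rewrite (_ : 4 = t^-1 * (x0 + t - (x0 - t)) + t^-1 * (y0 + t - (y0 - t))); last first.
  by field; rewrite gt_eqF.
rewrite -!Rintegral_itv_cst; [|lra|lra].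
have ci a b : leb.-integrable `[a, b] (EFin \o (fun=> t^-1)).
  apply: continuous_compact_integrable; first exact: segment_compact.
  by apply: continuous_subspaceT => x; exact: cvg_cst.
apply: lerD; apply: le_Rintegral => //.
- exact: (cont_on_Im_integrable (cont_on_hdiff S1 S2)).
- move=> x /=; rewrite in_itv/= => xt.
  rewrite (_ : y0 - t - y0 = - t); last by ring.
  rewrite (_ : y0 + t - y0 = t); last by ring.
  rewrite sqrrN mulNr !opprK -mulr2n -mulr_natl.
  by apply: bnd; apply/andP; split; lra.
- exact: (cont_on_Re_integrable (cont_on_vdiff S3 S4)).
- move=> y /=; rewrite in_itv/= => yt.
  rewrite (_ : x0 - t - x0 = - t); last by ring.
  rewrite (_ : x0 + t - x0 = t); last by ring.
  rewrite sqrrN mulNr opprK -mulr2n -mulr_natl (addrC (t ^+ 2)).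
  by apply: bnd; apply/andP; split; lra.
Qed.

Definition side_integral (f : C -> R) t : R :=
  (\int[leb]_(x in `[(x0 - t)%R, (x0 + t)%R])
      (f (x +i* (y0 - t)) + f (x +i* (y0 + t)))%R)%R +
  (\int[leb]_(y in `[(y0 - t)%R, (y0 + t)%R])
      (f ((x0 - t) +i* y) + f ((x0 + t) +i* y))%R)%R.

Lemma cauchy_estimate F t : 0 < t ->
  punctured t (fun z => exists D, has_cderiv F z D) ->
  {for w, continuous F} ->
  2 * t * normc (F w) <= side_integral (fun z => normc (F z)) t.
Proof.
move=> t0 dF cF.
have cS : punctured t (fun z => {for z, continuous F}).
  by move=> x y xs ys xy; have [D /has_cderiv_continuous] := dF x y xs ys xy.
have cI : punctured t (fun z => {for z, continuous (fun z => (z - w)^-1 : C)}).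
  move=> x y xt yt xy; apply: differentiable_continuous; apply/derivable1_diffP.
  by apply: derivable_inv_punctured; exact: punctured_neq.
have cQ k : punctured t (fun z => {for z, continuous (fun z => (F z - k) * (z - w)^-1 : C)}).
  move=> x y xs ys xy.
  have [D /has_cderiv_continuous//] := has_cderiv_quotient k (dF x y xs ys xy)
    (punctured_neq xy).
have Q0 := square_integral_quotient t0 dF cF.
have := rect_integralDZ (F w) (punctured_sides t0 (cQ (F w))) (punctured_sides t0 cI).
rewrite -/(square_integral _ t) -[X in _ = X + _]/(square_integral _ t).
rewrite Q0 add0r => E.
have : 4 * normc (F w) <= normc (square_integral (fun z => (F z - 0) * (z - w)^-1) t).
  have -> : square_integral (fun z => (F z - 0) * (z - w)^-1) t =
    F w * square_integral (fun z => (z - w)^-1) t.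
    apply: etrans E.
    have -> // : (fun z => (F z - 0) * (z - w)^-1) =
      (fun z => (F z - F w) * (z - w)^-1 + F w * (z - w)^-1) :> (C -> C).
    by apply/funext => z; rewrite subr0 -mulrDl subrK.
  rewrite normcM mulrC ler_wpM2l ?normc_ge0//.
  exact: square_integral_inv_ge.
have [S1 S2 S3 S4] := punctured_sides t0 cS.
have [T1 T2 T3 T4] := punctured_sides t0 (cQ 0).
have bQ x y : (`|x - x0| = t) \/ (`|y - y0| = t) ->
    normc ((F (x +i* y) - 0) * ((x +i* y : C) - w)^-1) <= t^-1 * normc (F (x +i* y)).
  move=> xyt; rewrite subr0 normcM normcV mulrC ler_wpM2r ?normc_ge0//.
  have zw : t <= normc ((x +i* y : C) - w).
    case: xyt => <-.
      exact: (normr_Re_le ((x +i* y : C) - w)).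
    exact: (normr_Im_le ((x +i* y : C) - w)).
  by rewrite lef_pV2// posrE (lt_le_trans t0).
have iS a b f : cont_on a b f -> leb.-integrable `[a, b] (EFin \o (fun x => normc (f x)))
  by move=> ?; exact: cont_on_normc_integrable.
have tn : `|t| = t by rewrite gtr0_norm.
have Ex : x0 + t - x0 = t by ring.
have Ex' : x0 - t - x0 = - t by ring.
have Ey : y0 + t - y0 = t by ring.
have Ey' : y0 - t - y0 = - t by ring.
have iD a b f g : leb.-integrable `[a, b] (EFin \o f) ->
    leb.-integrable `[a, b] (EFin \o g) ->
    leb.-integrable `[a, b] (EFin \o (fun x => f x + g x)).
  by move=> fi gi; apply: (@integrableD _ _ _ leb _ _ (EFin \o f) (EFin \o g)).
have iZ k a b (g : R -> R) : leb.-integrable `[a, b] (EFin \o g) ->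
    leb.-integrable `[a, b] (EFin \o (fun x => k * g x)).
  by move=> ig; apply: (@integrableZl _ _ _ leb `[a, b] _ k (EFin \o g)).
have Hh : normc (cintegral (x0 - t) (x0 + t) (fun x =>
     (F (x +i* (y0 - t)) - 0) * ((x +i* (y0 - t) : C) - w)^-1 -
     (F (x +i* (y0 + t)) - 0) * ((x +i* (y0 + t) : C) - w)^-1)) <=
   2 * (t^-1 * (\int[leb]_(x in `[(x0 - t)%R, (x0 + t)%R])
      (normc (F (x +i* (y0 - t))) + normc (F (x +i* (y0 + t))))%R)%R).
  rewrite (le_trans (normc_cintegral (cont_on_hdiff T1 T2)))// ler_pM2l//.
  have iF := iD _ _ _ _ (iS _ _ _ (cont_on_hline S1)) (iS _ _ _ (cont_on_hline S2)).
  rewrite -RintegralZl//; apply: le_Rintegral => //.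
  - exact: (iS _ _ _ (cont_on_hdiff T1 T2)).
  - exact: iZ.
  - move=> x _; rewrite (le_trans (normcD _ _))// normcN mulrDr lerD//.
      by apply: bQ; right; rewrite Ey' normrN.
    by apply: bQ; right; rewrite Ey.
have Hv : normc (cintegral (y0 - t) (y0 + t) (fun y =>
     (F ((x0 + t) +i* y) - 0) * (((x0 + t) +i* y : C) - w)^-1 -
     (F ((x0 - t) +i* y) - 0) * (((x0 - t) +i* y : C) - w)^-1)) <=
   2 * (t^-1 * (\int[leb]_(y in `[(y0 - t)%R, (y0 + t)%R])
      (normc (F ((x0 - t) +i* y)) + normc (F ((x0 + t) +i* y)))%R)%R).
  rewrite (le_trans (normc_cintegral (cont_on_vdiff T3 T4)))// ler_pM2l//.
  have iF := iD _ _ _ _ (iS _ _ _ (cont_on_vline S3)) (iS _ _ _ (cont_on_vline S4)).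
  rewrite -RintegralZl//; apply: le_Rintegral => //.
  - exact: (iS _ _ _ (cont_on_vdiff T3 T4)).
  - exact: iZ.
  - move=> x _; rewrite (le_trans (normcD _ _))// normcN mulrDr addrC lerD//.
      by apply: bQ; left; rewrite Ex' normrN.
    by apply: bQ; left; rewrite Ex.
have := normcD (cintegral (x0 - t) (x0 + t) (fun x =>
     (F (x +i* (y0 - t)) - 0) * ((x +i* (y0 - t) : C) - w)^-1 -
     (F (x +i* (y0 + t)) - 0) * ((x +i* (y0 + t) : C) - w)^-1))
   ((0 +i* 1) * cintegral (y0 - t) (y0 + t) (fun y =>
     (F ((x0 + t) +i* y) - 0) * (((x0 + t) +i* y : C) - w)^-1 -
     (F ((x0 - t) +i* y) - 0) * (((x0 - t) +i* y : C) - w)^-1)).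
rewrite normcM (_ : normc (0 +i* 1) = 1); last first.
  by rewrite /= expr0n/= add0r expr1n sqrtr1.
rewrite mul1r -/(rect_integral _ _ _ _ _) -/(square_integral _ t) /side_integral.
move: Hh Hv.
move: (normc (cintegral _ _ _)) (normc (cintegral _ _ _)) (Rintegral _ _ _)
  (Rintegral _ _ _) (normc (square_integral _ _)) (normc (F w)).
move=> a b i j q f ai bj qab fq.
have : 4 * f <= t^-1 * (2 * (i + j)) by rewrite !mulrDr; lra.
rewrite [t^-1 * _]mulrC ler_pdivlMr// => ?; lra.
Qed.

End square.
End cauchy_formula.

Section holomorphic.
Context {R : realType}.
Notation C := (cplx R).
Notation leb := (@lebesgue_measure R).

Lemma upper_square (y0 t x y : R) : t < y0 -> `|y - y0| <= t ->
  upper_half_plane (x +i* y : C).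
Proof. by rewrite ler_distl /upper_half_plane/= => ty /andP[]; lra. Qed.

Lemma analytic_cderiv (F : C -> C) z : analytic_on upper_half_plane F ->
  upper_half_plane z -> exists D, has_cderiv F z D.
Proof. by move=> aF uz; apply/derivable_cderivP; exact: aF. Qed.

Lemma analytic_continuous (F : C -> C) z : analytic_on upper_half_plane F ->
  upper_half_plane z -> {for z, continuous F}.
Proof.
by move=> aF uz; have [D /has_cderiv_continuous] := analytic_cderiv aF uz.
Qed.

Lemma analytic_square (F : C -> C) (x0 y0 t : R) : analytic_on upper_half_plane F ->
  t < y0 -> punctured x0 y0 t (fun z => exists D, has_cderiv F z D).
Proof.
move=> aF ty x y _ yt _; apply: analytic_cderiv => //.
exact: (@upper_square y0 t x y ty yt).
Qed.

Lemma analytic_sqr_mean (F : C -> C) (x0 y0 t : R) :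
  analytic_on upper_half_plane F -> 0 < t -> t < y0 ->
  2 * t * normc (F (x0 +i* y0)) ^+ 2 <=
  side_integral x0 y0 (fun z => normc (F z) ^+ 2) t.
Proof.
move=> aF t0 ty.
have aF2 : analytic_on upper_half_plane (fun z => F z * F z).
  by move=> z uz; apply: derivableM; exact: aF.
have w_up : upper_half_plane (x0 +i* y0 : C) by rewrite /upper_half_plane/=; lra.
have := cauchy_estimate t0 (analytic_square (x0 := x0) aF2 ty)
  (analytic_continuous aF2 w_up).
rewrite normcM -expr2 => /le_trans; apply.
rewrite le_eqVlt; apply/orP; left; apply/eqP; congr (side_integral _ _ _ _).
by apply/funext => z; rewrite normcM expr2.
Qed.

Lemma cauchy_sup (F : C -> C) (x0 y0 t M : R) : 0 < t ->
  punctured x0 y0 t (fun z => exists D, has_cderiv F z D) ->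
  {for (x0 +i* y0 : C), continuous F} ->
  (forall x y, `|x - x0| <= t -> `|y - y0| <= t ->
     (`|x - x0| = t) \/ (`|y - y0| = t) -> normc (F (x +i* y)) <= M) ->
  normc (F (x0 +i* y0)) <= 4 * M.
Proof.
move=> t0 dF cF FM.
have cS : punctured x0 y0 t (fun z => {for z, continuous F}).
  by move=> x y xs ys xy; have [D /has_cderiv_continuous] := dF x y xs ys xy.
have [S1 S2 S3 S4] := punctured_sides t0 cS.
have iS a b f : cont_on a b f -> leb.-integrable `[a, b]
    (EFin \o (fun x => normc (f x))).
  by move=> ?; exact: cont_on_normc_integrable.
have iD a b f g : leb.-integrable `[a, b] (EFin \o f) ->
    leb.-integrable `[a, b] (EFin \o g) ->
    leb.-integrable `[a, b] (EFin \o (fun x => f x + g x)).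
  by move=> fi gi; apply: (@integrableD _ _ _ leb _ _ (EFin \o f) (EFin \o g)).
have ci a b (k : R) : leb.-integrable `[a, b] (EFin \o (fun=> k)).
  apply: continuous_compact_integrable; first exact: segment_compact.
  by apply: continuous_subspaceT => x; exact: cvg_cst.
have tn : `|t| = t by rewrite gtr0_norm.
have Em r : `|r - t - r| = t by rewrite addrAC subrr add0r normrN.
have Ep r : `|r + t - r| = t by rewrite addrAC subrr add0r.
have := cauchy_estimate t0 dF cF.
have Eq : 2 * t * (4 * M) = 2 * M * (x0 + t - (x0 - t)) + 2 * M * (y0 + t - (y0 - t)).
  by ring.
move=> H; rewrite -(@ler_pM2l _ (2 * t)) ?mulr_gt0//.
rewrite (le_trans H)// /side_integral Eq.
have l1 : x0 - t <= x0 + t by lra.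
have l2 : y0 - t <= y0 + t by lra.
rewrite -!Rintegral_itv_cst//; apply: lerD; apply: le_Rintegral => //.
- have iF := iD _ _ _ _ (iS _ _ _ (cont_on_hline S1)) (iS _ _ _ (cont_on_hline S2)).
  by [].
- move=> x /=; rewrite in_itv/= -ler_distl mulr_natl mulr2n => xt.
  by apply: lerD; apply: FM; rewrite ?Em ?Ep//; right.
- have iF := iD _ _ _ _ (iS _ _ _ (cont_on_vline S3)) (iS _ _ _ (cont_on_vline S4)).
  by [].
- move=> x /=; rewrite in_itv/= -ler_distl mulr_natl mulr2n => xt.
  by apply: lerD; apply: FM; rewrite ?Em ?Ep//; left.
Qed.

Lemma has_cderiv_local (F G : C -> C) z D (r : R) : 0 < r ->
  (forall h, normc h < r -> F (z + h) = G (z + h)) ->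
  has_cderiv F z D -> has_cderiv G z D.
Proof.
move=> r0 FG FD e e0; have [d d0 Hd] := FD e e0.
exists (Num.min d r) => [|h]; first by rewrite lt_min d0.
rewrite lt_min => /andP[hd hr]; rewrite -FG//.
have := FG 0; rewrite normc0 addr0 => <-//; exact: Hd.
Qed.

Lemma has_cderivB (F G : C -> C) z D D' : has_cderiv F z D ->
  has_cderiv G z D' -> has_cderiv (fun w => F w - G w) z (D - D').
Proof.
move=> FD GD e e0; have e2 : 0 < e / 2 by rewrite divr_gt0.
have [d d0 Hd] := FD _ e2; have [d' d'0 Hd'] := GD _ e2.
exists (Num.min d d') => [|h]; first by rewrite lt_min d0.
rewrite lt_min => /andP[/Hd h1 /Hd' h2].
have aux (a b a' b' k k' l : R[i]) : a - a' - (b - b') - (k - k') * l =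
  (a - b - k * l) - (a' - b' - k' * l) by ring.
rewrite aux (le_trans (normcD _ _))// normcN [in leRHS](splitr e) mulrDl.
exact: lerD.
Qed.

Lemma cauchy_derivative (F : C -> C) (x0 y0 t M : R) D :
  analytic_on upper_half_plane F -> 0 < t -> t < y0 ->
  has_cderiv F (x0 +i* y0) D ->
  (forall x y, `|x - x0| <= t -> `|y - y0| <= t -> normc (F (x +i* y)) <= M) ->
  normc D <= 8 * M / t.
Proof.
move=> aF t0 ty FD FM.
pose w : C := x0 +i* y0.
pose G (z : C) : C := if z == w then D else (F z - F w) * (z - w)^-1.
have Gw : G w = D by rewrite /G eqxx.
have cG : {for w, continuous G}.
  apply/continuous_cplxP => e e0; have [d d0 Hd] := FD e e0.
  exists d => // h hd; rewrite Gw /G.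
  case: ifPn => [_|]; first by rewrite subrr normc0 ltW.
  rewrite (_ : w + h - w = h); last by rewrite addrAC subrr add0r.
  move=> hw; have h0 : h != 0.
    by apply: contra hw => /eqP->; rewrite addr0.
  have aux (u k l : R[i]) : l != 0 -> u / l - k = (u - k * l) / l.
    by move=> l0; field.
  rewrite aux//.
  rewrite normcM normcV ler_pdivrMr ?normc_gt0//; exact: Hd.
rewrite -Gw (_ : 8 * M / t = 4 * (2 * M / t)); last by ring.
have w_up : normc (F w) <= M by apply: FM; rewrite subrr normr0 ltW.
apply: (cauchy_sup t0) => //.
  move=> x y xt yt xy.
  have zw := punctured_neq xy.
  have [D' HD'] := has_cderiv_quotient (F w)
    (analytic_cderiv aF (@upper_square y0 t x y ty yt)) zw.
  exists D'; apply: (@has_cderiv_local _ _ _ _ (normc ((x +i* y : C) - w))) HD'.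
    by rewrite normc_gt0.
  move=> h hz; rewrite /G; case: eqP => // E; exfalso; move: hz.
  by rewrite -E opprD addrA subrr sub0r normcN ltxx.
move=> x y xt yt xyt.
have zw : t <= normc ((x +i* y : C) - w).
  case: xyt => <-.
    exact: (normr_Re_le ((x +i* y : C) - w)).
  exact: (normr_Im_le ((x +i* y : C) - w)).
rewrite /G; case: eqP => [E|_].
  by move: zw; rewrite E subrr normc0 leNgt t0.
rewrite normcM normcV ler_pM ?normc_ge0 ?invr_ge0 ?normc_ge0//.
  by rewrite (le_trans (normcD _ _))// normcN mulr_natl mulr2n lerD// FM.
by rewrite lef_pV2// posrE (lt_le_trans t0).
Qed.

Lemma is_derive_linear_part (L : C -> R) (F : C -> C) (z h D : C) (s : R) :
  (forall u v, L (u - v) = L u - L v) -> (forall (r : R) u, L (r%:C * u) = r * L u) ->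
  (forall u, `|L u| <= normc u) ->
  has_cderiv F (z + s%:C * h) D ->
  is_derive s 1 (fun t : R => L (F (z + t%:C * h))) (L (D * h)).
Proof.
move=> LB LZ Ln FD.
have h1 : 0 < normc h + 1 by rewrite ltr_wpDl// normc_ge0.
suff E : (fun r : R => r^-1 *: (L (F (z + (r *: 1 + s)%:C * h)) - L (F (z + s%:C * h))))
    @ 0^' --> L (D * h).
  split; last exact: cvg_lim E.
  by apply/cvg_ex; exists (L (D * h)).
apply/cvgrPdist_le => e e0.
have e'0 : 0 < e / (normc h + 1) by rewrite divr_gt0.
have [d d0 Hd] := FD _ e'0.
rewrite near_withinE; apply/nbhs_ballP.
exists (d / (normc h + 1)) => /=; first by rewrite divr_gt0.
move=> r; rewrite /ball/= sub0r normrN ltr_pdivlMr// => rd r0.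
have rh : normc (r%:C * h) < d.
  by rewrite normcM normc_normr (le_lt_trans _ rd)// ler_wpM2l// lerDl.
have := Hd _ rh.
have -> : z + s%:C * h + r%:C * h = z + (r + s)%:C * h.
  by rewrite rmorphD/= mulrDl addrAC addrA.
rewrite {1}/GRing.scale/= {1}/GRing.scale/= mulr1 => H.
have -> : L (D * h) - r^-1 * (L (F (z + (r + s)%:C * h)) - L (F (z + s%:C * h))) =
  - (r^-1 * L (F (z + (r + s)%:C * h) - F (z + s%:C * h) - D * (r%:C * h))).
  rewrite !LB (mulrCA D) LZ; field; exact: r0.
rewrite normrN normrM normfV ler_pdivrMl ?normr_gt0//.
rewrite (le_trans (Ln _))// (le_trans H)//.
rewrite normcM normc_normr mulrCA ler_wpM2l//.
by rewrite mulrAC ler_pdivrMr// ler_wpM2l ?(ltW e0)// lerDl.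
Qed.

Lemma mean_value_part (L : C -> R) (F : C -> C) (z h : C) (M : R) :
  (forall u v, L (u - v) = L u - L v) -> (forall (r : R) u, L (r%:C * u) = r * L u) ->
  (forall u, `|L u| <= normc u) ->
  (forall s : R, 0 <= s <= 1 -> exists2 D, has_cderiv F (z + s%:C * h) D & normc D <= M) ->
  `|L (F (z + h)) - L (F z)| <= M * normc h.
Proof.
move=> LB LZ Ln FD.
have /choice[D HD] : forall s : R, exists d : C, 0 <= s <= 1 ->
    has_cderiv F (z + s%:C * h) d /\ normc d <= M.
  move=> s; have [/FD[d ? ?]|n01] := boolP (0 <= s <= 1); first by exists d.
  by exists 0.
have fD (s : R) : s \in `[0, 1] ->
    is_derive s 1 (fun t : R => L (F (z + t%:C * h))) (L (D s * h)).
  by rewrite in_itv/= => /HD[H _]; exact: (is_derive_linear_part LB LZ Ln H).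
pose f (t : R) : R := L (F (z + t%:C * h)).
pose df (s : R) : R := L (D s * h).
have fdf (s : R) : s \in `]0, 1[ -> is_derive s 1 f (df s).
  by move=> /subset_itv_oo_cc; exact: fD.
have cf : {within `[0, 1], continuous f}.
  by apply: derivable_within_continuous => s /fD[].
have [c c01] := MVT_segment ler01 fdf cf.
rewrite /f /df.
rewrite subr0 mulr1.
have -> : z + 1%:C * h = z + h by rewrite rmorph1 mul1r.
have -> : z + 0%:C * h = z by rewrite rmorph0 mul0r addr0.
move=> ->; rewrite (le_trans (Ln _))// normcM ler_wpM2r ?normc_ge0//.
by move: c01; rewrite in_itv/= => /HD[].
Qed.

Lemma mean_value (F : C -> C) (z h : C) (M : R) :
  (forall s : R, 0 <= s <= 1 -> exists2 D, has_cderiv F (z + s%:C * h) D & normc D <= M) ->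
  normc (F (z + h) - F z) <= 2 * M * normc h.
Proof.
move=> FD; rewrite (le_trans (normc_le_ReIm _))// -mulrA mulr_natl mulr2n.
have ReB (u v : C) : complex.Re (u - v) = complex.Re u - complex.Re v.
  by case: u v => ? ? [].
have ImB (u v : C) : complex.Im (u - v) = complex.Im u - complex.Im v.
  by case: u v => ? ? [].
rewrite ReB ImB lerD//; apply: mean_value_part => //.
- by move=> r [p q] /=; rewrite mul0r subr0.
- exact: normr_Re_le.
- by move=> r [p q] /=; rewrite mul0r addr0.
- exact: normr_Im_le.
Qed.

Lemma cauchy_lipschitz (F : C -> C) (x0 y0 t M : R) h :
  analytic_on upper_half_plane F -> 0 < t -> 2 * t < y0 ->
  (forall x y, `|x - x0| <= 2 * t -> `|y - y0| <= 2 * t -> normc (F (x +i* y)) <= M) ->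
  normc h <= t ->
  normc (F ((x0 +i* y0) + h) - F (x0 +i* y0)) <= 16 * M / t * normc h.
Proof.
move=> aF t0 ty FM ht.
rewrite (_ : 16 * M / t = 2 * (8 * M / t)); last by ring.
apply: mean_value => s /andP[s0 s1].
have [ReH ImH] : `|complex.Re (s%:C * h)| <= t /\ `|complex.Im (s%:C * h)| <= t.
  have sh : normc (s%:C * h) <= t.
    rewrite normcM normc_normr ger0_norm// (le_trans _ ht)//.
    by rewrite ler_piMl// normc_ge0.
  by split; rewrite (le_trans _ sh)// ?normr_Re_le ?normr_Im_le.
case: (s%:C * h) ReH ImH => p q /= pt qt.
have tq : t < y0 + q by move: qt; rewrite ler_norml => /andP[? ?]; lra.
have [D HD] : exists D, has_cderiv F ((x0 + p) +i* (y0 + q)) D.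
  by apply: analytic_cderiv => //; rewrite /upper_half_plane/=; lra.
exists D => //; apply: (cauchy_derivative aF t0 tq HD) => x y xt yt.
apply: FM.
  by rewrite (_ : x - x0 = (x - (x0 + p)) + p) ?(le_trans (ler_normD _ _))//; [lra|ring].
by rewrite (_ : y - y0 = (y - (y0 + q)) + q) ?(le_trans (ler_normD _ _))//; [lra|ring].
Qed.

End holomorphic.

Section limits.
Context {R : realType}.
Notation C := (cplx R).
Notation leb := (@lebesgue_measure R).

Lemma cauchy_seq_ex (u a : nat -> R) : (forall n m, `|u n - u m| <= a n + a m) ->
  exists l, forall n, `|u n - l| <= a n.
Proof.
move=> ua.
have uam n m : u n - a n <= u m + a m.
  by have := ua n m; rewrite ler_norml => /andP[_]; lra.
exists (sup (range (fun n => u n - a n))) => n.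
have h1 : u n - a n <= sup (range (fun n => u n - a n)).
  apply: ub_le_sup; last by exists n.
  by exists (u 0 + a 0) => _ [m _ <-]; exact: uam.
have h2 : sup (range (fun n => u n - a n)) <= u n + a n.
  apply: ge_sup; first by exists (u 0 - a 0); exists 0%N.
  by move=> _ [m _ <-]; exact: uam.
by rewrite ler_norml; apply/andP; split; lra.
Qed.

Lemma cauchy_cseq_ex (u : nat -> C) (a : nat -> R) :
  (forall n m, normc (u n - u m) <= a n + a m) ->
  exists l, forall n, normc (u n - l) <= 2 * a n.
Proof.
move=> ua.
have ReB (p q : C) : complex.Re (p - q) = complex.Re p - complex.Re q.
  by case: p q => ? ? [].
have ImB (p q : C) : complex.Im (p - q) = complex.Im p - complex.Im q.
  by case: p q => ? ? [].
have [|l1 H1] := @cauchy_seq_ex (fun n => complex.Re (u n)) a.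
  by move=> n m; rewrite -ReB (le_trans (normr_Re_le _)).
have [|l2 H2] := @cauchy_seq_ex (fun n => complex.Im (u n)) a.
  by move=> n m; rewrite -ImB (le_trans (normr_Im_le _)).
exists (l1 +i* l2) => n; rewrite (le_trans (normc_le_ReIm _))//.
by rewrite ReB ImB mulr_natl mulr2n lerD.
Qed.

Lemma weierstrass (F : nat -> C -> C) (G : C -> C) (e : nat -> R) (K : R -> R) :
  (forall n, analytic_on upper_half_plane (F n)) ->
  (forall n, 0 <= e n) -> (forall eps, 0 < eps -> exists n, e n <= eps) ->
  (forall y y', 0 < y -> y <= y' -> K y' <= K y) ->
  (forall n x y, 0 < y -> normc (F n (x +i* y) - G (x +i* y)) <= e n * K y) ->
  analytic_on upper_half_plane G.
Proof.
move=> aF e0 e_to0 Kni FG [x0 y0]; rewrite /upper_half_plane/= => y00.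
pose t := y0 / 8.
have t0 : 0 < t by rewrite divr_gt0.
have ty : 2 * t < y0 by rewrite /t; lra.
pose M n := e n * K (y0 / 2).
have FM n m x y : `|x - x0| <= 2 * t -> `|y - y0| <= 2 * t ->
    normc (F n (x +i* y) - F m (x +i* y)) <= M n + M m.
  move=> _; rewrite ler_distl => /andP[yt _].
  have y2 : y0 / 2 <= y by rewrite /t in yt; lra.
  have y_gt0 : 0 < y by lra.
  have -> : F n (x +i* y) - F m (x +i* y) =
    (F n (x +i* y) - G (x +i* y)) - (F m (x +i* y) - G (x +i* y)).
    by rewrite opprB addrA subrK.
  rewrite (le_trans (normcD _ _))// normcN lerD// (le_trans (FG _ _ _ y_gt0))//.
    by rewrite ler_wpM2l// Kni// divr_gt0.
  by rewrite ler_wpM2l// Kni// divr_gt0.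
have aFB n m : analytic_on upper_half_plane (fun z => F n z - F m z).
  by move=> z uz; exact: (derivableB (aF n z uz) (aF m z uz)).
have Lip n m h : normc h <= t ->
    normc ((F n (x0 +i* y0 + h) - F m (x0 +i* y0 + h)) -
      (F n (x0 +i* y0) - F m (x0 +i* y0))) <= 16 * (M n + M m) / t * normc h.
  by move=> ht; exact: (cauchy_lipschitz (aFB n m) t0 ty (FM n m) ht).
have /choice[D HD] n : exists D, has_cderiv (F n) (x0 +i* y0) D.
  exact: analytic_cderiv.
have Dnm n m : normc (D n - D m) <= 8 * M n / t + 8 * M m / t.
  rewrite -mulrDl -mulrDr; apply: (@cauchy_derivative R (fun z => F n z - F m z) x0 y0).
  - exact: aFB.
  - exact: t0.
  - by lra.
  - exact: has_cderivB.
  - by move=> x y xt yt; apply: FM; lra.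
have [L HL] := cauchy_cseq_ex Dnm.
have M_to0 eps : 0 < eps -> exists n, M n <= eps.
  move=> eps0; have K1 : 0 < Num.max (K (y0 / 2)) 1 by rewrite lt_max ltr01 orbT.
  have [n en] := e_to0 (eps / Num.max (K (y0 / 2)) 1) (divr_gt0 eps0 K1).
  exists n; rewrite /M (@le_trans _ _ (e n * Num.max (K (y0 / 2)) 1))//.
    by rewrite ler_wpM2l// le_max lexx.
  by rewrite -ler_pdivlMr.
have LipG n h : normc h <= t ->
    normc ((F n (x0 +i* y0 + h) - G (x0 +i* y0 + h)) -
      (F n (x0 +i* y0) - G (x0 +i* y0))) <= 16 * M n / t * normc h.
  move=> ht; apply/ler_addgt0Pr => eps eps0.
  have hn := normc_ge0 h.
  have [m Mm] := M_to0 (eps / 18) (divr_gt0 eps0 (ltr0Sn _ _)).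
  have FGm (z : C) : y0 / 2 <= complex.Im z -> normc (F m z - G z) <= M m.
    case: z => x y /= yy; have y_gt0 : 0 < y by lra.
    by rewrite (le_trans (FG _ _ _ y_gt0))// ler_wpM2l// Kni// divr_gt0.
  have dec (a b a' b' c c' : R[i]) : (a - b) - (a' - b') =
    ((a - c) - (a' - c')) + ((c - b) - (c' - b')) by ring.
  rewrite (dec _ _ _ _ (F m (x0 +i* y0 + h)) (F m (x0 +i* y0))).
  rewrite (le_trans (normcD _ _))//.
  have H1 : normc (F m (x0 +i* y0 + h) - G (x0 +i* y0 + h) -
      (F m (x0 +i* y0) - G (x0 +i* y0))) <= 2 * (eps / 18).
    rewrite (le_trans (normcD _ _))// normcN mulr_natl mulr2n lerD//.
      rewrite (le_trans _ Mm)// FGm//=.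
      have := normr_Im_le h; case: h ht {hn} => p q ht /= hq.
      have : `|q| <= t by exact: le_trans hq ht.
      by rewrite ler_norml /t => /andP[]; lra.
    by rewrite (le_trans _ Mm)// FGm//=; lra.
  have H2 := Lip n m h ht.
  have H3 : 16 * (M n + M m) / t * normc h <= 16 * M n / t * normc h + 16 * (eps / 18).
    rewrite mulrDr mulrDl mulrDl lerD2l.
    have ht1 : normc h / t <= 1 by rewrite ler_pdivrMr// mul1r.
    have ht0 : 0 <= normc h / t by rewrite divr_ge0// ltW.
    rewrite mulrAC -mulrA -mulrA ler_pM2l// (le_trans (ler_wpM2r ht0 Mm))//.
    by rewrite ler_piMr// divr_ge0// ltW.
  rewrite (le_trans (lerD (le_trans H2 H3) H1))// -addrA lerD2l; lra.
apply/derivable_cderivP; exists L => eps eps0.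
have eps3 : 0 < eps / 3 by rewrite divr_gt0.
have [n Mn] := M_to0 (eps / 3 * t / 16) (divr_gt0 (mulr_gt0 eps3 t0) (ltr0Sn _ _)).
have [d d0 Hd] := HD n (eps / 3) eps3.
exists (Num.min d t) => [|h]; first by rewrite lt_min d0.
rewrite lt_min => /andP[/Hd hd /ltW /(LipG n) ht].
have hn := normc_ge0 h.
have dec (a b a' b' k l : R[i]) : a - b - l * h =
    - ((a' - a) - (b' - b)) + (a' - b' - k * h) + (k - l) * h by ring.
rewrite (dec _ _ (F n (x0 +i* y0 + h)) (F n (x0 +i* y0)) (D n)).
rewrite (le_trans (normcD _ _))//.
rewrite (_ : eps = eps / 3 + eps / 3 + eps / 3); last by field.
rewrite [leRHS]mulrDl lerD//.
  rewrite (le_trans (normcD _ _))// [leRHS]mulrDl lerD// normcN (le_trans ht)//.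
  rewrite ler_wpM2r// ler_pdivrMr//; lra.
rewrite normcM ler_wpM2r// (le_trans (HL n))// mulrA ler_pdivrMr//; lra.
Qed.

End limits.

(** * Weighted norms of slices *)

Section affine_substitution.
Context {R : realType}.
Notation leb := (@lebesgue_measure R).
Local Open Scope ereal_scope.

Let aff (a c : R) (x : measurableTypeR R) : measurableTypeR R :=
  (a * (x : R) + c)%R.

Let measurable_aff a c : measurable_fun [set: measurableTypeR R] (aff a c).
Proof.
by apply: continuous_measurable_fun => x; apply: cvgD;
  [apply: cvgMr; exact: cvg_id|exact: cvg_cst].
Qed.

Lemma lebesgue_measure_affine (a c : R) (a0 : a != 0%R) (A : set R) :
  measurable A ->
  leb A = `|a|%:E * leb ((fun x => a * x + c)%R @^-1` A).
Proof.
move=> mA.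
pose M : {measure set (measurableTypeR R) -> \bar R} :=
  measure_function_pushforward__canonical__measure_function_Measure leb (measurable_aff a c).
rewrite (@lebesgue_measure_unique R (mscale (NngNum (normr_ge0 a)) M)) //.
move=> _ [[u v]] _ <-.
rewrite /= /mscale/= /pushforward.
have [an|ap] := ltP a 0%R.
  have -> : aff a c @^-1` `]u, v] = `[((v - c) / a)%R, ((u - c) / a)%R[%classic.
    apply/seteqP; split=> x /=; rewrite !in_itv/= /aff ltr_ndivlMr// ler_ndivrMr//;
      by rewrite ltrBlDr lerBrDr (mulrC a) andbC.
  rewrite !lebesgue_measure_itv/= !lte_fin ltr_nM2r ?invr_lt0// ltrD2r.
  case: ifPn => _; rewrite ?mule0// -!EFinB -EFinM ltr0_norm//; congr EFin.
  by field.
have {}ap : (0 < a)%R by rewrite lt_neqAle eq_sym a0.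
have -> : aff a c @^-1` `]u, v] = `]((u - c) / a)%R, ((v - c) / a)%R]%classic.
  apply/seteqP; split=> x /=; rewrite !in_itv/= /aff ltr_pdivrMr// ler_pdivlMr//;
    by rewrite ltrBlDr lerBrDr (mulrC a).
rewrite !lebesgue_measure_itv/= !lte_fin ltr_pM2r ?invr_gt0// ltrD2r.
case: ifPn => _; rewrite ?mule0// -!EFinB -EFinM gtr0_norm//; congr EFin.
by field.
Qed.

Lemma ge0_integral_affine_neq0 (a c : R) (f : R -> \bar R) : a != 0%R ->
  measurable_fun setT f -> (forall x, 0 <= f x) ->
  \int[leb]_x f x = `|a|%:E * \int[leb]_x f (a * x + c)%R.
Proof.
move=> a0 mf f0.
pose M : {measure set (measurableTypeR R) -> \bar R} :=
  measure_function_pushforward__canonical__measure_function_Measure leb (measurable_aff a c).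
transitivity (\int[mscale (NngNum (normr_ge0 a)) M]_x f x).
  apply: eq_measure_integral => A mA _.
  exact: (lebesgue_measure_affine c a0 mA).
rewrite ge0_integral_mscale//=; congr (_ * _).
exact: (ge0_integral_pushforward (measurable_aff a c) leb measurableT mf
  (fun y _ => f0 y)).
Qed.

Lemma ge0_integral_affine (a c : R) (f : R -> \bar R) : (0 < a)%R ->
  measurable_fun setT f -> (forall x, 0 <= f x) ->
  \int[leb]_x f x = a%:E * \int[leb]_x f (a * x + c)%R.
Proof.
move=> a0 mf f0; rewrite (@ge0_integral_affine_neq0 a c)// ?gt_eqF//.
by rewrite gtr0_norm.
Qed.

End affine_substitution.

Section power_integrals.
Context {R : realType}.
Notation leb := (@lebesgue_measure R).
Local Open Scope ereal_scope.

Lemma integral_powR_le (al b : R) : (-1 < al)%R -> (0 < b)%R ->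
  \int[leb]_(y in `]0%R, b]) (y `^ al)%:E <= (b `^ (al + 1) / (al + 1))%:E.
Proof.
move=> al1 b0; have al10 : (0 < al + 1)%R by lra.
pose F n : set R := `[(b / n.+1%:R)%R, b]%classic.
have FE : \bigcup_n F n = `]0%R, b]%classic.
  apply/seteqP; split => [y [n _]|y].
    rewrite /F/= !in_itv/= => /andP[y0 yb].
    by rewrite (lt_le_trans _ y0)// divr_gt0.
  rewrite /= in_itv/= => /andP[y0 yb].
  have [n yn] : exists n : nat, (b / y < n.+1%:R)%R.
    exists (Num.truncn (b / y)).
    by have /andP[] := truncn_itv (divr_ge0 (ltW b0) (ltW y0)).
  exists n => //; rewrite /F/= in_itv/= yb andbT ler_pdivrMr//.
  by rewrite ltr_pdivrMr// in yn; rewrite mulrC ltW.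
have mp : measurable_fun setT (fun y : R => (y `^ al)%:E).
  by apply/measurable_EFinP; exact: measurable_powR.
have cvF : \int[leb]_(y in F n) (y `^ al)%:E @[n --> \oo] -->
    \int[leb]_(y in \bigcup_n F n) (y `^ al)%:E.
  apply: ge0_nondecreasing_set_cvg_integral => //.
  - move=> m n mn; apply/subsetPset => y; rewrite /F/= !in_itv/= => /andP[my ->].
    rewrite andbT (le_trans _ my)// ler_pM2l// lef_pV2 ?posrE//.
    by rewrite ler_nat ltnS.
  - by move=> n; exact: measurable_itv.
  - by move=> n; exact: measurable_funTS.
  - by move=> n y _; rewrite lee_fin powR_ge0.
rewrite -FE -(cvg_lim _ cvF)//; apply: lime_le; first by apply/cvg_ex; eexists; exact: cvF.
near=> n.
have [->|n0] := eqVneq n 0%N.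
  rewrite /F divr1 set_itv1 integral_set1 lee_fin divr_ge0 ?powR_ge0// ltW//.
have bn : (b / n.+1%:R < b)%R.
  by rewrite ltr_pdivrMr// ltr_pMr// ltr1n ltnS lt0n.
have bn0 : (0 < b / n.+1%:R)%R by rewrite divr_gt0.
pose G (y : R) : R := (y `^ (al + 1) / (al + 1))%R.
have dG (y : R) : (0 < y)%R -> is_derive y 1%R G (y `^ al)%R.
  move=> y0; have D := @is_derive1_powR R (al + 1) y y0.
  have -> : (y `^ al = (al + 1)^-1 *: ((al + 1) * y `^ (al + 1 - 1)))%R.
    by rewrite /GRing.scale/= mulrA mulVf ?mul1r ?addrK// gt_eqF.
  have -> : G = ((al + 1)^-1 \*: (fun y : R => y `^ (al + 1)))%R.
    by apply/funext => z; rewrite /G /= /GRing.scale/= mulrC.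
  exact: is_deriveZ.
have cG (y : R) : (0 < y)%R -> {for y, continuous G}.
  by move=> /dG[dGy _]; exact/differentiable_continuous/derivable1_diffP.
have := @continuous_FTC2 R (fun y => y `^ al)%R G _ _ bn.
move=> ->.
- rewrite -EFinB lee_fin lerBlDr lerDl divr_ge0 ?powR_ge0// ltW//.
- apply: derivable_within_continuous => y; rewrite in_itv/= => /andP[y1 _].
  by apply: derivable_powR; rewrite in_itv/= andbT (lt_le_trans bn0).
- split.
  + move=> y; rewrite in_itv/= => /andP[y1 _].
    by have [] := dG y (lt_trans bn0 y1).
  + by apply: cvg_at_right_filter; exact: cG.
  + by apply: cvg_at_left_filter; exact: cG.
- move=> y; rewrite in_itv/= => /andP[y1 _].
  have D := dG y (lt_trans bn0 y1).
  by rewrite derive1E derive_val.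
Unshelve. all: by end_near. Qed.

Lemma integral_oneDsqr_lty :
  \int[leb]_x ((1 + x ^+ 2)^-1)%:E < +oo.
Proof.
have cf : continuous (fun x : R => (1 + x ^+ 2)^-1)%R.
  move=> x; apply: cvgV; first by rewrite gt_eqF// ltr_wpDr// sqr_ge0.
  by apply: cvgD; [exact: cvg_cst|exact: exprn_continuous].
rewrite ge0_symfun_integralT//.
- rewrite -set_itvcy; have := @integral0y_oneDsqr R; rewrite /oneDsqr => ->.
  by rewrite -EFinM ltry.
- by move=> x; rewrite invr_ge0 addr_ge0// sqr_ge0.
- by move=> x /=; rewrite sqrrN.
Qed.

End power_integrals.

Section weights.
Context {R : realType} (alpha : R).
Hypothesis alpha_ge : -1 <= alpha.
Notation leb := (@lebesgue_measure R).
Local Open Scope ereal_scope.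

(* The weight of [y |-> \int |F (x + iy)|^2 dx] is the square of the norm of F;
   the supremum is the Hardy case. *)
Definition weight (M : R -> \bar R) : \bar R :=
  if alpha == (-1)%R then ereal_sup [set M y | y in [set y | (0 < y)%R]]
  else \int[leb]_(y in `]0%R, +oo[) (M y * (y `^ alpha)%:E).

Definition nnm (M : R -> \bar R) := measurable_fun setT M /\ forall y, 0 <= M y.

Lemma alpha_gt : (alpha == (-1)%R) = false -> (-1 < alpha)%R.
Proof. by move=> a1; rewrite lt_neqAle eq_sym a1. Qed.

Lemma measurable_EFin_powR (b : R) :
  measurable_fun setT (fun y : R => (y `^ b)%:E).
Proof. by apply/measurable_EFinP; exact: measurable_powR. Qed.

Lemma measurable_weighted (M : R -> \bar R) (D : set R) : nnm M ->
  measurable_fun D (fun y => M y * (y `^ alpha)%:E).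
Proof.
move=> [mM M0]; apply: measurable_funTS; apply: emeasurable_funM => //.
exact: measurable_EFin_powR.
Qed.

Lemma weighted_ge0 M y : nnm M -> 0 <= M y * (y `^ alpha)%:E.
Proof. by move=> [_ M0]; rewrite mule_ge0// lee_fin powR_ge0. Qed.

Lemma weight_ge0 M : nnm M -> 0 <= weight M.
Proof.
move=> nM; rewrite /weight; case: ifP => _.
  apply: (le_trans (nM.2 1%R)); apply: ereal_sup_ubound.
  by exists 1%R => //=; exact: ltr01.
by apply: integral_ge0 => y _; exact: weighted_ge0.
Qed.

Lemma le_weight M N : nnm M -> nnm N -> (forall y, (0 < y)%R -> M y <= N y) ->
  weight M <= weight N.
Proof.
move=> nM nN MN; rewrite /weight; case: ifP => _.
  apply: ge_ereal_sup => _ [y /= y0 <-]; apply: (le_trans (MN y y0)).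
  by apply: ereal_sup_ubound; exists y.
apply: ge0_le_integral => //.
- by move=> y _; exact: weighted_ge0.
- exact: measurable_weighted.
- exact: measurable_weighted.
- move=> y /=; rewrite in_itv/= andbT => y0.
  by rewrite lee_wpmul2r ?lee_fin ?powR_ge0// MN.
Qed.

Lemma nnm_affine (a c : R) M : nnm M -> nnm (fun y => M (a * y + c)%R).
Proof.
move=> [mM M0]; split => // ; apply: (measurableT_comp mM).
apply: continuous_measurable_fun => x; apply: cvgD; last exact: cvg_cst.
by apply: cvgMr; exact: cvg_id.
Qed.

Lemma weightZ (c : R) M : (0 <= c)%R -> nnm M ->
  weight (fun y => c%:E * M y) <= c%:E * weight M.
Proof.
move=> c0 nM; rewrite /weight; case: ifP => _.
  apply: ge_ereal_sup => _ [y /= y0 <-]; rewrite lee_wpmul2l ?lee_fin//.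
  by apply: ereal_sup_ubound; exists y.
rewrite le_eqVlt; apply/orP; left; apply/eqP.
rewrite -ge0_integralZl//=; [|exact: measurable_weighted|by move=> y _; exact: weighted_ge0].
by apply: eq_integral => y _; rewrite muleA.
Qed.

Lemma weightD M N : nnm M -> nnm N ->
  weight (fun y => M y + N y) <= weight M + weight N.
Proof.
move=> nM nN; rewrite /weight; case: ifP => _.
  apply: ge_ereal_sup => _ [y /= y0 <-]; apply: leeD.
    by apply: ereal_sup_ubound; exists y.
  by apply: ereal_sup_ubound; exists y.
rewrite -ge0_integralD//=; [|by move=> y _; exact: weighted_ge0
  |exact: measurable_weighted|by move=> y _; exact: weighted_ge0
  |exact: measurable_weighted].
rewrite le_eqVlt; apply/orP; left; apply/eqP.
by apply: eq_integral => y _; rewrite ge0_muleDl// ?nM.2 ?nN.2.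
Qed.

Lemma integral_gt0_mkcond (f : R -> \bar R) :
  \int[leb]_(y in `]0%R, +oo[) f y =
  \int[leb]_y (f y * (\1_(`]0%R, +oo[%classic : set R) y)%:E).
Proof.
rewrite integral_mkcond; apply: eq_integral => y _.
by rewrite patchE indicE; case: ifPn => _; rewrite ?mule1 ?mule0.
Qed.

Lemma measurable_EFin_indic (D : set R) : measurable D ->
  measurable_fun setT (fun y : R => (\1_D y)%:E : \bar R).
Proof. by move=> mD; apply/measurable_EFinP; exact: measurable_indic. Qed.

Lemma weight_scale (a : R) M : (0 < a)%R -> nnm M ->
  weight (fun y => M (a * y)%R) <= (a `^ (- (alpha + 1)))%:E * weight M.
Proof.
move=> a0 nM; have a1 : a != 0%R by rewrite gt_eqF.
rewrite /weight; case: ifPn => [/eqP->|_].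
  rewrite addNr oppr0 powRr0 mul1e; apply: ge_ereal_sup => _ [y /= y0 <-].
  by apply: ereal_sup_ubound; exists (a * y)%R => //=; rewrite mulr_gt0.
have mh := emeasurable_funM (@measurable_weighted M setT nM)
  (measurable_EFin_indic (measurable_itv `]0%R, +oo[)).
have h0 y : 0 <= M y * (y `^ alpha)%:E * (\1_(`]0%R, +oo[%classic : set R) y)%:E.
  by rewrite mule_ge0 ?weighted_ge0// lee_fin.
rewrite [X in _ <= _ * X]integral_gt0_mkcond (ge0_integral_affine 0 a0 mh h0).
rewrite muleA -EFinM.
rewrite -[X in (_ * X)%:E](powRr1 (ltW a0)) -powRD ?a1 ?implybT//.
rewrite (_ : - (alpha + 1) + 1 = - alpha)%R; last by ring.
rewrite -ge0_integralZl//=; last first.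
  by rewrite lee_fin powR_ge0.
- apply: (measurableT_comp mh).
  apply: continuous_measurable_fun => x; apply: cvgD; last exact: cvg_cst.
  by apply: cvgMr; exact: cvg_id.
rewrite integral_gt0_mkcond le_eqVlt; apply/orP; left; apply/eqP.
apply: eq_integral => y _; rewrite addr0 !indicE !mem_setE !in_itv/= !andbT.
rewrite pmulr_rgt0//; case: ltP => y0; last by rewrite !mule0.
rewrite !mule1 muleCA; congr (_ * _).
by rewrite powRM ?(ltW a0) ?(ltW y0)// -EFinM mulrA -powRD ?a1 ?implybT// addNr powRr0 mul1r.
Qed.

Lemma powR_itv_ge (v y c1 c2 : R) : (0 < y)%R -> (0 < c1)%R ->
  (c1 * y <= v <= c2 * y)%R ->
  (Num.min (c1 `^ alpha) (c2 `^ alpha) * y `^ alpha <= v `^ alpha)%R.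
Proof.
move=> y0 c10 /andP[cv vc].
have v0 : (0 < v)%R by rewrite (lt_le_trans _ cv)// mulr_gt0.
have c20 : (0 < c2)%R by rewrite -(pmulr_lgt0 _ y0) (lt_le_trans v0).
have [a0|a0] := leP 0%R alpha.
  apply: (@le_trans _ _ (c1 `^ alpha * y `^ alpha)%R).
    by rewrite ler_wpM2r ?powR_ge0// ge_min lexx.
  by rewrite -powRM ?(ltW c10) ?(ltW y0)// ge0_ler_powR// nnegrE ltW// mulr_gt0.
apply: (@le_trans _ _ (c2 `^ alpha * y `^ alpha)%R).
  by rewrite ler_wpM2r ?powR_ge0// ge_min lexx orbT.
have powN (z : R) : (z `^ alpha = (z `^ (- alpha))^-1)%R by rewrite -powRN opprK.
rewrite -powRM ?(ltW c20) ?(ltW y0)// !powN.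
rewrite lef_pV2 ?posrE ?powR_gt0// ?mulr_gt0//.
by rewrite ge0_ler_powR// ?nnegrE ?oppr_ge0 ltW// mulr_gt0.
Qed.

Lemma weight_window : exists2 K : R, (0 < K)%R & forall M (y : R), nnm M ->
  (0 < y)%R -> \int[leb]_(v in `[(y / 2)%R, (5 / 2 * y)%R]) M v <=
  (K * y `^ (- alpha))%:E * weight M.
Proof.
have [a1|a1] := boolP (alpha == (-1)%R).
  exists 2%R => // M y nM y0; rewrite /weight a1 (eqP a1) opprK powRr1 ?(ltW y0)//.
  set W := ereal_sup _.
  apply: (@le_trans _ _ (\int[leb]_(v in `[(y / 2)%R, (5 / 2 * y)%R]) (cst W v))).
    apply: ge0_le_integral => //.
    + by move=> v _; exact: nM.2.
    + by apply: measurable_funTS; exact: nM.1.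
    + move=> v /=; rewrite in_itv/= => /andP[yv _]; apply: ereal_sup_ubound.
      by exists v => //=; rewrite (lt_le_trans _ yv)// divr_gt0.
  rewrite integral_cst//= lebesgue_measure_itv/= lte_fin.
  rewrite (_ : (y / 2 < 5 / 2 * y)%R = true); last by apply/idP; lra.
  rewrite -EFinB muleC le_eqVlt; apply/orP; left; apply/eqP; congr (_%:E * _).
  by field.
pose k : R := (Num.min (2^-1 `^ alpha) ((5 / 2) `^ alpha))%R.
have k0 : (0 < k)%R by rewrite lt_min !powR_gt0// ?invr_gt0// divr_gt0.
exists (k^-1)%R; first by rewrite invr_gt0.
move=> M y nM y0; rewrite /weight (negbTE a1).
have ya0 : (0 < y `^ alpha)%R by rewrite powR_gt0.
rewrite powRN -invfM lee_pdivlMl ?mulr_gt0//.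
rewrite -ge0_integralZl//=; last first.
- by rewrite lee_fin ltW// mulr_gt0.
- by move=> v _; exact: nM.2.
- by apply: measurable_funTS; exact: nM.1.
apply: (@le_trans _ _ (\int[leb]_(v in `[(y / 2)%R, (5 / 2 * y)%R]) (M v * (v `^ alpha)%:E))).
  apply: ge0_le_integral => //.
  - by move=> v _; rewrite mule_ge0 ?nM.2// lee_fin ltW// mulr_gt0.
  - apply: emeasurable_funM; first exact: measurable_cst.
    by apply: measurable_funTS; exact: nM.1.
  - exact: measurable_weighted.
  - move=> v /=; rewrite in_itv/= mulrC => yv; rewrite muleC.
    by rewrite lee_wpmul2l ?nM.2// lee_fin powR_itv_ge// invr_gt0.
apply: ge0_subset_integral => //.
- exact: measurable_weighted.
- by move=> v _; exact: weighted_ge0.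
- move=> v /=; rewrite !in_itv/= andbT => /andP[yv _].
  by rewrite (lt_le_trans _ yv)// divr_gt0.
Qed.

Definition quasi_mean (M : R -> \bar R) := forall v t : R, (0 < t)%R -> (t < v)%R ->
  t%:E * M v <= 10 * \int[leb]_(u in `[(v - t)%R, (v + t)%R]) M u.

Lemma weight_shift : exists2 K : R, (0 < K)%R & forall M (b : R), nnm M ->
  quasi_mean M -> (0 < b)%R -> weight (fun y => M (y + b)%R) <= K%:E * weight M.
Proof.
have [a1|a1] := boolP (alpha == (-1)%R).
  exists 1%R => // M b nM _ b0; rewrite mul1e /weight a1.
  apply: ge_ereal_sup => _ [y /= y0 <-]; apply: ereal_sup_ubound.
  by exists (y + b)%R => //=; rewrite addr_gt0.
have al1 : (-1 < alpha)%R by apply: alpha_gt; exact: negbTE.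
have al10 : (0 < alpha + 1)%R by lra.
have [K K0 HK] := weight_window.
pose k : R := (Num.min (1 `^ alpha) (2 `^ alpha))%R.
have k0 : (0 < k)%R by rewrite lt_min !powR_gt0.
exists (k^-1 + 20 * K / (alpha + 1))%R.
  by rewrite addr_gt0 ?invr_gt0// divr_gt0// mulr_gt0.
move=> M b nM qM b0.
set I := \int[leb]_(v in `[(b / 2)%R, (5 / 2 * b)%R]) M v.
have I0 : 0 <= I by apply: integral_ge0 => v _; exact: nM.2.
pose h y := M y * (y `^ alpha)%:E * (\1_(`]0%R, +oo[%classic : set R) y)%:E.
have mh : measurable_fun setT h := emeasurable_funM (@measurable_weighted M setT nM)
  (measurable_EFin_indic (measurable_itv `]0%R, +oo[)).
have h0 y : 0 <= h y by rewrite mule_ge0 ?weighted_ge0// lee_fin.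
have mhb : measurable_fun setT (fun y : R => h (1 * y + b)%R).
  apply: (measurableT_comp mh).
  apply: continuous_measurable_fun => x; apply: cvgD; last exact: cvg_cst.
  by apply: cvgMr; exact: cvg_id.
have IW : I <= (K * b `^ (- alpha))%:E * weight M by exact: HK.
pose g1 y := k^-1%:E * h (1 * y + b)%R.
pose g2 y := (20 / b)%:E * I * ((y `^ alpha)%:E * (\1_(`]0%R, b]%classic : set R) y)%:E).
have mg1 D : measurable_fun D g1.
  by apply: measurable_funTS; apply: emeasurable_funM => //; exact: measurable_cst.
have mg2 D : measurable_fun D g2.
  apply: measurable_funTS; apply: emeasurable_funM; first exact: measurable_cst.
  apply: emeasurable_funM; first exact: measurable_EFin_powR.
  exact: (measurable_EFin_indic (measurable_itv `]0%R, b])).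
have g10 y : 0 <= g1 y by rewrite mule_ge0// lee_fin invr_ge0 ltW.
have g20 y : 0 <= g2 y.
  rewrite mule_ge0//; last by rewrite mule_ge0// lee_fin ?powR_ge0.
  by rewrite mule_ge0// lee_fin divr_ge0// ltW.
have nMb : nnm (fun y => M (y + b)%R).
  by have := nnm_affine 1 b nM; under [X in nnm X]eq_fun do rewrite mul1r.
rewrite [X in X <= _]/weight (negbTE a1).
apply: (@le_trans _ _ (\int[leb]_(y in `]0%R, +oo[) (g1 y + g2 y))).
  apply: ge0_le_integral => //.
  - by move=> y _; rewrite mule_ge0 ?nM.2// lee_fin powR_ge0.
  - exact: (@measurable_weighted (fun y => M (y + b)%R) _ nMb).
  - by apply: emeasurable_funD; [exact: mg1|exact: mg2].
  - move=> y /=; rewrite in_itv/= andbT => y0.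
    have yb0 : (0 < y + b)%R by rewrite addr_gt0.
    have [yb|yb] := leP b y.
      apply: (@le_trans _ _ (g1 y)); last by rewrite leeDl.
      rewrite /g1 /h mul1r indicE mem_setE in_itv/= andbT yb0 mule1.
      rewrite lee_pdivlMl// muleCA; apply: lee_wpmul2l; first exact: nM.2.
      by rewrite -EFinM lee_fin powR_itv_ge//; apply/andP; split; lra.
    apply: (@le_trans _ _ (g2 y)); last by rewrite leeDr.
    rewrite /g2 indicE mem_setE in_itv/= y0 (ltW yb) mule1.
    apply: lee_wpmul2r; first by rewrite lee_fin powR_ge0.
    rewrite (_ : 20 / b = (b / 2)^-1 * 10)%R; last by field; rewrite gt_eqF.
    rewrite EFinM -muleA lee_pdivlMl ?divr_gt0//.
    have b2 : (0 < b / 2)%R by rewrite divr_gt0.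
    have b2y : (b / 2 < y + b)%R by lra.
    apply: (le_trans (qM _ _ b2 b2y)); rewrite lee_pmul2l//.
    apply: ge0_subset_integral => //.
    + by apply: measurable_funTS; exact: nM.1.
    + by move=> v _; exact: nM.2.
    + by move=> v /=; rewrite !in_itv/= => /andP[? ?]; apply/andP; split; lra.
rewrite ge0_integralD//=; [|exact: mg1|exact: mg2].
rewrite EFinD ge0_muleDl ?lee_fin ?invr_ge0 ?(ltW k0)//; last first.
  by rewrite divr_ge0 ?(ltW al10)// mulr_ge0// ltW.
apply: leeD.
  apply: (@le_trans _ _ (\int[leb]_y g1 y)).
    by apply: ge0_subset_integral => //; exact: mg1.
  rewrite ge0_integralZl//=; last by rewrite lee_fin invr_ge0 ltW.
  have := ge0_integral_affine b ltr01 mh h0; rewrite mul1e => <-.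
  by rewrite /weight (negbTE a1) integral_gt0_mkcond.
rewrite ge0_integralZl//=; last 3 first.
- apply: measurable_funTS; apply: emeasurable_funM; first exact: measurable_EFin_powR.
  exact: (measurable_EFin_indic (measurable_itv `]0%R, b])).
- by move=> y _; rewrite mule_ge0// lee_fin ?powR_ge0.
- by rewrite mule_ge0// lee_fin divr_ge0// ltW.
have J : \int[leb]_(y in `]0%R, +oo[) ((y `^ alpha)%:E * (\1_(`]0%R, b]%classic : set R) y)%:E) <=
    (b `^ (alpha + 1) / (alpha + 1))%:E.
  apply: le_trans (integral_powR_le al1 b0).
  rewrite [X in _ <= X]integral_mkcond.
  apply: (@le_trans _ _ (\int[leb]_y ((y `^ alpha)%:E * (\1_(`]0%R, b]%classic : set R) y)%:E))).
    apply: ge0_subset_integral => //.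
    + apply: emeasurable_funM; first exact: measurable_EFin_powR.
      exact: (measurable_EFin_indic (measurable_itv `]0%R, b])).
    + by move=> y _; rewrite mule_ge0// lee_fin ?powR_ge0.
  rewrite le_eqVlt; apply/orP; left; apply/eqP; apply: eq_integral => y _.
  by rewrite patchE indicE; case: ifPn => _; rewrite ?mule1 ?mule0.
apply: (le_trans (lee_pmul (_ : 0 <= _) (_ : 0 <= _) (lee_wpmul2l (_ : 0 <= _) IW) J)).
- by rewrite mule_ge0// lee_fin divr_ge0// ltW.
- by apply: integral_ge0 => y _; rewrite mule_ge0// lee_fin ?powR_ge0.
- by rewrite lee_fin divr_ge0// ltW.
rewrite muleA -EFinM muleAC -EFinM le_eqVlt; apply/orP; left; apply/eqP.
congr (_%:E * _).
rewrite powRN powRD; last by rewrite gt_eqF ?implybT.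
rewrite powRr1 ?(ltW b0)//; field.
by rewrite !gt_eqF ?powR_gt0.
Qed.

Lemma limn_einf_pZr (u : nat -> \bar R) (c : R) : (0 < c)%R ->
  limn_einf u * c%:E <= limn_einf (fun n => u n * c%:E).
Proof.
move=> c0; set v := fun n => u n * c%:E.
rewrite -lee_pdivlMr// limn_einf_lim; apply: lime_le; first exact: is_cvg_einfs.
near=> n; rewrite lee_pdivlMr//.
apply: (@le_trans _ _ (einfs v n)); last first.
  rewrite limn_einf_lim (cvg_lim _ (@cvg_einfs_sup R v))//.
  by apply: ereal_sup_ubound; exists n.
apply: le_ereal_inf_tmp => _ [k /= nk <-]; rewrite /v lee_wpmul2r ?lee_fin ?(ltW c0)//.
by apply: ereal_inf_lbound; exists k.
Unshelve. all: by end_near. Qed.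

Lemma weight_fatou (Mn : nat -> R -> \bar R) M (B : \bar R) :
  (forall n, nnm (Mn n)) -> nnm M ->
  (forall y, (0 < y)%R -> M y <= limn_einf (fun n => Mn n y)) ->
  (forall n, weight (Mn n) <= B) -> weight M <= B.
Proof.
move=> nMn nM MMn; rewrite /weight; case: ifPn => a1 MnB.
  apply: ge_ereal_sup => _ [y /= y0 <-]; apply: (le_trans (MMn y y0)).
  rewrite limn_einf_lim; apply: lime_le; first exact: is_cvg_einfs.
  near=> n; apply: (@le_trans _ _ (Mn n y)).
    by apply: ereal_inf_lbound; exists n => /=.
  by apply: le_trans (MnB n); apply: ereal_sup_ubound; exists y.
apply: (@le_trans _ _ (\int[leb]_(y in `]0%R, +oo[)
   limn_einf (fun n => Mn n y * (y `^ alpha)%:E))).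
  apply: ge0_le_integral => //.
  - by move=> y _; exact: weighted_ge0.
  - exact: measurable_weighted.
  - apply: (emeasurable_fun_cvg
        (fun n y => einfs (fun n => Mn n y * (y `^ alpha)%:E) n)).
      by move=> n; apply: measurable_fun_einfs => k; exact: measurable_weighted.
    by move=> y _; rewrite limn_einf_lim; exact: is_cvg_einfs.
  - move=> y /=; rewrite in_itv/= andbT => y0.
    apply: (@le_trans _ _ (limn_einf (fun n => Mn n y) * (y `^ alpha)%:E)).
      by rewrite lee_wpmul2r ?lee_fin ?powR_ge0// MMn.
    by apply: limn_einf_pZr; rewrite powR_gt0.
apply: (le_trans (fatou _ _ _ _)) => //.
- by move=> n; exact: measurable_weighted.
- by move=> n y _; exact: weighted_ge0.
rewrite limn_einf_lim; apply: lime_le; first exact: is_cvg_einfs.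
near=> n; apply: (@le_trans _ _ (\int[leb]_(y in `]0%R, +oo[) (Mn n y * (y `^ alpha)%:E))).
  by apply: ereal_inf_lbound; exists n => /=.
exact: MnB.
Unshelve. all: by end_near. Qed.

Lemma weight_decay : exists m : nat,
  weight (fun y => ((1 + `|y|) ^- m)%:E) < +oo.
Proof.
have mf m : measurable_fun setT (fun y : R => ((1 + `|y|) ^- m)%:E : \bar R).
  apply/measurable_EFinP; apply: continuous_measurable_fun => y.
  apply: cvgV; first by rewrite expf_neq0// gt_eqF// ltr_pwDl.
  apply: (@cvg_comp _ _ _ (fun y : R => 1 + `|y|)%R (fun z => z ^+ m)%R _ _ _ _
    (@exprn_continuous R m (1 + `|y|)%R)).
  by apply: cvgD; [exact: cvg_cst|apply: cvg_norm; exact: cvg_id].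
have f0 m (y : R) : 0 <= ((1 + `|y|) ^- m)%:E.
  by rewrite lee_fin invr_ge0 exprn_ge0// addr_ge0.
have nf m : nnm (fun y => ((1 + `|y|) ^- m)%:E) by [].
have [a1|a1] := boolP (alpha == (-1)%R).
  exists 0%N; rewrite /weight a1; apply: (@le_lt_trans _ _ 1%:E); last exact: ltry.
  by apply: ge_ereal_sup => _ [y /= y0 <-]; rewrite lee_fin expr0 invr1.
have al1 : (-1 < alpha)%R by apply: alpha_gt; exact: negbTE.
pose m := (Num.truncn (alpha + 2)).+1.
have am : (alpha + 2 <= m%:R)%R.
  have a2 : (0 <= alpha + 2)%R by lra.
  by have /andP[_ /ltW] := truncn_itv a2.
exists m; rewrite /weight (negbTE a1).
pose g1 y := ((y `^ alpha)%:E * (\1_(`]0%R, 1%R]%classic : set R) y)%:E) : \bar R.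
pose g2 (y : R) := 2%:E * ((1 + y ^+ 2)^-1)%:E : \bar R.
have mg1 D : measurable_fun D g1.
  apply: measurable_funTS; apply: emeasurable_funM; first exact: measurable_EFin_powR.
  exact: (measurable_EFin_indic (measurable_itv `]0%R, 1%R])).
have mg0 : measurable_fun setT (fun y : R => ((1 + y ^+ 2)^-1)%:E : \bar R).
  apply/measurable_EFinP; apply: continuous_measurable_fun => x.
  apply: cvgV; first by rewrite gt_eqF// ltr_wpDr// sqr_ge0.
  by apply: cvgD; [exact: cvg_cst|exact: exprn_continuous].
have mg2 D : measurable_fun D g2.
  by apply: measurable_funTS; apply: emeasurable_funM => //; exact: measurable_cst.
have g10 y : 0 <= g1 y by rewrite mule_ge0// lee_fin ?powR_ge0.
have g20 y : 0 <= g2 y.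
  by rewrite mule_ge0// lee_fin invr_ge0 addr_ge0// sqr_ge0.
apply: (@le_lt_trans _ _ (\int[leb]_(y in `]0%R, +oo[) (g1 y + g2 y))).
  apply: ge0_le_integral => //.
  - by move=> y _; rewrite mule_ge0// lee_fin ?powR_ge0.
  - exact: measurable_weighted.
  - by apply: emeasurable_funD; [exact: mg1|exact: mg2].
  - move=> y /=; rewrite in_itv/= andbT => y0.
    have [y1|y1] := leP y 1%R.
      apply: (@le_trans _ _ (g1 y)); last by rewrite leeDl.
      rewrite /g1 indicE mem_setE in_itv/= y0 y1 mule1 -EFinM lee_fin.
      rewrite ler_piMl ?powR_ge0// invf_le1 ?exprn_gt0 ?ltr_pwDl//.
      by rewrite exprn_ege1// lerDl.
    apply: (@le_trans _ _ (g2 y)); last by rewrite leeDr.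
    rewrite /g2 -!EFinM lee_fin (gtr0_norm y0).
    have y20 : (0 < y ^+ 2)%R by rewrite exprn_gt0.
    apply: (@le_trans _ _ (y ^- 2)%R).
      have y1m : (0 < (1 + y) ^+ m)%R by rewrite exprn_gt0// addr_gt0.
      rewrite mulrC ler_pdivrMr//.
      apply: (@le_trans _ _ (y ^- 2 * y ^+ m)%R); last first.
        rewrite ler_pM2l ?invr_gt0// lerXn2r// ?nnegrE; lra.
      have y2N : (y ^- 2 = y `^ (- 2%:R))%R by rewrite powRN powR_mulrn ?ltW.
      rewrite y2N -(powR_mulrn m (ltW y0)) -powRD; last by rewrite (gt_eqF y0) implybT.
      by rewrite ler_powR; [|exact: ltW|lra].
    have y21 : (1 <= y ^+ 2)%R by rewrite exprn_ege1// ltW.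
    have y22 : (0 < 1 + y ^+ 2)%R by rewrite addr_gt0.
    by rewrite ler_pdivlMr// mulrC ler_pdivrMr//; lra.
rewrite ge0_integralD//=; [|exact: mg1|exact: mg2].
apply: lte_add_pinfty.
  apply: (@le_lt_trans _ _ (\int[leb]_y g1 y)).
    by apply: ge0_subset_integral => //; exact: mg1.
  apply: le_lt_trans (ltry (1 `^ (alpha + 1) / (alpha + 1))).
  apply: le_trans (integral_powR_le al1 ltr01).
  rewrite [X in _ <= X]integral_mkcond le_eqVlt; apply/orP; left; apply/eqP.
  apply: eq_integral => y _.
  by rewrite /g1 patchE indicE; case: ifPn => _; rewrite ?mule1 ?mule0.
apply: (@le_lt_trans _ _ (\int[leb]_y g2 y)).
  by apply: ge0_subset_integral => //; exact: mg2.
rewrite ge0_integralZl//=.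
  by rewrite lte_mul_pinfty// integral_oneDsqr_lty.
by move=> y _; rewrite lee_fin invr_ge0 addr_ge0// sqr_ge0.
Qed.

End weights.

Section slices.
Context {R : realType}.
Notation C := (cplx R).
Notation leb := (@lebesgue_measure R).
Local Open Scope ereal_scope.

Lemma integralD_ge0 (D : set R) (f g : R -> \bar R) : measurable D ->
  measurable_fun setT f -> measurable_fun setT g ->
  (forall x, 0 <= f x) -> (forall x, 0 <= g x) ->
  \int[leb]_(x in D) (f x + g x) = \int[leb]_(x in D) f x + \int[leb]_(x in D) g x.
Proof.
move=> mD mf mg f0 g0; apply: ge0_integralD => //; exact: measurable_funTS.
Qed.

Lemma integralZ_ge0 (D : set R) (c : R) (f : R -> \bar R) : measurable D ->
  (0 <= c)%R -> measurable_fun setT f -> (forall x, 0 <= f x) ->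
  \int[leb]_(x in D) (c%:E * f x) = c%:E * \int[leb]_(x in D) f x.
Proof.
move=> mD c0 mf f0; apply: ge0_integralZl => //; exact: measurable_funTS.
Qed.

Lemma mul2e (x : \bar R) : 2 * x = x + x.
Proof.
have -> : 2 = 1%:E + 1%:E :> \bar R by rewrite -EFinD; congr EFin; ring.
by rewrite ge0_muleDl// mul1e.
Qed.

Definition slice (phi : R * R -> R) (y : R) : \bar R :=
  \int[leb]_x (phi (x, y))%:E.

Definition nnp (phi : R * R -> R) :=
  measurable_fun setT phi /\ forall p, (0 <= phi p)%R.

Lemma nnp_comp (phi : R * R -> R) (f g : R * R -> R) : nnp phi ->
  measurable_fun setT f -> measurable_fun setT g ->
  nnp (fun p => phi (f p, g p)).
Proof.
move=> [mphi phi0] mf mg; split => // .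
by apply: (measurableT_comp mphi); exact: measurable_fun_pair.
Qed.

Lemma nnpD phi psi : nnp phi -> nnp psi -> nnp (fun p => phi p + psi p)%R.
Proof.
move=> [mf f0] [mg g0]; split; last by move=> p; rewrite addr_ge0.
exact: measurable_funD.
Qed.

Lemma nnpM phi psi : nnp phi -> nnp psi -> nnp (fun p => phi p * psi p)%R.
Proof.
move=> [mf f0] [mg g0]; split; last by move=> p; rewrite mulr_ge0.
exact: measurable_funM.
Qed.

Lemma nnm_slice phi : nnp phi -> nnm (slice phi).
Proof.
move=> [mphi phi0]; split.
  have mE : measurable_fun setT (EFin \o phi) by exact/measurable_EFinP.
  have p0 p : 0 <= (EFin \o phi) p by rewrite lee_fin.
  exact: (@measurable_fun_fubini_tonelli_G _ _ _ _ _ leb _ mE p0).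
by move=> y; apply: integral_ge0 => x _; rewrite lee_fin.
Qed.

Lemma measurable_section (phi : R * R -> R) y : nnp phi ->
  measurable_fun setT (fun x : R => (phi (x, y))%:E).
Proof.
move=> [mphi _]; apply/measurable_EFinP.
by apply: (measurableT_comp mphi); exact: measurable_pair2.
Qed.

Lemma measurable_section2 (phi : R * R -> R) x : nnp phi ->
  measurable_fun setT (fun y : R => (phi (x, y))%:E).
Proof.
move=> [mphi _]; apply/measurable_EFinP.
by apply: (measurableT_comp mphi); exact: measurable_pair1.
Qed.

Lemma slice_affine phi (a c y : R) : a != 0%R -> nnp phi ->
  slice phi y = `|a|%:E * \int[leb]_x (phi (a * x + c, y)%R)%:E.
Proof.
move=> a0 nphi; rewrite /slice.
rewrite (@ge0_integral_affine_neq0 _ a c)//; first exact: measurable_section.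
by move=> x; rewrite lee_fin; exact: nphi.2.
Qed.

Lemma tonelli_slice phi : nnp phi ->
  \int[leb]_x \int[leb]_y (phi (x, y))%:E = \int[leb]_y slice phi y.
Proof.
move=> [mphi phi0].
have mE : measurable_fun setT (EFin \o phi) by exact/measurable_EFinP.
have p0 p : 0 <= (EFin \o phi) p by rewrite lee_fin.
exact: (@fubini_tonelli _ _ _ _ _ leb leb _ mE p0).
Qed.

Definition ind (t s : R) : R := \1_(`[(- t)%R, t]%classic : set R) s.

Lemma ind_ge0 t s : (0 <= ind t s)%R.
Proof. by rewrite /ind indicE. Qed.

Lemma measurable_ind t : measurable_fun setT (ind t).
Proof. by apply: measurable_indic. Qed.

Lemma indE t s : ind t s = (if (- t <= s <= t)%R then 1%R else 0%R).
Proof. by rewrite /ind indicE mem_setE in_itv/=; case: ifP. Qed.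

Lemma le_ind t T s : (t <= T)%R -> (ind t s <= ind T s)%R.
Proof.
move=> tT; rewrite !indE; case: ifP => [/andP[s1 s2]|_]; last by case: ifP.
by rewrite (_ : (- T <= s <= T)%R); [|apply/andP; split; lra].
Qed.

(* Sub-mean value property over the boundary of the square of side 2t. *)
Definition sqr_mean (phi : R * R -> R) := forall x0 y0 t : R, (0 < t)%R ->
  (t < y0)%R ->
  (2 * t * phi (x0, y0))%:E <=
  \int[leb]_s (ind t s * (phi (x0 + s, y0 - t) + phi (x0 + s, y0 + t) +
     (phi (x0 - t, y0 + s) + phi (x0 + t, y0 + s))))%:E.

Lemma integral_window (a c T : R) (M : R -> \bar R) : nnm M ->
  (`|a| = 1)%R -> (0 < T)%R ->
  \int[leb]_(s in `[(T / 2)%R, T]) M (a * s + c)%R <=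
  \int[leb]_(u in `[(c - T)%R, (c + T)%R]) M u.
Proof.
move=> nM a1 T0.
pose h u := M u * (\1_(`[(c - T)%R, (c + T)%R]%classic : set R) u)%:E.
have mh : measurable_fun setT h.
  apply: emeasurable_funM; first exact: nM.1.
  by apply: measurable_EFin_indic.
have h0 u : 0 <= h u by rewrite mule_ge0 ?nM.2// lee_fin.
have an0 : a != 0%R by rewrite -normr_eq0 a1 oner_neq0.
have -> : \int[leb]_(u in `[(c - T)%R, (c + T)%R]) M u = \int[leb]_u h u.
  rewrite integral_mkcond; apply: eq_integral => u _.
  by rewrite /h patchE indicE; case: ifPn => _; rewrite ?mule1 ?mule0.
rewrite (@ge0_integral_affine_neq0 _ a c)// a1 mul1e.
have mhc : measurable_fun setT (fun s : R => h (a * s + c)%R).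
  apply: (measurableT_comp mh).
  apply: continuous_measurable_fun => x; apply: cvgD; last exact: cvg_cst.
  by apply: cvgMr; exact: cvg_id.
apply: (@le_trans _ _ (\int[leb]_(s in `[(T / 2)%R, T]) h (a * s + c)%R)).
  apply: ge0_le_integral => //.
  - by move=> s _; exact: nM.2.
  - by apply: measurable_funTS; exact: (nnm_affine a c nM).1.
  - exact: measurable_funTS.
  - move=> s /=; rewrite in_itv/= => /andP[s1 s2].
    rewrite /h indicE mem_setE in_itv/=.
    rewrite (_ : (c - T <= a * s + c <= c + T)%R) ?mule1//.
    have : (`|a * s| <= T)%R by rewrite normrM a1 mul1r ger0_norm; lra.
    by rewrite ler_norml => /andP[? ?]; apply/andP; split; lra.
by apply: ge0_subset_integral => //.
Qed.

Lemma integral_ind_window (c T : R) (M : R -> \bar R) : nnm M ->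
  \int[leb]_s ((ind T s)%:E * M (s + c)%R) =
  \int[leb]_(u in `[(c - T)%R, (c + T)%R]) M u.
Proof.
move=> nM.
pose h u := M u * (\1_(`[(c - T)%R, (c + T)%R]%classic : set R) u)%:E.
have mh : measurable_fun setT h.
  apply: emeasurable_funM; first exact: nM.1.
  by apply: measurable_EFin_indic.
have h0 u : 0 <= h u by rewrite mule_ge0 ?nM.2// lee_fin.
have -> : \int[leb]_(u in `[(c - T)%R, (c + T)%R]) M u = \int[leb]_u h u.
  rewrite integral_mkcond; apply: eq_integral => u _.
  by rewrite /h patchE indicE; case: ifPn => _; rewrite ?mule1 ?mule0.
rewrite [RHS](@ge0_integral_affine _ 1%R c)// mul1e; apply: eq_integral => s _.
rewrite mul1r /h muleC; congr (_ * _); rewrite indE indicE mem_setE in_itv/=.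
have -> : (c - T <= s + c <= c + T)%R = (- T <= s <= T)%R.
  by apply/idP/idP => /andP[? ?]; apply/andP; split; lra.
by case: ifP.
Qed.

Section mean.
Variable phi : R * R -> R.
Hypotheses (nphi : nnp phi) (mphi : sqr_mean phi).

Let M := slice phi.
Let nM : nnm M := nnm_slice nphi.

Let msum (f g h k : R -> \bar R) : measurable_fun setT f -> measurable_fun setT g ->
  measurable_fun setT h -> measurable_fun setT k ->
  (forall x, 0 <= f x) -> (forall x, 0 <= g x) -> (forall x, 0 <= h x) ->
  (forall x, 0 <= k x) ->
  \int[leb]_x (f x + g x + (h x + k x)) =
  \int[leb]_x f x + \int[leb]_x g x + (\int[leb]_x h x + \int[leb]_x k x).
Proof.
move=> mf mg mh mk f0 g0 h0 k0.
rewrite !integralD_ge0//; try exact: emeasurable_funD.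
- by move=> x; rewrite adde_ge0.
- by move=> x; rewrite adde_ge0.
Qed.

(* Averages the inequality [sqr_mean] over [t] in [T/2, T]. *)
Lemma average_window (y0 T : R) (A : \bar R) (B : R -> \bar R) : (0 < T)%R ->
  0 <= A -> nnm B ->
  (forall t, (T / 2 <= t <= T)%R -> A <= M (y0 - t)%R + M (y0 + t)%R + B t) ->
  (T / 2)%:E * A <= 2 * \int[leb]_(u in `[(y0 - T)%R, (y0 + T)%R]) M u +
    \int[leb]_(t in `[(T / 2)%R, T]) B t.
Proof.
move=> T0 A0 [mB B0] H.
have T2 : (T / 2 < T)%R by lra.
have len : leb `[(T / 2)%R, T] = (T / 2)%:E.
  rewrite lebesgue_measure_itv/= lte_fin T2 -EFinB; congr EFin; lra.
have ma a : measurable_fun setT (fun t : R => M (a * t + y0)%R).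
  exact: (nnm_affine a y0 nM).1.
have mm := emeasurable_funD (ma (-1)%R) (ma 1%R).
have -> : (T / 2)%:E * A = \int[leb]_(t in `[(T / 2)%R, T]) cst A t.
  by rewrite integral_cst//= len muleC.
apply: (@le_trans _ _ (\int[leb]_(t in `[(T / 2)%R, T])
   (M (-1 * t + y0)%R + M (1 * t + y0)%R + B t))).
  apply: ge0_le_integral => //.
  - by apply: measurable_funTS; apply: emeasurable_funD => //; exact: mm.
  - move=> t /=; rewrite in_itv/= => tT; rewrite mulN1r mul1r [(- t + y0)%R]addrC [(t + y0)%R]addrC.
    exact: H.
have ms (D : set R) (f : R -> \bar R) : measurable_fun setT f -> measurable_fun D f.
  by move=> mf; exact: measurable_funTS.
rewrite ge0_integralD//; last first.
- exact: ms mB.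
- exact: ms mm.
- by move=> t _; rewrite adde_ge0 ?nM.2.
rewrite leeD2r//.
rewrite ge0_integralD//; last first.
- exact: ms (ma 1%R).
- by move=> t _; exact: nM.2.
- exact: ms (ma (-1)%R).
- by move=> t _; exact: nM.2.
rewrite mul2e; apply: leeD; apply: integral_window => //.
  by rewrite normrN normr1.
by rewrite normr1.
Qed.

Let slice_shift (c y : R) : \int[leb]_x (phi (x + c, y)%R)%:E = M y.
Proof.
rewrite /M (@slice_affine phi 1%R c y (oner_neq0 R) nphi).
by rewrite normr1 mul1e; apply: eq_integral => x _; rewrite mul1r.
Qed.

Let slice_reflect (c y : R) : \int[leb]_x (phi (c - x, y)%R)%:E = M y.
Proof.
have n1 : (-1 != 0 :> R)%R by rewrite oppr_eq0 oner_neq0.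
rewrite /M (@slice_affine phi (-1)%R c y n1 nphi).
by rewrite normrN normr1 mul1e; apply: eq_integral => x _; rewrite mulN1r addrC.
Qed.

Let mshift (f g : R -> R) : continuous f -> continuous g ->
  measurable_fun setT (fun x => (phi (f x, g x))%:E).
Proof.
move=> cf cg; apply/measurable_EFinP; apply: (measurableT_comp nphi.1).
by apply: measurable_fun_pair; exact: continuous_measurable_fun.
Qed.

Lemma sqr_mean_point (x0 y0 T : R) : (0 < T)%R -> (T < y0)%R ->
  (T ^+ 2 * phi (x0, y0))%:E <=
  8 * \int[leb]_(u in `[(y0 - T)%R, (y0 + T)%R]) M u.
Proof.
move=> T0 Ty.
pose psi (p : R * R) : R :=
  (ind T p.2 * (phi (x0 - p.1, y0 + p.2) + phi (p.1 + x0, y0 + p.2)))%R.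
have npsi : nnp psi.
  apply: nnpM.
    split; last by move=> p; exact: ind_ge0.
    by apply: (measurableT_comp (measurable_ind T)); exact: measurable_snd.
  have m2 : measurable_fun setT (fun p : R * R => y0 + p.2)%R.
    by apply: measurable_funD => //; exact: measurable_snd.
  apply: nnpD; apply: nnp_comp => //.
    by apply: measurable_funB => //; exact: measurable_fst.
  by apply: measurable_funD => //; exact: measurable_fst.
pose B t := \int[leb]_s (psi (t, s))%:E.
have nB : nnm B.
  split; last by move=> t; apply: integral_ge0 => s _; rewrite lee_fin npsi.2.
  have mE : measurable_fun setT (EFin \o psi) by apply/measurable_EFinP; exact: npsi.1.
  have p0 p : 0 <= (EFin \o psi) p by rewrite lee_fin npsi.2.
  exact: (@measurable_fun_fubini_tonelli_F _ _ _ _ _ leb _ mE p0).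
set W := \int[leb]_(u in `[(y0 - T)%R, (y0 + T)%R]) M u.
have W0 : 0 <= W by apply: integral_ge0 => u _; exact: nM.2.
have H : (T / 2)%:E * (T * phi (x0, y0))%:E <= 2 * W + \int[leb]_(t in `[(T / 2)%R, T]) B t.
  apply: average_window => //; first by rewrite lee_fin mulr_ge0 ?(ltW T0)// nphi.2.
  move=> t /andP[t1 t2]; have t0 : (0 < t)%R by lra.
  have ty : (t < y0)%R by lra.
  apply: (@le_trans _ _ (2 * t * phi (x0, y0))%:E).
    by rewrite lee_fin ler_wpM2r ?nphi.2//; lra.
  apply: (le_trans (mphi x0 t0 ty)).
  rewrite -(slice_shift x0 (y0 - t)) -(slice_shift x0 (y0 + t)) /B.
  have mg c : measurable_fun setT (fun s : R => (phi (s + x0, c))%:E).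
    apply: (@mshift (fun s => s + x0)%R (cst c)) => s; last exact: cvg_cst.
    by apply: cvgD; [exact: cvg_id|exact: cvg_cst].
  have mps : measurable_fun setT (fun s => (psi (t, s))%:E) by exact: measurable_section2.
  have p0 c (s : R) : 0 <= (phi (s + x0, c)%R)%:E by rewrite lee_fin nphi.2.
  have mgD := emeasurable_funD (mg (y0 - t)%R) (mg (y0 + t)%R).
  have pD s : 0 <= (phi (s + x0, y0 - t)%R)%:E + (phi (s + x0, y0 + t)%R)%:E.
    by rewrite adde_ge0.
  have ps0 s : 0 <= (psi (t, s))%:E by rewrite lee_fin npsi.2.
  rewrite -(integralD_ge0 measurableT (mg _) (mg _) (p0 _) (p0 _)).
  rewrite -(integralD_ge0 measurableT mgD mps pD ps0).
  apply: ge0_le_integral => //.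
  - move=> s _; rewrite lee_fin mulr_ge0 ?ind_ge0// !addr_ge0 ?nphi.2//.
  - apply/measurable_EFinP; apply: measurable_funM; first exact: measurable_ind.
    have mc (f g : R -> R) : continuous f -> continuous g ->
        measurable_fun setT (fun x => phi (f x, g x)).
      by move=> cf cg; have /measurable_EFinP := mshift cf cg.
    have ca c : continuous (fun s : R => c + s)%R.
      by move=> s; apply: cvgD; [exact: cvg_cst|exact: cvg_id].
    have cc (c : R) : continuous (fun s : R => c) by move=> s; exact: cvg_cst.
    by do 2![apply: measurable_funD]; apply: mc.
  - by apply: emeasurable_funD => //; exact: emeasurable_funD.
  - move=> s _; rewrite -!EFinD lee_fin mulrDr lerD//.
      rewrite (addrC s x0) ler_piMl ?addr_ge0 ?nphi.2// indE.
      by case: ifP; rewrite ?ler01 ?lexx.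
    rewrite /psi/= (addrC t) ler_wpM2r ?addr_ge0 ?nphi.2//.
    exact: le_ind.
have HB : \int[leb]_(t in `[(T / 2)%R, T]) B t <= 2 * W.
  apply: (@le_trans _ _ (\int[leb]_t B t)).
    apply: ge0_subset_integral => //; first exact: nB.1.
    by move=> t _; exact: nB.2.
  rewrite /B tonelli_slice// /W -(integral_ind_window y0 T nM).
  rewrite -integralZ_ge0//; last 2 first.
  - apply: emeasurable_funM; first by apply/measurable_EFinP; exact: measurable_ind.
    have := (nnm_affine 1 y0 nM).1.
    by under [X in measurable_fun _ X]eq_fun do rewrite mul1r.
  - by move=> s; rewrite mule_ge0 ?nM.2// lee_fin ind_ge0.
  rewrite le_eqVlt; apply/orP; left; apply/eqP; apply: eq_integral => s _.
  rewrite /slice /psi/=.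
  under eq_integral do rewrite EFinM.
  have mc c : measurable_fun setT (fun x : R => (phi (x + x0, c))%:E).
    apply: (@mshift (fun s => s + x0)%R (cst c)) => u; last exact: cvg_cst.
    by apply: cvgD; [exact: cvg_id|exact: cvg_cst].
  have mc' c : measurable_fun setT (fun x : R => (phi (x0 - x, c))%:E).
    apply: (@mshift (fun s => x0 - s)%R (cst c)) => u; last exact: cvg_cst.
    by apply: cvgB; [exact: cvg_cst|exact: cvg_id].
  under eq_integral do rewrite EFinD.
  rewrite integralZ_ge0 ?ind_ge0//; last 2 first.
  - exact: emeasurable_funD.
  - by move=> x; rewrite adde_ge0// lee_fin nphi.2.
  rewrite integralD_ge0//; last 2 first.
  - by move=> x; rewrite lee_fin nphi.2.
  - by move=> x; rewrite lee_fin nphi.2.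
  rewrite slice_shift slice_reflect (addrC y0) muleCA; congr (_ * _).
  by rewrite mul2e.
have := le_trans H (leeD (lexx _) HB).
rewrite -ge0_muleDl// -EFinM -EFinD => {}H.
rewrite (_ : T ^+ 2 * _ = 2 * (T / 2 * (T * phi (x0, y0))))%R; last by rewrite expr2; field.
have -> : 8 = 2%:E * (2 + 2)%:E :> \bar R by rewrite -EFinM; congr EFin; ring.
by rewrite EFinM -muleA lee_pmul2l.
Qed.

Lemma sqr_mean_quasi_mean : quasi_mean M.
Proof.
move=> y0 T T0 Ty.
set W := \int[leb]_(u in `[(y0 - T)%R, (y0 + T)%R]) M u.
have W0 : 0 <= W by apply: integral_ge0 => u _; exact: nM.2.
have H : (T / 2)%:E * (2^-1%:E * M y0) <=
    2 * W + \int[leb]_(t in `[(T / 2)%R, T]) cst (T^-1%:E * W) t.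
  apply: average_window => //.
  - by rewrite mule_ge0 ?nM.2// lee_fin invr_ge0.
  - split; first exact: measurable_cst.
    by move=> t; rewrite mule_ge0// lee_fin invr_ge0 ltW.
  move=> t /andP[t1 t2]; have t0 : (0 < t)%R by lra.
  have ty : (t < y0)%R by lra.
  pose psi (p : R * R) : R := (ind t p.2 *
    (phi (p.1 + p.2, y0 - t) + phi (p.1 + p.2, y0 + t) +
     (phi (p.1 - t, y0 + p.2) + phi (p.1 + t, y0 + p.2))))%R.
  have m1 : measurable_fun setT (fun p : R * R => p.1 + p.2)%R.
    by apply: measurable_funD; [exact: measurable_fst|exact: measurable_snd].
  have m2 : measurable_fun setT (fun p : R * R => y0 + p.2)%R.
    by apply: measurable_funD => //; exact: measurable_snd.
  have npsi : nnp psi.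
    apply: nnpM.
      split; last by move=> p; exact: ind_ge0.
      by apply: (measurableT_comp (measurable_ind t)); exact: measurable_snd.
    apply: nnpD; apply: nnpD; apply: nnp_comp => //.
      by apply: measurable_funB => //; exact: measurable_fst.
    by apply: measurable_funD => //; exact: measurable_fst.
  set A := M (y0 - t)%R + M (y0 + t)%R.
  have A0 : 0 <= A by rewrite adde_ge0 ?nM.2.
  have nA : nnm (cst A) by split => //; exact: measurable_cst.
  have mi : measurable_fun setT (fun s => (ind t s)%:E).
    by apply/measurable_EFinP; exact: measurable_ind.
  have mI : measurable_fun setT (fun s => (ind T s)%:E).
    by apply/measurable_EFinP; exact: measurable_ind.
  have mMs : measurable_fun setT (fun s : R => M (s + y0)%R).
    have := (nnm_affine 1 y0 nM).1.
    by under [X in measurable_fun _ X]eq_fun do rewrite mul1r.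
  have mIM : measurable_fun setT (fun s : R => (ind T s)%:E * M (s + y0)%R).
    exact: emeasurable_funM.
  have mc (a c : R) : measurable_fun setT (fun x : R => (phi (x + a, c)%R)%:E).
    apply: (@mshift (fun s => s + a)%R (cst c)) => u; last exact: cvg_cst.
    by apply: cvgD; [exact: cvg_id|exact: cvg_cst].
  have p0 (a c : R) : forall x : R, 0 <= (phi (x + a, c)%R)%:E.
    by move=> x; rewrite lee_fin nphi.2.
  have Hs s : slice psi s = (ind t s)%:E * (A + (M (y0 + s)%R + M (y0 + s)%R)).
    rewrite /slice /psi/=.
    under eq_integral do rewrite EFinM !EFinD.
    rewrite integralZ_ge0 ?ind_ge0//; last 2 first.
    - by do 2![apply: emeasurable_funD].
    - by move=> x; rewrite !adde_ge0// lee_fin nphi.2.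
    by rewrite msum// !slice_shift.
  have H : (2 * t)%:E * M y0 <= (2 * t)%:E * A + 2 * W.
    apply: (@le_trans _ _ (\int[leb]_x \int[leb]_s (psi (x, s))%:E)).
      rewrite -(slice_shift 0 y0) -integralZ_ge0//; last by rewrite mulr_ge0// ltW.
      apply: ge0_le_integral => //.
      - by move=> x _; rewrite -EFinM lee_fin !mulr_ge0 ?nphi.2// ltW.
      - by apply: emeasurable_funM => //; exact: mc.
      - have mE : measurable_fun setT (EFin \o psi) by apply/measurable_EFinP; exact: npsi.1.
        have q0 p : 0 <= (EFin \o psi) p by rewrite lee_fin npsi.2.
        exact: (@measurable_fun_fubini_tonelli_F _ _ _ _ _ leb _ mE q0).
      - by move=> x _; rewrite addr0 -EFinM; exact: mphi.
    rewrite tonelli_slice//.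
    apply: (@le_trans _ _ (\int[leb]_s ((ind t s)%:E * A + 2 * ((ind T s)%:E * M (s + y0)%R)))).
      apply: ge0_le_integral => //.
      - by move=> s _; exact: (nnm_slice npsi).2.
      - exact: (nnm_slice npsi).1.
      - apply: emeasurable_funD.
          by apply: emeasurable_funM => //; exact: measurable_cst.
        by apply: emeasurable_funM => //; exact: measurable_cst.
      - move=> s _; have M0 : 0 <= M (y0 + s)%R + M (y0 + s)%R.
          by rewrite adde_ge0// nM.2.
        rewrite Hs ge0_muleDr//; apply: leeD; first exact: lexx.
        rewrite (addrC s) muleCA mul2e; apply: lee_wpmul2r => //.
        by rewrite lee_fin le_ind.
    rewrite integralD_ge0//; last 4 first.
    - by apply: emeasurable_funM => //; exact: measurable_cst.
    - by apply: emeasurable_funM => //; exact: measurable_cst.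
    - by move=> s; rewrite mule_ge0// lee_fin ind_ge0.
    - by move=> s; rewrite !mule_ge0 ?nM.2// lee_fin ind_ge0.
    rewrite integralZ_ge0//; last first.
      by move=> s; rewrite mule_ge0 ?nM.2// lee_fin ind_ge0.
    rewrite integral_ind_window//; apply: leeD => //.
    rewrite (integral_ind_window 0 t nA) integral_cst//= lebesgue_measure_itv/= lte_fin.
    rewrite (_ : (0 - t < 0 + t)%R); last by lra.
    by rewrite muleC -EFinB (_ : 0 + t - (0 - t) = 2 * t)%R//; ring.
  rewrite /cst -/A -(@lee_pmul2l _ (4 * t)%:E)//; last by rewrite lte_fin mulr_gt0.
  rewrite muleA -EFinM (_ : 4 * t / 2 = 2 * t)%R; last by field.
  apply: (le_trans H); have TW : 0 <= T^-1%:E * W by rewrite mule_ge0// lee_fin invr_ge0 ltW.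
  rewrite [X in _ <= X](ge0_muleDr _ A0 TW); apply: leeD; first by rewrite lee_wpmul2r// lee_fin; lra.
  rewrite muleA -EFinM lee_wpmul2r// lee_fin ler_pdivlMr//; lra.
have len : leb `[(T / 2)%R, T] = (T / 2)%:E.
  have T2 : (T / 2 < T)%R by lra.
  rewrite lebesgue_measure_itv/= lte_fin T2 -EFinB; congr EFin; lra.
move: H; rewrite integral_cst//= len muleAC -EFinM muleA -EFinM.
rewrite -ge0_muleDl//; last by rewrite lee_fin mulr_ge0 ?invr_ge0 ?divr_ge0 ?(ltW T0).
rewrite -EFinD (_ : 2 + T^-1 * (T / 2) = 5 / 2)%R; last by field; rewrite gt_eqF.
rewrite (_ : T / 2 * 2^-1 = T / 4)%R; last by field.
move=> H; rewrite (_ : T = 4 * (T / 4))%R; last by field.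
rewrite (_ : 10 = (4 * (5 / 2))%:E); last by congr EFin; field.
by rewrite EFinM (EFinM 4) -!muleA lee_pmul2l// -EFinM.
Qed.

End mean.
End slices.

Section energy.
Context {R : realType} (alpha : R).
Hypothesis alpha_ge : -1 <= alpha.
Notation C := (cplx R).
Notation leb := (@lebesgue_measure R).
Local Open Scope ereal_scope.

Implicit Types phi psi : R * R -> R.

Definition energy (phi : R * R -> R) : \bar R := weight alpha (slice phi).

Lemma energy_ge0 phi : nnp phi -> 0 <= energy phi.
Proof. by move=> nphi; apply: weight_ge0; exact: nnm_slice. Qed.

Lemma le_slice phi psi y : nnp phi -> nnp psi ->
  (forall x, phi (x, y) <= psi (x, y))%R -> slice phi y <= slice psi y.
Proof.
move=> np nq pq; apply: ge0_le_integral => //.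
- by move=> x _; rewrite lee_fin np.2.
- exact: measurable_section.
- exact: measurable_section.
- by move=> x _; rewrite lee_fin.
Qed.

Lemma le_energy phi psi : nnp phi -> nnp psi ->
  (forall x y, (0 < y)%R -> phi (x, y) <= psi (x, y))%R ->
  energy phi <= energy psi.
Proof.
move=> np nq pq; apply: le_weight; [exact: nnm_slice..|] => y y0.
by apply: le_slice => // x; exact: pq.
Qed.

Lemma nnpZ (c : R) phi : (0 <= c)%R -> nnp phi -> nnp (fun p => c * phi p)%R.
Proof.
move=> c0 [mp p0]; split; last by move=> p; rewrite mulr_ge0.
by apply: measurable_funM => //; exact: measurable_cst.
Qed.

Lemma sliceD phi psi y : nnp phi -> nnp psi ->
  slice (fun p => phi p + psi p)%R y = slice phi y + slice psi y.
Proof.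
move=> np nq; rewrite /slice -integralD_ge0//; try exact: measurable_section.
- by move=> x; rewrite lee_fin np.2.
- by move=> x; rewrite lee_fin nq.2.
Qed.

Lemma sliceZ (c : R) phi y : (0 <= c)%R -> nnp phi ->
  slice (fun p => c * phi p)%R y = c%:E * slice phi y.
Proof.
move=> c0 np; rewrite /slice -integralZ_ge0//; first exact: measurable_section.
by move=> x; rewrite lee_fin np.2.
Qed.

Lemma energyZ (c : R) phi : (0 <= c)%R -> nnp phi ->
  energy (fun p => c * phi p)%R <= c%:E * energy phi.
Proof.
move=> c0 np; rewrite /energy.
rewrite (_ : slice _ = fun y => c%:E * slice phi y); last first.
  by apply/funext => y; rewrite sliceZ.
by apply: weightZ => //; exact: nnm_slice.
Qed.

Lemma energyD phi psi : nnp phi -> nnp psi ->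
  energy (fun p => phi p + psi p)%R <= energy phi + energy psi.
Proof.
move=> np nq; rewrite /energy.
rewrite (_ : slice _ = fun y => slice phi y + slice psi y); last first.
  by apply/funext => y; rewrite sliceD.
by apply: weightD; exact: nnm_slice.
Qed.

Lemma nnp0 : @nnp R (fun=> 0%R).
Proof. by split => //; exact: measurable_cst. Qed.

Lemma energy0 : energy (fun=> 0%R) <= 0.
Proof.
have := energyZ (lexx 0%R) nnp0; rewrite mul0e.
by under [X in energy X]eq_fun do rewrite mul0r.
Qed.

Lemma nnp_sum I (s : seq I) (phi : I -> R * R -> R) : (forall i, nnp (phi i)) ->
  nnp (fun p => \sum_(i <- s) phi i p)%R.
Proof.
move=> np; elim: s => [|i s IH].
  by under [X in nnp X]eq_fun do rewrite big_nil; exact: nnp0.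
under [X in nnp X]eq_fun do rewrite big_cons.
exact: (nnpD (np i) IH).
Qed.

Lemma energy_sum I (s : seq I) (phi : I -> R * R -> R) : (forall i, nnp (phi i)) ->
  energy (fun p => \sum_(i <- s) phi i p)%R <= \sum_(i <- s) energy (phi i).
Proof.
move=> np; elim: s => [|i s IH].
  under [X in energy X]eq_fun do rewrite big_nil; rewrite big_nil; exact: energy0.
under [X in energy X]eq_fun do rewrite big_cons; rewrite big_cons.
apply: (le_trans (energyD (np i) (nnp_sum s np))).
exact: leeD.
Qed.

Lemma nnp_affine phi (a c b d : R) : nnp phi ->
  nnp (fun p => phi (a * p.1 + c, b * p.2 + d)%R).
Proof.
move=> np; apply: nnp_comp => //.
  apply: measurable_funD => //; apply: measurable_funM => //; exact: measurable_fst.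
apply: measurable_funD => //; apply: measurable_funM => //; exact: measurable_snd.
Qed.

Lemma slice_comp_affine phi (a c b d y : R) : (0 < a)%R -> nnp phi ->
  slice (fun p => phi (a * p.1 + c, b * p.2 + d)%R) y =
  a^-1%:E * slice phi (b * y + d)%R.
Proof.
move=> a0 np; rewrite (@slice_affine _ phi a c _ (lt0r_neq0 a0) np).
by rewrite muleA -EFinM gtr0_norm// mulVf ?gt_eqF// mul1e.
Qed.

Lemma energy_scale phi (a c : R) : (0 < a)%R -> nnp phi ->
  energy (fun p => phi (a * p.1 + c, a * p.2)%R) <=
  (a `^ (- (alpha + 2)))%:E * energy phi.
Proof.
move=> a0 np; have nM := nnm_slice np.
rewrite /energy (_ : slice _ = fun y => a^-1%:E * slice phi (a * y)%R); last first.
  apply/funext => y; have := slice_comp_affine c a 0 y a0 np.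
  rewrite addr0 => <-; congr slice; apply/funext => p; by rewrite addr0.
have nMa : nnm (fun y => slice phi (a * y)%R).
  by have := nnm_affine a 0 nM; under [X in nnm X]eq_fun do rewrite addr0.
have a1 : (0 <= a^-1)%R by rewrite invr_ge0 ltW.
apply: (le_trans (weightZ alpha a1 nMa)).
have ai : 0 <= a^-1%:E by [].
apply: (le_trans (lee_wpmul2l ai (weight_scale alpha a0 nM))).
rewrite muleA -EFinM -[X in (X * _)%R%:E](powR_inv1 (ltW a0)).
rewrite -powRD; last by rewrite (gt_eqF a0) implybT.
by rewrite (_ : -1 - (alpha + 1) = - (alpha + 2))%R//; ring.
Qed.

Lemma energy_fatou (phin : nat -> R * R -> R) phi (B : \bar R) :
  (forall n, nnp (phin n)) -> nnp phi ->
  (forall p, (0 < p.2)%R -> phin ^~ p @ \oo --> phi p) ->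
  (forall n, energy (phin n) <= B) -> energy phi <= B.
Proof.
move=> npn np cv Bn; apply: (weight_fatou _ _ _ Bn).
- by move=> n; exact: nnm_slice.
- exact: nnm_slice.
move=> y y0; rewrite /slice.
rewrite (_ : \int[leb]_x _ = \int[leb]_x limn_einf (fun n => (phin n (x, y))%:E)).
  apply: fatou => //.
  - by move=> n; exact: measurable_section.
  - by move=> n x _; rewrite lee_fin (npn n).2.
apply: eq_integral => x _.
have h : (fun n => (phin n (x, y))%:E) @ \oo --> (phi (x, y))%:E.
  by apply: cvg_EFin; [exact: nearW|exact: (cv (x, y))].
by rewrite is_cvg_limn_einfE; [apply/esym/cvg_lim|apply/cvg_ex; exists (phi (x, y))%:E].
Qed.

Definition decay (m : nat) (p : R * R) : R :=
  ((1 + p.1 ^+ 2)^-1 * (1 + `|p.2|) ^- m)%R.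

Lemma decay_fin : exists m, nnp (decay m) /\ energy (decay m) < +oo.
Proof.
have [m Hm] := weight_decay alpha_ge; exists m.
have m1 : measurable_fun setT (fun x : R => (1 + x ^+ 2)^-1)%R.
  apply: continuous_measurable_fun => x.
  apply: cvgV; first by rewrite gt_eqF// ltr_wpDr// sqr_ge0.
  by apply: cvgD; [exact: cvg_cst|exact: exprn_continuous].
have m2 : measurable_fun setT (fun y : R => (1 + `|y|) ^- m)%R.
  apply: continuous_measurable_fun => y.
  apply: cvgV; first by rewrite expf_neq0// gt_eqF// ltr_pwDl.
  apply: (@cvg_comp _ _ _ (fun y : R => 1 + `|y|)%R (fun z => z ^+ m)%R _ _ _ _
    (@exprn_continuous R m (1 + `|y|)%R)).
  by apply: cvgD; [exact: cvg_cst|apply: cvg_norm; exact: cvg_id].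
have p1 (x : R) : (0 <= (1 + x ^+ 2)^-1)%R by rewrite invr_ge0 addr_ge0// sqr_ge0.
have p2 (y : R) : (0 <= (1 + `|y|) ^- m)%R by rewrite invr_ge0 exprn_ge0// addr_ge0.
have nd : nnp (decay m).
  split; last by move=> p; rewrite mulr_ge0.
  apply: measurable_funM.
    by apply: (measurableT_comp m1); exact: measurable_fst.
  by apply: (measurableT_comp m2); exact: measurable_snd.
split => //.
pose J := \int[leb]_x ((1 + x ^+ 2)^-1)%:E.
have Joo : J < +oo := @integral_oneDsqr_lty R.
have J0 : 0 <= J by apply: integral_ge0 => x _; rewrite lee_fin.
have Jf : J \is a fin_num by rewrite ge0_fin_numE.
rewrite /energy (_ : slice _ = fun y => (fine J)%:E * ((1 + `|y|) ^- m)%:E); last first.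
  apply/funext => y; rewrite /slice /decay/=.
  under eq_integral do rewrite mulrC EFinM.
  rewrite integralZ_ge0//; first by rewrite fineK// muleC.
  - by apply/measurable_EFinP.
have nw : nnm (fun y : R => ((1 + `|y|) ^- m)%:E).
  by split; [apply/measurable_EFinP|move=> y; rewrite lee_fin].
have fJ : (0 <= fine J)%R by rewrite fine_ge0.
apply: (le_lt_trans (weightZ alpha fJ nw)).
by rewrite lte_mul_pinfty// lee_fin.
Qed.

Definition sqmag (F : C -> C) (p : R * R) : R := (normc (F (p.1 +i* p.2)) ^+ 2)%R.

Lemma nnp_sqmag F : admissible F -> nnp (sqmag F).
Proof.
move=> aF; split; last by move=> p; rewrite sqr_ge0.
by apply: measurable_funX; exact: (measurable_mag aF).
Qed.

Lemma slice_sqmag_out F y : admissible F -> (y <= 0)%R -> slice (sqmag F) y = 0.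
Proof.
move=> [_ F0] y0; rewrite /slice; under eq_integral.
  move=> x _; rewrite /sqmag/= F0; last by rewrite /upper_half_plane/= ltNge y0.
  rewrite normc0 expr0n; over.
by rewrite integral0.
Qed.

Lemma poweR_half_le (x : \bar R) (c : R) : 0 <= x -> (0 <= c)%R ->
  (x `^ 2^-1 <= c%:E) = (x <= (c ^+ 2)%:E).
Proof.
move=> x0 c0; have c2 : (c ^+ 2)%:E `^ 2^-1 = c%:E.
  by rewrite poweR_EFin -powR_mulrn// -powRrM divff ?pnatr_eq0// powRr1.
have x2 : x = (x `^ 2^-1) `^ 2.
  by rewrite -poweRrM// mulVf ?pnatr_eq0// poweRe1.
have p2 : c%:E `^ 2 = (c ^+ 2)%:E by rewrite poweR_EFin powR_mulrn.
apply/idP/idP => h.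
  rewrite x2 -p2; apply: gt0_ler_poweR => //.
  - by rewrite in_itv/= leey andbT poweR_ge0.
  - by rewrite in_itv/= leey andbT lee_fin.
rewrite -c2; apply: gt0_ler_poweR => //.
- by rewrite in_itv/= leey andbT.
- by rewrite in_itv/= leey andbT lee_fin sqr_ge0.
Qed.

Lemma A2_norm_le F (c : R) : admissible F -> (0 <= c)%R ->
  (A2_norm alpha F <= c%:E) = (energy (sqmag F) <= (c ^+ 2)%:E).
Proof.
move=> aF c0; have nF := nnp_sqmag aF; have nM := nnm_slice nF.
rewrite /A2_norm /energy /weight; case: ifPn => [_|a1].
  apply/idP/idP => h.
    apply: ge_ereal_sup => _ [y /= y0 <-]; rewrite -poweR_half_le ?nM.2//.
    by apply: le_trans h; apply: ereal_sup_ubound; exists y.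
  apply: ge_ereal_sup => _ [y /= y0 <-]; rewrite poweR_half_le ?nM.2//.
    by apply: le_trans h; apply: ereal_sup_ubound; exists y.
rewrite bergmanE// /L2 poweR_half_le//; last first.
  by apply: integral_ge0 => p _; rewrite lee_fin sqr_ge0.
congr (_ <= _).
pose w (p : R * R) := (normc (F (p.1 +i* p.2)) * p.2 `^ (alpha / 2))%R.
pose f p := (w p ^+ 2)%:E.
have mf : measurable_fun setT f.
  by apply/measurable_EFinP; apply: measurable_funX; exact: (measurable_wmag alpha aF).
have f0 p : 0 <= f p by rewrite lee_fin sqr_ge0.
rewrite [LHS](@fubini_tonelli2 _ _ _ _ _ leb leb f mf f0) /fubini_G.
have E y : \int[leb]_x f (x, y) = slice (sqmag F) y * (y `^ alpha)%:E.
  have fE x : f (x, y) = (y `^ alpha)%:E * (sqmag F (x, y))%:E.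
    rewrite -EFinM /f /w exprMn mulrC; congr ((_ * _)%:E).
    by rewrite -powR_mulrn ?powR_ge0// -powRrM divfK// pnatr_eq0.
  under eq_integral do rewrite fE.
  rewrite integralZ_ge0 ?powR_ge0//; first by rewrite muleC.
    exact: measurable_section.
  by move=> x; rewrite lee_fin nF.2.
under eq_integral do rewrite E.
rewrite [RHS]integral_mkcond; apply: eq_integral => y _.
rewrite patchE; case: ifPn => //; rewrite notin_setE/= in_itv/= andbT => /negP.
by rewrite -leNgt => y0; rewrite slice_sqmag_out// mul0e.
Qed.

End energy.

Section half_plane.
Context {R : realType}.
Notation C := (cplx R).
Notation leb := (@lebesgue_measure R).

Definition ext0 (G : C -> C) (w : C) : C := if 0 < complex.Im w then G w else 0.

Lemma ext0E G w : 0 < complex.Im w -> ext0 G w = G w.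
Proof. by rewrite /ext0 => ->. Qed.

Lemma normr_Im_lt (z h : C) : normc h < complex.Im z -> 0 < complex.Im (z + h).
Proof.
move=> hz; have := normr_Im_le h; case: z h hz => a b [c d] /= hz.
by rewrite ler_norml => /andP[h1 _]; lra.
Qed.

Lemma admissible_ext0 G : analytic_on (@upper_half_plane R) G -> admissible (ext0 G).
Proof.
move=> aG; split=> [w uw|w /negP]; last by rewrite /ext0 => /negbTE ->.
apply/derivable_cderivP; have [D HD] := analytic_cderiv aG uw.
exists D; apply: has_cderiv_local uw _ HD => h hw.
by rewrite ext0E//; exact: normr_Im_lt.
Qed.

Lemma has_cderiv_affine (F : C -> C) (a c z D : C) : has_cderiv F (a * z + c) D ->
  has_cderiv (fun w => F (a * w + c)) z (D * a).
Proof.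
move=> FD e e0.
have na1 : 0 < normc a + 1 by rewrite ltr_wpDl// normc_ge0.
have [d d0 Hd] := FD _ (divr_gt0 e0 na1).
exists (d / (normc a + 1)) => [|h]; first exact: divr_gt0.
rewrite ltr_pdivlMr// => hd.
have ah : normc (a * h) <= (normc a + 1) * normc h.
  by rewrite normcM ler_wpM2r ?normc_ge0// lerDl.
have ahd : normc (a * h) < d by rewrite (le_lt_trans ah)// mulrC.
have aux (p q r s : R[i]) : p * (q + r) + s = p * q + s + p * r by ring.
rewrite aux -mulrA (le_trans (Hd _ ahd))//.
by rewrite -mulrA ler_pM2l// ler_pdivrMl.
Qed.

Definition comp_affine (mu : R) (w0 : C) (F : C -> C) : C -> C :=
  ext0 (fun w => F (mu%:C * w + w0)).

Lemma cplx_affineE (mu x y : R) (w0 : C) : mu%:C * (x +i* y) + w0 =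
  (mu * x + complex.Re w0) +i* (mu * y + complex.Im w0) :> C.
Proof.
by case: w0 => u v; apply/eqP; rewrite eq_complex/=; apply/andP; split;
  apply/eqP; ring.
Qed.

Lemma Im_affine (mu : R) (w0 w : C) :
  complex.Im (mu%:C * w + w0) = mu * complex.Im w + complex.Im w0.
Proof. by case: w w0 => x y [a b] /=; ring. Qed.

Lemma Im_affine_gt0 (mu : R) (w0 w : C) : 0 < mu -> 0 <= complex.Im w0 ->
  0 < complex.Im w -> 0 < complex.Im (mu%:C * w + w0).
Proof. by move=> mu0 w00 w1; rewrite Im_affine ltr_wpDr// mulr_gt0. Qed.

Lemma admissible_comp_affine mu w0 F : 0 < mu -> 0 <= complex.Im w0 -> admissible F ->
  admissible (comp_affine mu w0 F).
Proof.
move=> mu0 w00 [aF F0]; apply: admissible_ext0 => w uw; apply/derivable_cderivP.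
have [D HD] := analytic_cderiv aF (Im_affine_gt0 mu0 w00 uw : upper_half_plane _).
by exists (D * mu%:C); exact: has_cderiv_affine.
Qed.

Local Open Scope ereal_scope.

Lemma EFin_fine_le (x : \bar R) : 0 <= x -> (fine x)%:E <= x.
Proof. by case: x => // x0; exact: leey. Qed.

Lemma sqr_mean_sqmag (F : C -> C) : admissible F -> sqr_mean (sqmag F).
Proof.
move=> aF x0 y0 t t0 ty; have nF := nnp_sqmag aF.
have mc (y : R) : measurable_fun setT (fun x : R => (sqmag F (x, y))%:E).
  exact: measurable_section.
have mr (x : R) : measurable_fun setT (fun y : R => (sqmag F (x, y))%:E).
  exact: measurable_section2.
have p0 p : 0 <= (sqmag F p)%:E by rewrite lee_fin nF.2.
pose M1 x := (sqmag F (x, y0 - t)%R)%:E + (sqmag F (x, y0 + t)%R)%:E.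
pose M2 y := (sqmag F (x0 - t, y)%R)%:E + (sqmag F (x0 + t, y)%R)%:E.
have n1 : nnm M1.
  by split; [exact: emeasurable_funD|move=> x; rewrite adde_ge0].
have n2 : nnm M2.
  by split; [exact: emeasurable_funD|move=> x; rewrite adde_ge0].
have i0 s : 0 <= (ind t s)%:E by rewrite lee_fin ind_ge0.
have mi : measurable_fun setT (fun s : R => (ind t s)%:E).
  by apply/measurable_EFinP; exact: measurable_ind.
have ms M (c : R) : nnm M -> measurable_fun setT (fun s : R => (ind t s)%:E * M (s + c)%R).
  move=> nM; apply: emeasurable_funM => //; have := (nnm_affine 1 c nM).1.
  by under [X in measurable_fun _ X]eq_fun do rewrite mul1r.
have ps M (c : R) : nnm M -> forall s : R, 0 <= (ind t s)%:E * M (s + c)%R.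
  by move=> nM s; rewrite mule_ge0// nM.2.
apply: (@le_trans _ _ (side_integral x0 y0 (fun z => normc (F z) ^+ 2)%R t)%:E).
  by rewrite lee_fin; apply: analytic_sqr_mean => //; exact: aF.1.
rewrite /side_integral EFinD.
apply: (@le_trans _ _ (\int[leb]_s ((ind t s)%:E * M1 (s + x0)%R + (ind t s)%:E * M2 (s + y0)%R))).
  rewrite integralD_ge0//; [|exact: ms|exact: ms|exact: ps|exact: ps].
  by apply: leeD; rewrite integral_ind_window//; apply: EFin_fine_le;
    apply: integral_ge0 => s _; rewrite lee_fin addr_ge0// sqr_ge0.
rewrite le_eqVlt; apply/orP; left; apply/eqP; apply: eq_integral => s _.
by rewrite (addrC s) (addrC s) mulrDr.
Qed.

Context (alpha : R).
Hypothesis alpha_ge : (-1 <= alpha)%R.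

Lemma energy_comp_affine : exists2 K : R, (0 < K)%R & forall (mu : R) (w0 : C) (F : C -> C), (0 < mu)%R ->
  (0 <= complex.Im w0)%R -> admissible F ->
  energy alpha (sqmag (comp_affine mu w0 F)) <=
  (K * mu `^ (- (alpha + 2)))%:E * energy alpha (sqmag F).
Proof.
have [K K0 HK] := weight_shift alpha_ge.
exists (K + 1)%R => [|mu w0 F mu0 w00 aF]; first by rewrite ltr_wpDr.
have nF := nnp_sqmag aF; have nM := nnm_slice nF.
have aG := admissible_comp_affine mu0 w00 aF; have nG := nnp_sqmag aG.
set b := complex.Im w0 in w00 *.
pose psi p := sqmag F (mu * p.1 + complex.Re w0, mu * p.2 + b)%R.
have npsi : nnp psi by exact: nnp_affine.
have mui : (0 <= mu^-1)%R by rewrite invr_ge0 ltW.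
pose N y := slice (sqmag F) (y + b)%R.
have nN : nnm N.
  by have := nnm_affine 1 b nM; under [X in nnm X]eq_fun do rewrite mul1r.
have nNmu : nnm (fun y => N (mu * y)%R).
  by have := nnm_affine mu 0 nN; under [X in nnm X]eq_fun do rewrite addr0.
have WN : weight alpha N <= (K + 1)%:E * energy alpha (sqmag F).
  have [b0|b0] := eqVneq b 0%R.
    rewrite /N; under [X in weight _ X]eq_fun do rewrite b0 addr0.
    rewrite -[X in X <= _]mul1e; apply: lee_wpmul2r; first exact: energy_ge0.
    by rewrite lee_fin lerDr ltW.
  apply: (@le_trans _ _ (K%:E * energy alpha (sqmag F))).
    apply: HK => //; last by rewrite lt_neqAle eq_sym b0.
    exact: sqr_mean_quasi_mean (sqr_mean_sqmag aF).
  by apply: lee_wpmul2r; [exact: energy_ge0|rewrite lee_fin lerDl].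
apply: (@le_trans _ _ (energy alpha psi)).
  apply: le_energy => // x y y0; rewrite /sqmag /psi /comp_affine/= ext0E//=.
  by rewrite cplx_affineE.
rewrite /energy (_ : slice psi = fun y => mu^-1%:E * N (mu * y)%R); last first.
  by apply/funext => y; exact: slice_comp_affine.
apply: (le_trans (weightZ alpha mui nNmu)).
have mie : 0 <= mu^-1%:E by [].
apply: (le_trans (lee_wpmul2l mie (weight_scale alpha mu0 nN))).
rewrite muleA -EFinM -[X in (X * _)%R%:E](powR_inv1 (ltW mu0)).
rewrite -powRD; last by rewrite (gt_eqF mu0) implybT.
rewrite (_ : -1 - (alpha + 1) = - (alpha + 2))%R; last by ring.
rewrite mulrC EFinM -muleA; apply: lee_wpmul2l => //.
by rewrite lee_fin powR_ge0.
Qed.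

Lemma point_evaluation : exists2 K : R, (0 < K)%R & forall (F : C -> C) x y, admissible F ->
  (0 < y)%R ->
  (normc (F (x +i* y)) ^+ 2)%:E <=
  (K * y `^ (- (alpha + 2)))%:E * energy alpha (sqmag F).
Proof.
have [K K0 HK] := weight_window alpha.
exists (32 * K)%R => [|F x y aF y0]; first by rewrite mulr_gt0.
have nF := nnp_sqmag aF; have nM := nnm_slice nF.
have y2 : (0 < y / 2)%R by rewrite divr_gt0.
have y2y : (y / 2 < y)%R by lra.
have h := sqr_mean_point nF (sqr_mean_sqmag aF) x y2 y2y.
have hw : \int[leb]_(u in `[(y - y / 2)%R, (y + y / 2)%R]) slice (sqmag F) u <=
    (K * y `^ (- alpha))%:E * energy alpha (sqmag F).
  apply: le_trans (HK _ _ nM y0); apply: ge0_subset_integral => //.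
  - by apply: measurable_funTS; exact: nM.1.
  - by move=> u _; exact: nM.2.
  - by move=> u /=; rewrite !in_itv/= => /andP[? ?]; apply/andP; split; lra.
have e8 : 0 <= 8 :> \bar R by [].
have := le_trans h (lee_wpmul2l e8 hw); rewrite /sqmag/= EFinM.
have yy : (0 < (y / 2) ^+ 2)%R by rewrite exprn_gt0.
rewrite -lee_pdivlMl// => /le_trans; apply.
rewrite !muleA -!EFinM le_eqVlt; apply/orP; left; apply/eqP; congr (_%:E * _).
rewrite (_ : - (alpha + 2) = - alpha + - 2%:R)%R; last by ring.
rewrite powRD; last by rewrite (gt_eqF y0) implybT.
by rewrite powRN (powRN y 2%:R) powR_mulrn ?ltW//; field; rewrite !gt_eqF ?powR_gt0.
Qed.

End half_plane.

(** * Operators on Banach spaces *)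

Section banach.
Context {R : realType} {V : normedModType R[i]}.
Implicit Types (u v w : V) (c : R[i]).

Definition nrm v : R := complex.Re `|v|.

Lemma nrmE v : `|v| = (nrm v)%:C.
Proof. by rewrite /nrm; have := normr_ge0 v; case: `|v| => a b; rewrite lecE/= => /andP[/eqP->]. Qed.

Lemma nrm_ge0 v : 0 <= nrm v.
Proof. by have := normr_ge0 v; rewrite nrmE lecR. Qed.

Lemma nrmD u v : nrm (u + v) <= nrm u + nrm v.
Proof. by have := ler_normD u v; rewrite !nrmE -rmorphD lecR. Qed.

Lemma nrmN v : nrm (- v) = nrm v.
Proof. by rewrite /nrm normrN. Qed.

Lemma nrmBC u v : nrm (u - v) = nrm (v - u).
Proof. by rewrite -nrmN opprB. Qed.

Lemma nrmB u v : nrm (u - v) <= nrm u + nrm v.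
Proof. by rewrite -(nrmN v) nrmD. Qed.

Lemma nrmZ c v : nrm (c *: v) = normc c * nrm v.
Proof. by rewrite /nrm normrZ nrmE normcR -rmorphM. Qed.

Lemma nrm0 : nrm 0 = 0.
Proof. by rewrite /nrm normr0. Qed.

Lemma nrm_eq0 v : nrm v = 0 -> v = 0.
Proof. by move=> v0; apply/eqP; rewrite -normr_eq0 nrmE v0. Qed.

Lemma nrm_sum I (r : seq I) (f : I -> V) :
  nrm (\sum_(i <- r) f i) <= \sum_(i <- r) nrm (f i).
Proof.
elim: r => [|i r IH]; first by rewrite !big_nil nrm0.
by rewrite !big_cons (le_trans (nrmD _ _))// lerD2l.
Qed.

Lemma nrm_small v (K : R) : (forall e, 0 < e -> nrm v <= K * e) -> v = 0.
Proof.
move=> h; apply: nrm_eq0; apply/eqP; rewrite eq_le nrm_ge0 andbT.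
apply/ler_addgt0Pr => e e0; rewrite add0r.
have k0 : 0 < `|K| + 1 by rewrite ltr_wpDl.
apply: le_trans (h _ (divr_gt0 e0 k0)) _; rewrite mulrA ler_pdivrMr// mulrC ler_pM2l//.
by rewrite (le_trans (ler_norm _))// lerDl.
Qed.

Lemma closed_nrm (Y : set V) v : closed Y ->
  (forall e, 0 < e -> exists2 y, Y y & nrm (v - y) < e) -> Y v.
Proof.
move=> cY h; apply: cY => B /nbhs_ballP[e /= e0 eB].
have [r r0 er] := posc_ex e0; have [y Yy vy] := h r r0.
exists y; split => //; apply: eB; rewrite -ball_normE/= nrmE er ltcR//.
Qed.

(* An explicit modulus [a] of convergence avoids filters in the proofs. *)
Definition seq_complete := forall (u : nat -> V) (a : nat -> R),
  (forall n m, (n <= m)%N -> a m <= a n) ->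
  (forall e, 0 < e -> exists n, a n <= e) ->
  (forall n m, nrm (u n - u m) <= a n + a m) ->
  exists l, forall n, nrm (u n - l) <= a n.

Lemma bounded_operator_nrm (U : V -> V) : bounded_operator U ->
  exists2 M : R, 0 < M & forall v, nrm (U v) <= M * nrm v.
Proof.
move=> [_ [M HM]]; exists (normc M + 1) => [|v].
  by rewrite ltr_wpDl// normc_ge0.
have := HM v; rewrite !nrmE.
case: M HM => a b HM; rewrite lecE => /andP[_] /=.
rewrite mulr0 subr0 => /le_trans; apply; rewrite ler_wpM2r ?nrm_ge0//.
by rewrite (le_trans (ler_norm _))// (le_trans (normr_Re_le (a +i* b)))// lerDl.
Qed.

Lemma operator_nrm_bounded (U : V -> V) (M : R) : linear U ->
  (forall v, nrm (U v) <= M * nrm v) -> bounded_operator U.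
Proof.
move=> lU HM; split => //; exists M%:C => v.
by rewrite !nrmE -rmorphM lecR.
Qed.

Lemma subrACA (a b c d : V) : (a - b) - (c - d) = (a - c) - (b - d).
Proof. by rewrite !opprD !opprK addrACA. Qed.

Section linear_maps.
Variable U : V -> V.
Hypothesis lU : linear U.

Lemma linD u v : U (u + v) = U u + U v.
Proof. by have := lU 1 u v; rewrite !scale1r. Qed.

Lemma lin0 : U 0 = 0.
Proof. by have := linD 0 0; rewrite addr0 => /eqP; rewrite -subr_eq0 opprD addNKr oppr_eq0 => /eqP. Qed.

Lemma linZ c u : U (c *: u) = c *: U u.
Proof. by have := lU c u 0; rewrite lin0 !addr0. Qed.

Lemma linN u : U (- u) = - U u.
Proof. by rewrite -scaleN1r linZ scaleN1r. Qed.

Lemma linB u v : U (u - v) = U u - U v.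
Proof. by rewrite linD linN. Qed.

Lemma lin_sum I (r : seq I) (f : I -> V) : U (\sum_(i <- r) f i) = \sum_(i <- r) U (f i).
Proof.
by elim: r => [|i r IH]; rewrite ?big_nil ?lin0// !big_cons linD IH.
Qed.

End linear_maps.

Lemma invertible_of (U S : V -> V) (M : R) : linear U -> cancel S U ->
  injective U -> (forall v, nrm (S v) <= M * nrm v) -> invertible_operator U.
Proof.
move=> lU SU iU bS; have US : cancel U S by move=> v; apply: iU; rewrite SU.
exists S; split => //; apply: (@operator_nrm_bounded _ M) => // c u v.
by apply: iU; rewrite lU !SU.
Qed.

Lemma invertible_fredholm (U : V -> V) : invertible_operator U -> fredholm U.
Proof.
move=> [S [bS US SU]].
have lS := bS.1; have S0 := lin0 lS.
split.
- exists 0%N, (fun=> 0) => w /= Uw; exists (fun=> 0).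
  by rewrite big_ord0 -(US w) Uw S0.
- by rewrite (_ : range U = setT) ?closedT//; apply/seteqP; split => // v _; exists (S v).
- exists 0%N, (fun=> 0) => v; exists v; first by exists (S v).
  by exists (fun=> 0); rewrite big_ord0 addr0.
Qed.

Lemma exp_small (q : R) : 0 <= q -> q < 1 -> forall e, 0 < e -> exists n, q ^+ n <= e.
Proof.
move=> q0 q1 e e0.
have : (fun n => q ^+ n) @ \oo --> (0 : R) by apply: cvg_expr; rewrite ger0_norm.
move/cvgrPdist_le => /(_ e e0)[N _ HN]; exists N.
by have := HN N (leqnn N); rewrite sub0r normrN ger0_norm// exprn_ge0.
Qed.

Lemma half_small (e : R) : 0 < e -> exists n, (2^-1 : R) ^+ n <= e.
Proof. by apply: exp_small; lra. Qed.

Hypothesis compV : seq_complete.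

Lemma neumann (T : V -> V) (K q : R) : linear T -> 0 <= K -> 0 <= q -> q < 1 ->
  (forall n v, nrm (iter n T v) <= K * q ^+ n * nrm v) ->
  invertible_operator (fun v => v - T v).
Proof.
move=> lT K0 q0 q1 HT.
have lU : linear (fun v => v - T v).
  by move=> c u v; rewrite lT scalerBr opprD addrACA.
have q1' : 0 < 1 - q by rewrite subr_gt0.
have qn n : 0 <= q ^+ n by rewrite exprn_ge0.
pose A v := K * nrm v / (1 - q).
have A0 v : 0 <= A v by rewrite divr_ge0 ?(ltW q1')// mulr_ge0 ?nrm_ge0.
have /choice[S HS] : forall v, exists l, forall n,
    nrm (\sum_(k < n) iter k T v - l) <= A v * q ^+ n.
  move=> v; have aD m d :
      nrm (\sum_(k < m + d) iter k T v - \sum_(k < m) iter k T v) <= A v * q ^+ m.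
    rewrite big_split_ord/= addrAC subrr add0r (le_trans (nrm_sum _ _))//.
    have : \sum_(i < d) nrm (iter (m + i) T v) <=
        \sum_(i < d) K * nrm v * q ^+ m * q ^+ i.
      apply: ler_sum => i _; rewrite (le_trans (HT _ _))// exprD.
      by rewrite le_eqVlt; apply/orP; left; apply/eqP; ring.
    move/le_trans; apply; rewrite -mulr_sumr /A.
    rewrite (_ : K * nrm v / (1 - q) * q ^+ m = K * nrm v * q ^+ m * (1 - q)^-1); last by ring.
    apply: ler_wpM2l; first by rewrite !mulr_ge0 ?nrm_ge0.
    rewrite -[leRHS]mul1r ler_pdivlMr// mulrC.
    have -> : (1 - q) * \sum_(i < d) q ^+ i = 1 - q ^+ d.
      by rewrite -[RHS]opprB subrX1 -mulNr opprB.
    by rewrite gerBl.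
  apply: (compV (a := fun n => A v * q ^+ n)).
  - by move=> n m nm; rewrite ler_wpM2l//; apply: ler_wiXn2l => //; exact: ltW.
  - move=> e e0; have [a00|a00] := eqVneq (A v) 0.
      by exists 0%N; rewrite a00 mul0r ltW.
    have a1 : 0 < A v by rewrite lt_neqAle eq_sym a00 A0.
    have [n Hn] := exp_small q0 q1 (divr_gt0 e0 a1).
    by exists n; rewrite mulrC -ler_pdivlMr.
  - have an n : 0 <= A v * q ^+ n by rewrite mulr_ge0.
    move=> n m; have [nm|/ltnW mn] := leqP n m.
      by rewrite -(subnKC nm) nrmBC (le_trans (aD _ _))// lerDl.
    by rewrite -(subnKC mn) (le_trans (aD _ _))// lerDr.
have HS0 v : nrm (S v) <= K / (1 - q) * nrm v.
  have := HS v 0%N; rewrite big_ord0 sub0r nrmN expr0 mulr1 => /le_trans; apply.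
  by rewrite /A mulrAC.
have T1 v : nrm (T v) <= K * q * nrm v by have := HT 1%N v; rewrite expr1.
apply: (@invertible_of _ S _ lU _ _ HS0).
- move=> v /=.
  have tel n : \sum_(k < n) iter k T v - T (\sum_(k < n) iter k T v) = v - iter n T v.
    elim: n => [|n IH]; first by rewrite big_ord0 (lin0 lT) !subrr.
    rewrite big_ord_recr/= (linD lT) opprD addrACA IH.
    by rewrite addrA subrK.
  apply/eqP; rewrite -subr_eq0; apply/eqP.
  apply: (@nrm_small _ ((1 + K * q) * A v + K * nrm v)) => e e0.
  have [n Hn] := exp_small q0 q1 e0; set s := \sum_(k < n) iter k T v.
  have -> : S v - T (S v) - v = (S v - s) - T (S v - s) - iter n T v.
    have := tel n; rewrite -/s => H.
    by rewrite (linB lT) subrACA H -[RHS]addrA -opprD subrK.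
  rewrite (le_trans (nrmB _ _))// mulrDl lerD//; last first.
    rewrite (le_trans (HT _ _))// mulrAC ler_wpM2l// mulr_ge0 ?nrm_ge0//.
  have hs : nrm (S v - s) <= A v * e.
    by rewrite nrmBC (le_trans (HS _ _))// ler_wpM2l.
  rewrite (le_trans (nrmB _ _))// (le_trans (lerD (lexx _) (T1 _)))//.
  by rewrite -[X in X + _]mul1r -mulrDl -mulrA ler_wpM2l// addr_ge0// mulr_ge0.
- move=> u v /= uv; apply/eqP; rewrite -subr_eq0; apply/eqP.
  have fix_uv : T (u - v) = u - v.
    by apply/eqP; rewrite eq_sym -subr_eq0 (linB lT) subrACA uv subrr.
  have fixn n : iter n T (u - v) = u - v.
    by elim: n => //= n IH; rewrite IH fix_uv.
  apply: (@nrm_small _ (K * nrm (u - v))) => e e0.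
  have [n Hn] := exp_small q0 q1 e0.
  rewrite -{1}(fixn n) (le_trans (HT _ _))// mulrAC ler_wpM2l// mulr_ge0 ?nrm_ge0//.
Qed.

(* Baire's argument: the images of the balls of integer radius cover the
   closed range, so one of them is dense in a ball of the range. *)
Lemma dense_image (U : V -> V) : linear U -> closed (range U) ->
  exists (n : nat) y0 (rho : R), [/\ range U y0, 0 < rho & forall y d, range U y ->
    nrm (y - y0) < rho -> 0 < d -> exists2 f, nrm (U f - y) < d & nrm f <= n%:R].
Proof.
move=> lU cU; apply: contrapT => H.
pose Y := range U.
have step (n : nat) (p : V * R) : exists q : V * R, Y p.1 -> 0 < p.2 ->
    [/\ Y q.1, 0 < q.2, q.2 <= p.2 / 2, nrm (q.1 - p.1) <= p.2 / 2 &
      forall f, nrm f <= n%:R -> q.2 < nrm (U f - q.1)].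
  have [[Yp p0]|np] := pselect (Y p.1 /\ 0 < p.2); last first.
    by exists p => Yp p0; case: np.
  have p2 : 0 < p.2 / 2 by rewrite divr_gt0.
  apply: contrapT => Hq; apply: H; exists n, p.1, (p.2 / 2); split => // y d Yy yp d0.
  apply: contrapT => Hf; apply: Hq.
  exists (y, Num.min (d / 2) (p.2 / 2)) => _ _ /=; split => //.
  - by rewrite lt_min divr_gt0.
  - by rewrite ge_min lexx orbT.
  - exact: ltW.
  - move=> f fn; rewrite ltNge; apply/negP => h; apply: Hf; exists f => //.
    rewrite (le_lt_trans h)// gt_min; apply/orP; left; lra.
have /choice[G HG] : forall np : nat * (V * R), exists q : V * R, Y np.2.1 -> 0 < np.2.2 ->
    [/\ Y q.1, 0 < q.2, q.2 <= np.2.2 / 2, nrm (q.1 - np.2.1) <= np.2.2 / 2 &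
      forall f, nrm f <= np.1%:R -> q.2 < nrm (U f - q.1)].
  by move=> [n p]; exact: step.
pose fix P (n : nat) : V * R := if n is m.+1 then G (m, P m) else (0, 1).
have P0 n : Y (P n).1 /\ 0 < (P n).2.
  elim: n => [|n [IH1 IH2]].
    by split => /=; [exists 0 => //; exact: lin0|exact: ltr01].
  by have [] := HG (n, P n) IH1 IH2.
have PS n : [/\ (P n.+1).2 <= (P n).2 / 2, nrm ((P n.+1).1 - (P n).1) <= (P n).2 / 2 &
      forall f, nrm f <= n%:R -> (P n.+1).2 < nrm (U f - (P n.+1).1)].
  by have [Y1 Y2] := P0 n; have [] := HG (n, P n) Y1 Y2.
have Pd n d : nrm ((P (n + d)%N).1 - (P n).1) <= (P n).2 - (P (n + d)%N).2.
  elim: d => [|d IH]; first by rewrite addn0 !subrr nrm0.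
  rewrite addnS; have [h1 h2 _] := PS (n + d)%N.
  have -> : (P (n + d).+1).1 - (P n).1 =
      ((P (n + d).+1).1 - (P (n + d)%N).1) + ((P (n + d)%N).1 - (P n).1).
    by rewrite addrA subrK.
  by rewrite (le_trans (nrmD _ _))//; lra.
have Pni n m : (n <= m)%N -> (P m).2 <= (P n).2.
  move=> nm; rewrite -(subnKC nm).
  by have := Pd n (m - n)%N; have := nrm_ge0 ((P (n + (m - n))%N).1 - (P n).1); lra.
have Pexp n : (P n).2 <= 2^-1 ^+ n.
  elim: n => [|n IH]; first by rewrite expr0.
  by have [h1 _ _] := PS n; rewrite exprS; lra.
have [l Hl] : exists l, forall n, nrm ((P n).1 - l) <= (P n).2.
  apply: (compV (u := fun n => (P n).1) (a := fun n => (P n).2)) => //.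
  - move=> e e0; have [n Hn] := half_small e0.
    by exists n; rewrite (le_trans (Pexp n)).
  - move=> n m; have [nm|/ltnW mn] := leqP n m.
      rewrite -(subnKC nm) nrmBC; have := Pd n (m - n)%N.
      by have [_ ] := P0 (n + (m - n))%N; lra.
    rewrite -(subnKC mn); have := Pd m (n - m)%N.
    by have [_ ] := P0 (m + (n - m))%N; lra.
have [f _ Uf] : Y l.
  apply: closed_nrm => // e e0.
  have [n Hn] := half_small (divr_gt0 e0 (ltr0n R 2)).
  exists (P n).1; first by have [] := P0 n.
  by have := Hl n; have := Pexp n; rewrite nrmBC; lra.
have [m fm] : exists m : nat, nrm f <= m%:R.
  exists (Num.truncn (nrm f)).+1.
  by have /andP[_ /ltW] := truncn_itv (nrm_ge0 f).
have [_ _ /(_ f fm)] := PS m; rewrite Uf ltNge => /negP; apply.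
by rewrite nrmBC; exact: Hl.
Qed.

Lemma open_mapping (U : V -> V) (M : R) : linear U -> 0 <= M ->
  (forall v, nrm (U v) <= M * nrm v) -> closed (range U) ->
  exists2 K : R, 0 <= K & forall g, range U g -> exists2 f, U f = g & nrm f <= K * nrm g.
Proof.
move=> lU M0 bU cU; have [n [y0 [rho [[f0 _ Uf0] rho0 Hd]]]] := dense_image lU cU.
have nn0 : (0 : R) <= n%:R by [].
have near0 y d : range U y -> nrm y < rho -> 0 < d ->
    exists2 f, nrm (U f - y) < d & nrm f <= 2 * n%:R.
  move=> [f _ Uf] yr d0; have d2 : 0 < d / 2 by rewrite divr_gt0.
  have [||f1 h1 n1] := Hd (y0 + y) (d / 2) _ _ d2.
  - by exists (f0 + f) => //; rewrite (linD lU) Uf0 Uf.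
  - by rewrite addrAC subrr add0r.
  have [||f2 h2 n2] := Hd y0 (d / 2) _ _ d2; [by exists f0|by rewrite subrr nrm0|].
  exists (f1 - f2); last by rewrite (le_trans (nrmB _ _))//; lra.
  rewrite (linB lU) (_ : _ - y = (U f1 - (y0 + y)) - (U f2 - y0)); last first.
    by rewrite subrACA [y0 + y]addrC addrK.
  by rewrite (le_lt_trans (nrmB _ _))//; lra.
pose K := 4 * n%:R / rho.
have K0 : 0 <= K by rewrite divr_ge0 ?(ltW rho0)// mulr_ge0.
have approx y : range U y -> exists2 f, nrm (U f - y) <= nrm y / 2 & nrm f <= K * nrm y.
  move=> Yy; have [y_eq0|y_neq0] := eqVneq (nrm y) 0.
    exists 0; last by rewrite nrm0 y_eq0 mulr0.
    by rewrite (lin0 lU) sub0r nrmN y_eq0 mul0r.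
  have y1 : 0 < nrm y by rewrite lt_neqAle eq_sym y_neq0 nrm_ge0.
  pose c := rho / 2 / nrm y.
  have c0 : 0 < c by rewrite !divr_gt0.
  have nc : normc (c%:C) = c by rewrite normc_normr ger0_norm// ltW.
  have nci : normc (c^-1%:C) = c^-1 by rewrite normc_normr ger0_norm// invr_ge0 ltW.
  have cy : nrm (c%:C *: y) = rho / 2 by rewrite nrmZ nc /c divfK// gt_eqF.
  have [|||f h nf] := near0 (c%:C *: y) (c * (nrm y / 2)).
  - by case: Yy => f _ <-; exists (c%:C *: f) => //; rewrite (linZ lU).
  - by rewrite cy; lra.
  - by move: (divr_gt0 y1 (ltr0n _ 2)) => ?; rewrite mulr_gt0.
  have ccC : c^-1%:C * c%:C = 1 :> R[i] by rewrite -rmorphM mulVf ?gt_eqF.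
  exists (c^-1%:C *: f).
    rewrite (linZ lU) (_ : _ - y = c^-1%:C *: (U f - c%:C *: y)); last first.
      by rewrite scalerBr scalerA ccC scale1r.
    by rewrite nrmZ nci ler_pdivrMl// ltW.
  rewrite nrmZ nci ler_pdivrMl//.
  have -> : c * (K * nrm y) = 2 * n%:R; last exact: nf.
  by rewrite /c /K; field; rewrite !gt_eqF.
have /choice[g Hg] : forall y, exists f, range U y ->
    nrm (U f - y) <= nrm y / 2 /\ nrm f <= K * nrm y.
  move=> y; have [/approx[f h1 h2]|nY] := pselect (range U y); last by exists 0.
  by exists f.
exists (2 * K) => [|y Yy]; first by rewrite mulr_ge0.
pose fix r (k : nat) : V := if k is j.+1 then r j - U (g (r j)) else y.
have Yr k : range U (r k) /\ nrm (r k) <= nrm y * 2^-1 ^+ k.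
  elim: k => [|k [[f _ Uf] IH]] /=; first by rewrite expr0 mulr1.
  split; first by exists (f - g (r k)) => //; rewrite (linB lU) Uf.
  have Yk : range U (r k) by exists f.
  have [h1 _] := Hg (r k) Yk.
  by rewrite nrmBC exprS; lra.
pose s k := \sum_(j < k) g (r j).
have Us k : y - U (s k) = r k.
  elim: k => [|k IH]; first by rewrite /s big_ord0 (lin0 lU) subr0.
  by rewrite /s big_ord_recr/= (linD lU) opprD addrA IH.
pose a k := 2 * K * nrm y * 2^-1 ^+ k.
have aK : 0 <= 2 * K * nrm y by rewrite mulr_ge0 ?nrm_ge0// mulr_ge0.
have h0 : (0 : R) <= 2^-1 by lra.
have h1 : (2^-1 : R) < 1 by lra.
have sd k d : nrm (s (k + d)%N - s k) <= a k - a (k + d)%N.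
  elim: d => [|d IH]; first by rewrite addn0 !subrr nrm0.
  rewrite addnS {1}/s big_ord_recr/= -/(s (k + d)%N) addrAC.
  rewrite (le_trans (nrmD _ _))//.
  have [Yk rk] := Yr (k + d)%N; have [_ gk] := Hg _ Yk.
  have : K * nrm (r (k + d)%N) <= K * (nrm y * 2^-1 ^+ (k + d)) by rewrite ler_wpM2l.
  have -> : a (k + d).+1 = a (k + d)%N / 2 by rewrite /a exprS; field.
  have -> : K * (nrm y * 2^-1 ^+ (k + d)) = a (k + d)%N / 2 by rewrite /a; field.
  lra.
have a0 k : 0 <= a k by rewrite mulr_ge0// exprn_ge0.
have [f Hf] : exists f, forall k, nrm (s k - f) <= a k.
  apply: compV.
  - by move=> k m km; rewrite ler_wpM2l//; apply: ler_wiXn2l => //; exact: ltW.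
  - move=> e e0; have [a00|a00] := eqVneq (2 * K * nrm y) 0.
      by exists 0%N; rewrite /a a00 mul0r ltW.
    have a1 : 0 < 2 * K * nrm y by rewrite lt_neqAle eq_sym a00 aK.
    have [m Hm] := half_small (divr_gt0 e0 a1).
    by exists m; rewrite /a mulrC -ler_pdivlMr.
  - move=> k m; have [km|/ltnW mk] := leqP k m.
      by rewrite -(subnKC km) nrmBC; have := sd k (m - k)%N; have := a0 (k + (m - k))%N; lra.
    by rewrite -(subnKC mk); have := sd m (k - m)%N; have := a0 (m + (k - m))%N; lra.
exists f; last first.
  by have := Hf 0%N; rewrite /s big_ord0 sub0r nrmN /a expr0 mulr1.
apply/eqP; rewrite -subr_eq0; apply/eqP.
apply: (@nrm_small _ (M * (2 * K * nrm y) + nrm y)) => e e0.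
have [k Hk] := half_small e0; have [_ rk] := Yr k.
have -> : U f - y = U (f - s k) - r k.
  by rewrite -Us (linB lU) opprB addrA subrK.
rewrite (le_trans (nrmB _ _))// mulrDl lerD//.
  rewrite (le_trans (bU _))// -mulrA ler_wpM2l// nrmBC (le_trans (Hf _))//.
  by rewrite ler_wpM2l.
by rewrite (le_trans rk)// ler_wpM2l ?nrm_ge0.
Qed.

End banach.

(** * The spaces A^2_alpha *)

Section A2_theory.
Context {R : realType} (alpha : R).
Hypothesis alpha_ge : -1 <= alpha.
Notation C := (cplx R).
Notation V := (A2_space alpha).
Implicit Types F G : V.

Lemma A2_nrmE F : nrm F = fine (A2_norm alpha F).
Proof. by []. Qed.

Lemma A2D F G w : (F + G) w = F w + G w.
Proof. by []. Qed.

Lemma A2B F G w : (F - G) w = F w - G w.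
Proof. by []. Qed.

Lemma A2Z (c : R[i]) F w : (c *: F) w = c * F w.
Proof. by []. Qed.

Lemma A20 w : (0 : V) w = 0.
Proof. by []. Qed.

Lemma A2_sum I (r : seq I) (f : I -> V) w :
  (\sum_(i <- r) f i) w = \sum_(i <- r) f i w.
Proof.
by elim: r => [|i r IH]; rewrite ?big_nil ?A20// !big_cons A2D IH.
Qed.

Lemma A2_out F w : ~ 0 < complex.Im w -> F w = 0.
Proof. exact: (A2_admissible F).2. Qed.

Lemma A2_ext F G : (forall w, 0 < complex.Im w -> F w = G w) -> F = G.
Proof.
move=> FG; apply/val_inj/funext => w /=.
by have [w0|w0] := pselect (0 < complex.Im w); [exact: FG|rewrite !A2_out].
Qed.

Lemma nnpF F : nnp (sqmag F).
Proof. exact: nnp_sqmag (A2_admissible F). Qed.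

Lemma energy_nrm F : (energy alpha (sqmag F) <= (nrm F ^+ 2)%:E)%E.
Proof.
rewrite -(A2_norm_le alpha (A2_admissible F) (nrm_ge0 F)).
by rewrite A2_nrmE fineK// A2_norm_fin.
Qed.

Lemma nrm_le F (c : R) : 0 <= c -> (energy alpha (sqmag F) <= (c ^+ 2)%:E)%E ->
  nrm F <= c.
Proof.
move=> c0; rewrite -(A2_norm_le alpha (A2_admissible F) c0) A2_nrmE.
by move=> h; rewrite -lee_fin fineK// A2_norm_fin.
Qed.

Lemma A2_ex (f : C -> C) : admissible f -> (energy alpha (sqmag f) < +oo)%E ->
  exists F, A2_fun F = f.
Proof.
move=> af ef.
have e0 := energy_ge0 alpha (nnp_sqmag af).
have fN : f \in A2_pred alpha.
  apply/A2_predP; split => //.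
  pose c := fine (energy alpha (sqmag f)).
  have c0 : 0 <= c by exact: fine_ge0.
  have c1 : 0 <= 1 + c by rewrite addr_ge0.
  apply: (@le_lt_trans _ _ (1 + c)%:E); last exact: ltry.
  rewrite A2_norm_le// (@le_trans _ _ c%:E)//.
    by rewrite fineK// ge0_fin_numE.
  by rewrite lee_fin expr2; nra.
by exists (MkA2 fN).
Qed.

Lemma A2_point : exists2 K : R, 0 < K & forall F x y, 0 < y ->
  normc (F (x +i* y)) <= K * y `^ (- ((alpha + 2) / 2)) * nrm F.
Proof.
have [K K0 HK] := point_evaluation alpha.
exists (Num.sqrt K) => [|F x y y0]; first by rewrite sqrtr_gt0.
have b0 : 0 <= Num.sqrt K * y `^ (- ((alpha + 2) / 2)) * nrm F.
  by rewrite mulr_ge0 ?nrm_ge0// mulr_ge0 ?sqrtr_ge0// powR_ge0.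
rewrite -(@ler_pXn2r _ 2)// ?nnegrE ?normc_ge0//.
rewrite -lee_fin (le_trans (HK _ x y (A2_admissible F) y0))//.
have k0 : (0 <= (K * y `^ (- (alpha + 2)))%:E)%E.
  by rewrite lee_fin mulr_ge0 ?powR_ge0// ltW.
rewrite (le_trans (lee_wpmul2l k0 (energy_nrm F)))// -EFinM lee_fin !exprMn.
rewrite sqr_sqrtr ?(ltW K0)// -[X in _ <= K * X * _]powR_mulrn ?powR_ge0// -powRrM.
by rewrite mulNr divfK.
Qed.

Lemma A2_fatou (f : nat -> V) (g : C -> C) (B : R) : admissible g -> 0 <= B ->
  (forall w : C, 0 < complex.Im w -> forall e : R, 0 < e ->
     exists N, forall m, (N <= m)%N -> normc (f m w - g w) <= e) ->
  (forall m, nrm (f m) <= B) -> (energy alpha (sqmag g) <= (B ^+ 2)%:E)%E.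
Proof.
move=> ag B0 fg fB.
apply: (@energy_fatou R alpha (fun m => sqmag (f m))).
- by move=> m; exact: nnpF.
- exact: nnp_sqmag.
- move=> [x y] /= y0.
  have h : (fun m => normc (f m (x +i* y))) @ \oo --> normc (g (x +i* y)).
    apply/cvgrPdist_le => e e0; have [N HN] := fg (x +i* y) y0 e e0.
    exists N => // m /= Nm; have h := HN m Nm.
    have h1 := normcD (f m (x +i* y) - g (x +i* y)) (g (x +i* y)).
    have h2 := normcD (g (x +i* y) - f m (x +i* y)) (f m (x +i* y)).
    rewrite !subrK in h1 h2; rewrite normcB in h2.
    by rewrite ler_norml; apply/andP; split; lra.
  have h2 := @cvg_comp _ _ _ _ (fun z : R => z ^+ 2) _ _ _ h
    (@exprn_continuous R 2 (normc (g (x +i* y)))).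
  by refine h2.
- move=> m; rewrite (le_trans (energy_nrm _))// lee_fin lerXn2r ?nnegrE ?nrm_ge0//.
Qed.

Lemma A2_complete : @seq_complete R V.
Proof.
move=> u a ani a_to0 ua.
have al2 : 0 <= (alpha + 2) / 2.
  by have := alpha_ge => h; rewrite divr_ge0//; lra.
have [K K0 HK] := A2_point.
pose k y := K * y `^ (- ((alpha + 2) / 2)).
have k0 y : 0 <= k y by rewrite mulr_ge0 ?powR_ge0// ltW.
have kni y y' : 0 < y -> y <= y' -> k y' <= k y.
  move=> y0 yy; rewrite ler_wpM2l ?(ltW K0)// !powRN.
  have y'0 : 0 < y' by rewrite (lt_le_trans y0).
  rewrite lef_pV2 ?posrE ?powR_gt0//; apply: ge0_ler_powR => //.
  - by rewrite nnegrE ltW.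
  - by rewrite nnegrE ltW.
have a0 n : 0 <= a n.
  by have := ua n n; rewrite subrr nrm0; lra.
have /choice[l Hl] : forall w : C, exists l : C, 0 < complex.Im w ->
    forall n, normc (u n w - l) <= 2 * (k (complex.Im w) * a n).
  move=> [x y]; have [/= y0|y0] := pselect (0 < y); last by exists 0.
  have [|l Hl] := @cauchy_cseq_ex R (fun n => u n (x +i* y)) (fun n => k y * a n).
    move=> n m; rewrite -mulrDr -A2B (le_trans (HK _ x y y0))//; apply: ler_wpM2l => //; exact: k0.
  by exists l.
pose L := ext0 l.
have aL : admissible L.
  apply: admissible_ext0.
  apply: (@weierstrass R (fun n => u n) l a (fun y => 2 * k y)) => //.
  - by move=> n; exact: (A2_admissible (u n)).1.
  - by move=> y y' y0 yy; rewrite ler_pM2l// kni.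
  - move=> n x y y0; have /= h := Hl (x +i* y) y0 n; rewrite (le_trans h)//.
    by rewrite mulrA mulrC.
have cvL (w : C) : 0 < complex.Im w -> forall e : R, 0 < e ->
    exists N, forall m, (N <= m)%N -> normc (u m w - L w) <= e.
  move=> w0 e e0; have kw : 0 < 2 * k (complex.Im w) + 1 by rewrite ltr_wpDl// mulr_ge0.
  have [N HN] := a_to0 _ (divr_gt0 e0 kw); exists N => m Nm.
  rewrite /L ext0E// (le_trans (Hl _ w0 m))// mulrA.
  apply: (@le_trans _ _ ((2 * k (complex.Im w) + 1) * a m)); first by rewrite ler_wpM2r// lerDl.
  by rewrite -ler_pdivlMl// mulrC (le_trans (ani _ _ Nm)).
have uB m : nrm (u m) <= nrm (u 0%N) + 2 * a 0%N.
  have h := ua m 0%N; have := ani 0%N m (leq0n m); have := nrmD (u m - u 0%N) (u 0%N).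
  by rewrite subrK; lra.
have B0 : 0 <= nrm (u 0%N) + 2 * a 0%N by rewrite addr_ge0 ?nrm_ge0// mulr_ge0.
have [||Lf HL] := @A2_ex L.
- exact: aL.
- exact: le_lt_trans (A2_fatou aL B0 cvL uB) (ltry _).
exists Lf => n; apply/ler_addgt0Pr => e e0.
have [N HN] := a_to0 e e0.
have c0 : 0 <= a n + e by rewrite addr_ge0// ltW.
apply: nrm_le => //.
apply: (A2_fatou (f := fun m => u n - u (N + m)%N)) => //.
- exact: A2_admissible.
- move=> w w0 d d0; have [M HM] := cvL w w0 d d0; exists M => m Mm.
  rewrite !A2B HL.
  have aux (p q r : R[i]) : p - q - (p - r) = - (q - r) by ring.
  by rewrite aux normcN; apply: HM; rewrite (leq_trans Mm)// leq_addl.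
- move=> m; rewrite (le_trans (ua _ _))// lerD2l.
  by rewrite (le_trans (ani N _ _))// leq_addr.
Qed.

(* The constant is uniform in mu and w0: the bound applied to the iterates of
   C_tau gives the spectral radius. *)
Lemma A2_comp_bound : exists2 K : R, 0 < K & forall (mu : R) (w0 : C) F G,
  0 < mu -> 0 <= complex.Im w0 ->
  (forall w : C, 0 < complex.Im w -> G w = F (mu%:C * w + w0)) ->
  nrm G <= K * mu `^ (- ((alpha + 2) / 2)) * nrm F.
Proof.
have [K K0 HK] := energy_comp_affine alpha_ge.
exists (Num.sqrt K) => [|mu w0 F G mu0 w00 FG]; first by rewrite sqrtr_gt0.
apply: nrm_le; first by rewrite mulr_ge0 ?nrm_ge0// mulr_ge0 ?sqrtr_ge0// powR_ge0.
have GE : A2_fun G = comp_affine mu w0 F.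
  apply/funext => w; have [iw|iw] := pselect (0 < complex.Im w).
    by rewrite /comp_affine ext0E// FG.
  by rewrite A2_out// /comp_affine /ext0 (negbTE (introN idP iw)).
rewrite GE (le_trans (HK mu w0 F mu0 w00 (A2_admissible F)))//.
have k0 : (0 <= (K * mu `^ (- (alpha + 2)))%:E)%E.
  by rewrite lee_fin mulr_ge0 ?powR_ge0// ltW.
rewrite (le_trans (lee_wpmul2l k0 (energy_nrm F)))// -EFinM lee_fin !exprMn.
rewrite sqr_sqrtr ?(ltW K0)// -[X in _ <= K * X * _]powR_mulrn ?powR_ge0// -powRrM.
by rewrite mulNr divfK.
Qed.

Lemma A2_comp_ex (mu : R) (w0 : C) : 0 < mu -> 0 <= complex.Im w0 ->
  exists T : V -> V, forall F (w : C), 0 < complex.Im w -> T F w = F (mu%:C * w + w0).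
Proof.
move=> mu0 w00; have [K K0 HK] := energy_comp_affine alpha_ge.
suff /choice[T HT] : forall F, exists G : V, forall w : C, 0 < complex.Im w ->
    G w = F (mu%:C * w + w0) by exists T.
move=> F; have [||G HG] := @A2_ex (comp_affine mu w0 F).
- exact: admissible_comp_affine (A2_admissible F).
- apply: (le_lt_trans (HK mu w0 F mu0 w00 (A2_admissible F))).
  rewrite lte_mul_pinfty ?lee_fin ?mulr_ge0 ?powR_ge0 ?(ltW K0)//.
  exact: le_lt_trans (energy_nrm F) (ltry _).
- by exists G => w iw; rewrite HG /comp_affine ext0E.
Qed.

End A2_theory.

Section invertibility.
Context {R : realType} {V : normedModType R[i]}.

Lemma invertible_scale (c : R[i]) (U : V -> V) : c != 0 -> invertible_operator U ->
  invertible_operator (fun v => c *: U v).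
Proof.
move=> c0 [S [bS US SU]]; have [M M0 HM] := bounded_operator_nrm bS.
exists (fun v => S (c^-1 *: v)); split.
- apply: (@operator_nrm_bounded _ _ _ (M * normc c^-1)).
    by move=> a u v; rewrite scalerDr scalerA mulrC -scalerA bS.1.
  by move=> v; rewrite (le_trans (HM _))// nrmZ mulrA.
- by move=> v /=; rewrite scalerA mulVf// scale1r US.
- by move=> v /=; rewrite SU scalerA mulfV// scale1r.
Qed.

Lemma invertible_comp (U1 U2 : V -> V) : invertible_operator U1 ->
  invertible_operator U2 -> invertible_operator (fun v => U1 (U2 v)).
Proof.
move=> [S1 [bS1 US1 SU1]] [S2 [bS2 US2 SU2]].
exists (fun v => S2 (S1 v)); split.
- have [M1 M10 HM1] := bounded_operator_nrm bS1.
  have [M2 M20 HM2] := bounded_operator_nrm bS2.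
  apply: (@operator_nrm_bounded _ _ _ (M2 * M1)).
    by move=> a u v; rewrite bS1.1 bS2.1.
  by move=> v; rewrite (le_trans (HM2 _))// -mulrA ler_pM2l.
- by move=> v /=; rewrite US1 US2.
- by move=> v /=; rewrite SU2 SU1.
Qed.

End invertibility.

Section composition.
Context {R : realType} (alpha : R).
Hypothesis alpha_ge : -1 <= alpha.
Notation C := (cplx R).
Notation V := (A2_space alpha).
Implicit Types F G : V.

Definition comp_rel (mu : R) (w0 : C) (T : V -> V) :=
  forall F (w : C), 0 < complex.Im w -> T F w = F (mu%:C * w + w0).

Lemma comp_linear mu w0 T : comp_rel mu w0 T -> linear T.
Proof.
move=> HT c F G; apply: A2_ext => w iw.
by rewrite HT// !A2D !A2Z !HT.
Qed.

Lemma comp_bounded mu w0 T : 0 < mu -> 0 <= complex.Im w0 -> comp_rel mu w0 T ->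
  bounded_operator T.
Proof.
move=> mu0 w00 HT; have [K K0 HK] := A2_comp_bound alpha_ge.
apply: (operator_nrm_bounded (comp_linear HT)) => F.
exact: (HK mu w0 F (T F) mu0 w00 (HT F)).
Qed.

Lemma comp_iter mu w0 T n : 0 < mu -> 0 <= complex.Im w0 -> comp_rel mu w0 T ->
  exists2 v : C, 0 <= complex.Im v & comp_rel (mu ^+ n) v (iter n T).
Proof.
move=> mu0 w00 HT; elim: n => [|n [v v0 IH]].
  by exists 0 => // F w iw; rewrite /= expr0 mul1r addr0.
exists ((mu ^+ n)%:C * w0 + v).
  by rewrite Im_affine addr_ge0// mulr_ge0// exprn_ge0// ltW.
move=> F w iw; rewrite [LHS]HT// IH; last exact: Im_affine_gt0.
have aux (m p q r s : R[i]) : p * (m * q + r) + s = m * p * q + (p * r + s) by ring.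
by rewrite aux exprS rmorphM.
Qed.

Lemma powR_exp (mu s : R) n : 0 <= mu -> (mu ^+ n) `^ s = (mu `^ s) ^+ n.
Proof.
by move=> mu0; rewrite -powR_mulrn// -powRrM mulrC powRrM powR_mulrn// powR_ge0.
Qed.

Lemma iterZ (c : R[i]) (T : V -> V) n F : linear T ->
  iter n (fun G => c *: T G) F = c ^+ n *: iter n T F.
Proof.
move=> lT; elim: n => [|n IH]; first by rewrite expr0 scale1r.
by rewrite /= IH (linZ lT) scalerA exprS.
Qed.

Lemma comp_neumann mu w0 T (c : R[i]) : 0 < mu -> 0 <= complex.Im w0 ->
  comp_rel mu w0 T -> normc c * mu `^ (- ((alpha + 2) / 2)) < 1 ->
  invertible_operator (fun F => F - c *: T F).
Proof.
move=> mu0 w00 HT c1; have lT := comp_linear HT.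
have [K K0 HK] := A2_comp_bound alpha_ge.
have q0 : 0 <= normc c * mu `^ (- ((alpha + 2) / 2)).
  by rewrite mulr_ge0 ?normc_ge0 ?powR_ge0.
apply: (neumann (A2_complete alpha_ge) _ (ltW K0) q0 c1).
  by move=> a u v; rewrite lT scalerDr !scalerA mulrC.
move=> n F; rewrite iterZ// nrmZ normcX.
have [v v0 Hv] := comp_iter n mu0 w00 HT.
have := HK _ v F _ (exprn_gt0 n mu0) v0 (Hv F).
rewrite powR_exp ?(ltW mu0)// => h.
have cn : 0 <= normc c ^+ n by rewrite exprn_ge0 ?normc_ge0.
rewrite (le_trans (ler_wpM2l cn h))// exprMn.
by rewrite le_eqVlt; apply/orP; left; apply/eqP; ring.
Qed.

Lemma spectrum_outer mu w0 T (l : R[i]) : 0 < mu -> 0 <= complex.Im w0 ->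
  comp_rel mu w0 T -> mu `^ (- ((alpha + 2) / 2)) < normc l ->
  invertible_operator (fun F => T F - l *: F).
Proof.
move=> mu0 w00 HT rl.
have nl : 0 < normc l by rewrite (le_lt_trans _ rl)// powR_ge0.
have l0 : l != 0 by rewrite -normc_gt0.
have nl0 : - l != 0 by rewrite oppr_eq0.
have -> : (fun F => T F - l *: F) = (fun F => - l *: (F - l^-1 *: T F)).
  apply/funext => F; rewrite scalerBr scalerA mulNr mulfV// !scaleNr scale1r opprK.
  by rewrite addrC.
apply: invertible_scale => //; apply: comp_neumann HT _ => //.
rewrite normcV mulrC ltr_pdivrMr// mul1r//.
Qed.

Lemma spectrum_inner mu w0 T (l : R[i]) : 0 < mu -> complex.Im w0 = 0 ->
  comp_rel mu w0 T -> normc l < mu `^ (- ((alpha + 2) / 2)) ->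
  invertible_operator (fun F => T F - l *: F).
Proof.
move=> mu0 w00 HT rl; have lT := comp_linear HT.
have mui : 0 < mu^-1 by rewrite invr_gt0.
pose v0 : C := - (mu^-1)%:C * w0.
have w00' : 0 <= complex.Im w0 by rewrite w00.
have v00 : complex.Im v0 = 0.
  by rewrite /v0; case: (w0) w00 => a b /= ->; ring.
have v00' : 0 <= complex.Im v0 by rewrite v00.
have [S HS] := A2_comp_ex alpha_ge mui v00'.
have mC : (mu^-1)%:C * mu%:C = 1 :> R[i] by rewrite -rmorphM mulVf ?gt_eqF.
have TS : cancel S T.
  move=> F; apply: A2_ext => w iw; rewrite HT// HS; last exact: Im_affine_gt0.
  have aux (m k p q : R[i]) : m * (k * p + q) + - m * q = m * k * p by ring.
  by rewrite /v0 aux mC mul1r.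
have ST : cancel T S.
  move=> F; apply: A2_ext => w iw; rewrite HS// HT; last exact: Im_affine_gt0.
  have aux (m k p q : R[i]) : k * (m * p + - m * q) + q = m * k * (p - q) + q by ring.
  by rewrite /v0 aux mC mul1r subrK.
have iT : invertible_operator T.
  by exists S; split => //; exact: comp_bounded HS.
have -> : (fun F => T F - l *: F) = (fun F => T (F - l *: S F)).
  by apply/funext => F; rewrite (linB lT) (linZ lT) TS.
apply: (invertible_comp iT); apply: comp_neumann HS _ => //.
have r0 : 0 < mu `^ (- ((alpha + 2) / 2)) by rewrite powR_gt0.
by rewrite -(ltr_pM2r r0) -mulrA -powRM ?(ltW mui) ?(ltW mu0)// mulVf ?gt_eqF// powR1 mulr1 mul1r.
Qed.

End composition.

(** * Criteria for the failure of the Fredholm property *)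

Section finite_dimension.
Context {R : realType}.

Lemma exists_relation n (c : 'I_n.+1 -> 'I_n -> R[i]) :
  exists2 v : 'I_n.+1 -> R[i], (exists i, v i != 0) &
    forall k, \sum_i v i * c i k = 0.
Proof.
pose A : 'M[R[i]]_(n.+1, n) := \matrix_(i, k) c i k.
have rk : (0 < \rank (kermx A))%N.
  by rewrite mxrank_ker subn_gt0 (leq_ltn_trans (rank_leq_col A)).
have kA : kermx A != 0 by rewrite -mxrank_eq0 -lt0n.
have /rowV0Pn[v vA v0] := kA.
exists (fun i => v 0 i).
  by have /rV0Pn[i vi] := v0; exists i.
move=> k; have /sub_kermxP/matrixP/(_ 0 k) := vA; rewrite !mxE => h.
rewrite -[RHS]h; by apply: eq_bigr => i _; rewrite mxE.
Qed.

Lemma dominant_row n (v : 'I_n.+1 -> R[i]) : (exists i, v i != 0) ->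
  exists j, v j != 0 /\ forall a : 'I_n.+1 -> R[i],
    normc (v j) * (normc (a j) - \sum_(i | i != j) normc (a i)) <=
    normc (\sum_i v i * a i).
Proof.
move=> [i0 vi0].
have [j vj] : exists j, forall i, normc (v i) <= normc (v j).
  by case: (@arg_maxP _ _ _ i0 xpredT (fun i => normc (v i)) isT) => j _ vj; exists j => i; exact: vj.
have vj0 : v j != 0.
  by rewrite -normc_gt0 (lt_le_trans _ (vj i0))// normc_gt0.
exists j; split => // a; rewrite [in leRHS](bigD1 j)//=.
have h : normc (\sum_(i | i != j) v i * a i) <= normc (v j) * \sum_(i | i != j) normc (a i).
  rewrite (le_trans (normc_sum _ _ _))// mulr_sumr; apply: ler_sum => i _.
  by rewrite normcM ler_wpM2r ?normc_ge0.
set s := \sum_(i | i != j) v i * a i in h *.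
have := normcD (v j * a j + s) (- s); rewrite addrK normcN normcM.
by rewrite mulrBr; lra.
Qed.

End finite_dimension.

Section fredholm_criteria.
Context {R : realType} (alpha : R).
Hypothesis alpha_ge : -1 <= alpha.
Notation C := (cplx R).
Notation V := (A2_space alpha).
Implicit Types F G : V.

Definition bounded_at_points (f : nat -> V) :=
  forall w : C, 0 < complex.Im w -> exists M : R, forall N, normc (f N w) <= M.

Lemma span_bounded_at_points n (e : 'I_n -> V) (f : nat -> V) :
  (forall N, exists c : 'I_n -> R[i], f N = \sum_i c i *: e i) ->
  bounded_at_points f -> exists M : R, forall N, nrm (f N) <= M.
Proof.
elim: n e f => [|n IH] e f fe fb.
  by exists 0 => N; have [c ->] := fe N; rewrite big_ord0 nrm0.
pose el := e ord_max; pose ew i := e (widen_ord (leqnSn n) i).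
have [[w1 iw1 el1]|nel] := pselect (exists2 w1 : C, 0 < complex.Im w1 & el w1 != 0).
  pose t i := ew i w1 / el w1; pose d N := f N w1 / el w1.
  have [M1 HM1] := fb w1 iw1.
  have dN N : normc (d N) <= M1 / normc (el w1).
    by rewrite normcM normcV ler_wpM2r ?invr_ge0 ?normc_ge0.
  have [||M HM] := IH (fun i => ew i - t i *: el) (fun N => f N - d N *: el).
  - move=> N; have [c Hc] := fe N; exists (fun i => c (widen_ord (leqnSn n) i)).
    rewrite big_ord_recr/= in Hc.
    have dE : d N = \sum_(i < n) c (widen_ord (leqnSn n) i) * t i + c ord_max.
      rewrite /d Hc A2D A2_sum A2Z mulrDl mulfK// mulr_suml; congr (_ + _).
      by apply: eq_bigr => i _; rewrite A2Z mulrA.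
    under eq_bigr do rewrite scalerBr scalerA.
    rewrite sumrB -scaler_suml [in LHS]Hc dE scalerDl opprD.
    by rewrite addrACA subrr addr0.
  - move=> w iw; have [M HM] := fb w iw.
    exists (M + M1 / normc (el w1) * normc (el w)) => N.
    rewrite A2B A2Z (le_trans (normcD _ _))// normcN normcM lerD//.
    by rewrite ler_wpM2r ?normc_ge0.
  exists (M + M1 / normc (el w1) * nrm el) => N.
  rewrite -[f N](subrK (d N *: el)) (le_trans (nrmD _ _))// lerD// nrmZ.
  by rewrite ler_wpM2r ?nrm_ge0.
have el0 : el = 0.
  apply: A2_ext => w iw; apply/eqP/negPn/negP => h; apply: nel; by exists w.
apply: (IH ew) => // N; have [c Hc] := fe N; exists (fun i => c (widen_ord (leqnSn n) i)).
by rewrite Hc big_ord_recr/= -/el el0 scaler0 addr0.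
Qed.

Lemma point_bound (w : C) : 0 < complex.Im w ->
  exists2 K : R, 0 < K & forall F, normc (F w) <= K * nrm F.
Proof.
case: w => x y /= y0; have [K K0 HK] := A2_point alpha.
exists (K * y `^ (- ((alpha + 2) / 2))); first by rewrite mulr_gt0 ?powR_gt0.
by move=> F; exact: HK.
Qed.

Variable U : V -> V.
Hypothesis bU : bounded_operator U.

Let lU : linear U := bU.1.

Lemma range_preimage : fredholm U ->
  exists2 K : R, 0 <= K & forall g, exists2 h, U h = U g & nrm h <= K * nrm (U g).
Proof.
move=> [_ cU _]; have [M M0 HM] := bounded_operator_nrm bU.
have [K K0 HK] := open_mapping (A2_complete alpha_ge) lU (ltW M0) HM cU.
by exists K => // g; apply: HK; exists g.
Qed.

Lemma fredholm_bounded (f : nat -> V) (B : R) : fredholm U ->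
  (forall N, nrm (U (f N)) <= B) -> bounded_at_points f ->
  exists M : R, forall N, nrm (f N) <= M.
Proof.
move=> fU UfB fb; have [K K0 HK] := range_preimage fU.
have [[n [e He]] _ _] := fU.
have /choice[h Hh] : forall N, exists h, U h = U (f N) /\ nrm h <= K * B.
  move=> N; have [h h1 h2] := HK (f N); exists h; split => //.
  by rewrite (le_trans h2)// ler_wpM2l.
have [||M HM] := @span_bounded_at_points n e (fun N => f N - h N).
- by move=> N; apply: He; rewrite /= (linB lU) (Hh N).1 subrr.
- move=> w iw; have [M HM] := fb w iw; have [D D0 HD] := point_bound iw.
  exists (M + D * (K * B)) => N; rewrite A2B (le_trans (normcD _ _))// normcN lerD//.
  by rewrite (le_trans (HD _))// ler_pM2l// (Hh N).2.
exists (M + K * B) => N; rewrite -[f N](subrK (h N)) (le_trans (nrmD _ _))// lerD//.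
exact: (Hh N).2.
Qed.

(* The hypothesis makes the matrix [E i (p j)] diagonally dominant. The open
   mapping theorem moves the [E i] into the kernel by a small correction, so that
   the kernel has dimension larger than n. *)
Lemma infinite_kernel :
  (forall n, exists2 p : 'I_n.+1 -> C, (forall j, 0 < complex.Im (p j)) &
    forall eps : R, 0 < eps -> exists2 E : 'I_n.+1 -> V,
      (forall i, nrm (U (E i)) <= eps) &
      forall j, \sum_(i | i != j) normc (E i (p j)) + 2^-1 <= normc (E j (p j))) ->
  ~ fredholm U.
Proof.
move=> H fU; have [K K0 HK] := range_preimage fU.
have [[n [e He]] _ _] := fU; have [p p0 HE] := H n.
have /choice[d Hd] : forall j, exists d : R, 0 < d /\ forall F, normc (F (p j)) <= d * nrm F.
  by move=> j; have [d d0 Hd] := point_bound (p0 j); exists d.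
pose D := \sum_j d j.
have D0 : 0 <= D by apply: sumr_ge0 => j _; exact: ltW (Hd j).1.
have HD j F : normc (F (p j)) <= D * nrm F.
  rewrite (le_trans ((Hd j).2 F))// ler_wpM2r ?nrm_ge0// /D (bigD1 j)//= lerDl.
  by apply: sumr_ge0 => i _; exact: ltW (Hd i).1.
have c0 : 0 < n.+1%:R * D * K + 1 by rewrite ltr_wpDl// !mulr_ge0.
have eps0 : 0 < 4^-1 / (n.+1%:R * D * K + 1) by rewrite divr_gt0.
set eps := _ / _ in eps0; have [E UE Edom] := HE _ eps0.
have /choice[h Hh] : forall i, exists h, U h = U (E i) /\ nrm h <= K * eps.
  move=> i; have [h h1 h2] := HK (E i); exists h; split => //.
  by rewrite (le_trans h2)// ler_wpM2l.
have /choice[c Hc] : forall i, exists c : 'I_n -> R[i], E i - h i = \sum_k c k *: e k.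
  by move=> i; apply: He; rewrite /= (linB lU) (Hh i).1 subrr.
have [v v0 vc] := exists_relation c.
have [j [vj vdom]] := dominant_row v0.
have := vdom (fun i => (E i - h i) (p j)).
have -> : \sum_i v i * (E i - h i) (p j) = 0.
  under eq_bigr do rewrite Hc A2_sum mulr_sumr.
  rewrite exchange_big/= big1// => k _.
  transitivity (\sum_i v i * c i k * e k (p j)).
    by apply: eq_bigr => i _; rewrite -mulrA.
  by rewrite -mulr_suml vc mul0r.
rewrite normc0 pmulr_rle0 ?normc_gt0// leNgt => /negP; apply.
have hs i : normc (h i (p j)) <= D * (K * eps).
  by rewrite (le_trans (HD _ _))// ler_wpM2l// (Hh i).2.
have h1 : normc (E j (p j)) <= normc ((E j - h j) (p j)) + D * (K * eps).
  by rewrite A2B -{1}[E j (p j)](subrK (h j (p j))) (le_trans (normcD _ _))// lerD2l.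
have h2 : \sum_(i | i != j) normc ((E i - h i) (p j)) <=
    \sum_(i | i != j) normc (E i (p j)) + n%:R * (D * (K * eps)).
  have -> : n%:R * (D * (K * eps)) = \sum_(i < n.+1 | i != j) D * (K * eps).
    by rewrite sumr_const cardC1 card_ord mulr_natl.
  rewrite -big_split/=; apply: ler_sum => i _.
  apply: (le_trans (normcD (E i (p j)) (- h i (p j)))).
  by rewrite normcN lerD2l.
have h3 : n.+1%:R * (D * (K * eps)) <= 4^-1.
  rewrite /eps !mulrA ler_pdivrMr// mulrDr mulr1.
  rewrite [leLHS](_ : _ = 4^-1 * (n.+1%:R * D * K)); last by ring.
  by rewrite lerDl.
have := Edom j; rewrite -natr1 in h3; lra.
Qed.

Lemma infinite_codimension :
  (forall n, exists (G : 'I_n.+1 -> V) (ell : 'I_n.+1 -> nat -> V -> R[i]), [/\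
    forall j N c F F', ell j N (c *: F + F') = c * ell j N F + ell j N F',
    forall j F (eps : R), 0 < eps -> exists N0, forall N, (N0 <= N)%N ->
        normc (ell j N (U F)) <= eps &
    forall j N, \sum_(i | i != j) normc (ell j N (G i)) + 2^-1 <= normc (ell j N (G j))]) ->
  ~ fredholm U.
Proof.
move=> H [_ _ [n [e He]]]; have [G [ell [lin_ell ell_lim Gdom]]] := H n.
have /choice[h Hh] : forall i, exists h : V * ('I_n -> R[i]),
    G i = U h.1 + \sum_k h.2 k *: e k.
  by move=> i; have [_ [h _ <-] [c Hc]] := He (G i); exists (h, c).
have [v v0 vc] := exists_relation (fun i => (h i).2).
have [j [vj vdom]] := dominant_row v0.
pose X := \sum_i v i *: (h i).1.
have GX : \sum_i v i *: G i = U X.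
  under eq_bigr do rewrite Hh scalerDr.
  rewrite big_split/= [X in _ + X](_ : _ = 0) ?addr0.
    by rewrite /X (lin_sum lU); apply: eq_bigr => i _; rewrite (linZ lU).
  under eq_bigr do rewrite scaler_sumr.
  rewrite exchange_big/= big1// => k _.
  under eq_bigr do rewrite scalerA.
  by rewrite -scaler_suml vc scale0r.
have nv : 0 < normc (v j) by rewrite normc_gt0.
have [N HN] := ell_lim j X (normc (v j) / 4) (divr_gt0 nv (ltr0n _ 4)).
have := vdom (fun i => ell j N (G i)).
have ell0 : ell j N 0 = 0.
  by have := lin_ell j N 1 0 0; rewrite scaler0 addr0 mul1r => /eqP;
    rewrite -subr_eq0 opprD addNKr oppr_eq0 => /eqP.
have -> : \sum_i v i * ell j N (G i) = ell j N (U X).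
  rewrite -GX; elim: (index_enum _) => [|i s IH]; first by rewrite !big_nil ell0.
  by rewrite !big_cons lin_ell IH.
move/le_trans => /(_ _ (HN N (leqnn N))); rewrite ler_pM2l//.
by have := Gdom j N; lra.
Qed.

End fredholm_criteria.

(** * Peak functions *)

Section hump.
Context {R : realType}.

Definition hump (t : R) : R := 4 * t / (1 + t) ^+ 2.

Lemma hump_ge0 t : 0 <= t -> 0 <= hump t.
Proof. by move=> t0; rewrite divr_ge0 ?mulr_ge0 ?exprn_ge0 ?addr_ge0. Qed.

Lemma hump1 : hump 1 = 1.
Proof. by rewrite /hump; field. Qed.

Lemma hump_le1 t : 0 <= t -> hump t <= 1.
Proof.
move=> t0; have t1 : 0 < 1 + t by rewrite ltr_pwDl.
rewrite ler_pdivrMr ?exprn_gt0// mul1r -subr_ge0.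
by rewrite (_ : _ - _ = (1 - t) ^+ 2) ?sqr_ge0//; ring.
Qed.

Lemma hump_lt1 t : 1 < t -> hump t < 1.
Proof.
move=> t1; have t0 : 0 < 1 + t by lra.
rewrite ltr_pdivrMr ?exprn_gt0// mul1r -subr_gt0.
by rewrite (_ : _ - _ = (t - 1) ^+ 2) ?exprn_gt0 ?subr_gt0//; ring.
Qed.

Lemma humpV t : 0 < t -> hump t^-1 = hump t.
Proof.
move=> t0; have t1 : 0 < 1 + t by rewrite addr_gt0.
by rewrite /hump; field; rewrite !gt_eqF// addrC.
Qed.

Lemma humpM a b : 1 <= a -> 1 <= b -> hump (a * b) <= hump a * hump b.
Proof.
move=> a1 b1; have a0 : 0 < a by lra. have b0 : 0 < b by lra.
have ab : 0 < 1 + a * b by rewrite addr_gt0// mulr_gt0.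
have h0 : 0 < ((1 + a) ^+ 2 * (1 + b) ^+ 2) by rewrite mulr_gt0// exprn_gt0//; lra.
rewrite /hump [leRHS](_ : _ = 4 * a * (4 * b) / ((1 + a) ^+ 2 * (1 + b) ^+ 2)); last first.
  by field; rewrite !gt_eqF//; lra.
rewrite ler_pdivlMr// mulrAC ler_pdivrMr ?exprn_gt0//.
have h : (1 + a) * (1 + b) <= 2 * (1 + a * b).
  rewrite -subr_ge0 (_ : _ - _ = (a - 1) * (b - 1)); last by ring.
  by rewrite mulr_ge0 ?subr_ge0.
have h2 : ((1 + a) * (1 + b)) ^+ 2 <= (2 * (1 + a * b)) ^+ 2.
  by rewrite lerXn2r// nnegrE; nra.
rewrite exprMn in h2.
rewrite (_ : 4 * a * (4 * b) * _ = 4 * (a * b) * (2 * (1 + a * b)) ^+ 2); last by ring.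
by rewrite ler_wpM2l// !mulr_ge0// ltW.
Qed.

Lemma hump_ni a b : 1 <= a -> a <= b -> hump b <= hump a.
Proof.
move=> a1 ab; have a0 : 0 < a by lra.
have ba : 1 <= b / a by rewrite ler_pdivlMr// mul1r.
have -> : b = a * (b / a) by rewrite mulrC divfK// gt_eqF.
rewrite (le_trans (humpM a1 ba))// ler_piMr ?hump_ge0 ?(ltW a0)// hump_le1//; lra.
Qed.

Lemma humpX t n : 1 <= t -> hump (t ^+ n) <= hump t ^+ n.
Proof.
move=> t1; elim: n => [|n IH]; first by rewrite !expr0 hump1.
rewrite !exprS (le_trans (humpM t1 _)) ?exprn_ege1//.
by rewrite ler_wpM2l// hump_ge0//; lra.
Qed.

Lemma hump_gap t n x : 1 <= t -> 0 < x -> t ^+ n <= x \/ t ^+ n <= x^-1 ->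
  hump x <= hump t ^+ n.
Proof.
move=> t1 x0 h; apply: le_trans (humpX n t1); case: h => h.
  by apply: hump_ni => //; rewrite exprn_ege1.
by rewrite -humpV//; apply: hump_ni => //; rewrite exprn_ege1.
Qed.

Definition ndist (n m : nat) : nat := ((n - m) + (m - n))%N.

Lemma sum_geometric_le (x : R) n : 0 <= x -> x < 1 -> \sum_(i < n) x ^+ i <= (1 - x)^-1.
Proof.
move=> x0 x1; have x1' : 0 < 1 - x by rewrite subr_gt0.
rewrite -[leRHS]mul1r ler_pdivlMr// mulrC.
have -> : (1 - x) * \sum_(i < n) x ^+ i = 1 - x ^+ n.
  by rewrite -[RHS]opprB subrX1 -mulNr opprB.
by rewrite gerBl exprn_ge0.
Qed.

Lemma sum_ndist (x : R) N : 0 <= x -> x < 1 ->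
  \sum_(n < N + N.+1) x ^+ ndist n N <= 1 + 2 * x / (1 - x).
Proof.
move=> x0 x1; have x1' : 0 < 1 - x by rewrite subr_gt0.
rewrite big_split_ord/=.
have -> : \sum_(i < N) x ^+ ndist i N = \sum_(i < N) x * x ^+ i.
  rewrite (reindex_inj rev_ord_inj)/=; apply: eq_bigr => i _.
  rewrite -exprS /ndist; congr (_ ^+ _).
  by have := ltn_ord i; lia.
have -> : \sum_(i < N.+1) x ^+ ndist (N + i) N = \sum_(i < N.+1) x ^+ i.
  by apply: eq_bigr => i _; rewrite /ndist; congr (_ ^+ _); lia.
rewrite -mulr_sumr big_ord_recl/= expr0.
have -> : \sum_(i < N) x ^+ bump 0 i = x * \sum_(i < N) x ^+ i.
  by rewrite mulr_sumr; apply: eq_bigr => i _; rewrite exprS.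
have := sum_geometric_le N x0 x1 => h.
have := ler_wpM2l x0 h; rewrite -mulrA; lra.
Qed.

Lemma weighted_cauchy_schwarz I (s : seq I) (p q : I -> R) : (forall i, 0 <= p i) ->
  (forall i, 0 <= q i) ->
  (\sum_(i <- s) q i * p i) ^+ 2 <=
  (\sum_(i <- s) p i) * (\sum_(i <- s) q i ^+ 2 * p i).
Proof.
move=> p0 q0; elim: s => [|i s IH]; first by rewrite !big_nil expr0n mul0r.
rewrite !big_cons.
set X := \sum_(j <- s) _ in IH *; set A := \sum_(j <- s) p j in IH *.
set B := \sum_(j <- s) _ in IH *.
have A0 : 0 <= A by apply: sumr_ge0.
have B0 : 0 <= B by apply: sumr_ge0 => j _; rewrite mulr_ge0// sqr_ge0.
have X0 : 0 <= X by apply: sumr_ge0 => j _; rewrite mulr_ge0.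
have h : 2 * X * q i <= A * q i ^+ 2 + B.
  rewrite -(@ler_pXn2r _ 2)// ?nnegrE ?mulr_ge0 ?addr_ge0 ?mulr_ge0 ?sqr_ge0//.
  apply: (@le_trans _ _ (4 * (A * B) * q i ^+ 2)).
    rewrite !exprMn ler_wpM2r ?sqr_ge0//; lra.
  rewrite -subr_ge0 (_ : _ - _ = (A * q i ^+ 2 - B) ^+ 2) ?sqr_ge0//; ring.
have := ler_wpM2r (p0 i) h.
rewrite (_ : (q i * p i + X) ^+ 2 = X ^+ 2 + 2 * X * q i * p i + q i ^+ 2 * p i ^+ 2); last by ring.
rewrite (_ : (p i + A) * _ = A * B + (A * q i ^+ 2 + B) * p i + q i ^+ 2 * p i ^+ 2); last by ring.
lra.
Qed.

Lemma sum_hump (x nu : R) n : 0 <= x -> 1 < nu ->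
  \sum_(i < n) x / nu ^+ i / (1 + x / nu ^+ i) ^+ 2 <= nu / (nu - 1).
Proof.
move=> x0 nu1; have nu0 : 0 < nu by lra.
pose X i := x / nu ^+ i; pose t i := X i / (1 + X i).
have X0 i : 0 <= X i by rewrite divr_ge0// exprn_ge0// ltW.
have step i : X i / (1 + X i) ^+ 2 <= nu / (nu - 1) * (t i - t i.+1).
  have XS : X i = nu * X i.+1 by rewrite /X exprS; field; rewrite !gt_eqF ?exprn_gt0.
  have y0 := X0 i.+1; rewrite /t XS; set y := X i.+1 in y0 *.
  have ny0 : 0 <= nu * y by rewrite mulr_ge0// ltW.
  have -> : nu / (nu - 1) * (nu * y / (1 + nu * y) - y / (1 + y)) =
      nu * y / ((1 + nu * y) * (1 + y)).
    by field; rewrite !gt_eqF//; lra.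
  rewrite ler_wpM2l// lef_pV2 ?posrE ?exprn_gt0 ?mulr_gt0//; try lra.
  by rewrite expr2 ler_wpM2l//; nra.
apply: (@le_trans _ _ (\sum_(i < n) nu / (nu - 1) * (t i - t i.+1))).
  by apply: ler_sum => i _; exact: step.
have nn : 0 < nu - 1 by lra.
rewrite -mulr_sumr -[leRHS]mulr1; apply: ler_wpM2l; first by rewrite divr_ge0 ?ltW.
have -> : \sum_(i < n) (t i - t i.+1) = t 0%N - t n.
  elim: n => [|n IH]; first by rewrite big_ord0 subrr.
  by rewrite big_ord_recr/= IH; ring.
have t0 i : 0 <= t i by rewrite divr_ge0 ?addr_ge0.
have t1 : t 0%N <= 1.
  by rewrite /t ler_pdivrMr ?mul1r ?lerDr ?ltr_pwDl.
by have := t0 n; lra.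
Qed.

End hump.

Section peaks.
Context {R : realType}.
Notation C := (cplx R).

Lemma normc_imag (x : R) : normc (0 +i* x) = `|x|.
Proof. by rewrite /= expr0n/= add0r sqrtr_sqr. Qed.

Lemma derivable_exprn (f : C -> C) n (z : C) : derivable f z 1 ->
  derivable (fun w => f w ^+ n : C) z 1.
Proof.
move=> df; elim: n => [|n IH]; first exact: (derivable_cst (1 : C) z 1).
have h := derivableM df IH.
by rewrite (_ : (fun w => _) = (f * (fun w => f w ^+ n : C))%R)//; apply/funext => w; rewrite exprS.
Qed.

Lemma derivable_linear (a b z : C) : derivable (fun w : C => a * w + b : C) z 1.
Proof.
exact: (derivableD (derivableM (derivable_cst a z 1) (@derivable_id _ _ z 1))
  (derivable_cst b z 1)).
Qed.

Variables (wst : C) (c : R).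
Hypothesis c0 : 0 < c.

Definition peak_arg (s : R) (w : C) : C := (0 +i* (- (s / c))) * (w - wst).

(* At wst + iy this is [hump (s * y / c) ^+ k]: the peak is at height c / s, and
   the dilation with centre wst and ratio mu carries it to the one of parameter
   mu s. *)
Definition peakf (k : nat) (s : R) (w : C) : C :=
  (4 * peak_arg s w / (1 + peak_arg s w) ^+ 2) ^+ k.

Definition peak_rad (s : R) (w : C) : R := s / c * normc (w - wst).

Lemma normc_peak_arg s w : 0 <= s ->
  normc (peak_arg s w) = peak_rad s w.
Proof.
by move=> s0; rewrite normcM normc_imag normrN ger0_norm// divr_ge0// ltW.
Qed.

Lemma Re_peak_arg s (w : C) :
  complex.Re (peak_arg s w) = s / c * (complex.Im w - complex.Im wst).
Proof. by rewrite /peak_arg; case: w wst => x y [a b] /=; ring. Qed.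

(* Keeps the real part of [peak_arg s w] above -1/2 on the half-plane, hence
   [peakf] holomorphic there. *)
Definition peak_ok (s : R) := 0 < s /\ s * complex.Im wst <= c / 2.

Lemma peak_arg_Re_ge s (w : C) : peak_ok s -> 0 < complex.Im w ->
  - 2^-1 <= complex.Re (peak_arg s w).
Proof.
move=> [s0 sc] iw; rewrite Re_peak_arg.
have h : s * complex.Im wst / c <= 2^-1 by rewrite ler_pdivrMr//; lra.
have h2 : 0 <= s / c * complex.Im w by rewrite mulr_ge0 ?divr_ge0 ?ltW.
rewrite mulrBr (_ : s / c * complex.Im wst = s * complex.Im wst / c); last by ring.
lra.
Qed.

Lemma peak_arg_bound s (w : C) : peak_ok s -> 0 < complex.Im w ->
  1 + normc (peak_arg s w) <= 5 * normc (1 + peak_arg s w).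
Proof.
move=> sc iw; have := peak_arg_Re_ge sc iw; set u := peak_arg s w => hu.
have h1 : 2^-1 <= normc (1 + u).
  have := normr_Re_le (1 + u); rewrite (_ : complex.Re (1 + u) = 1 + complex.Re u).
    by rewrite ger0_norm; lra.
  by case: (u) => a b.
have h2 : normc u <= normc (1 + u) + 1.
  have := normcD (1 + u) (- 1); rewrite normcN normc1.
  by rewrite (_ : 1 + u - 1 = u :> C)// addrC addKr.
lra.
Qed.

Lemma peak_arg_neq s (w : C) : peak_ok s -> 0 < complex.Im w ->
  1 + peak_arg s w != 0.
Proof.
move=> sc iw; rewrite -normc_gt0.
by have := peak_arg_bound sc iw; have := normc_ge0 (peak_arg s w); lra.
Qed.

Lemma normc4 : normc (4 : C) = 4.
Proof.
have -> : (4 : C) = (4 : R)%:C by rewrite rmorph_nat.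
by rewrite normc_normr normr_nat.
Qed.

Lemma peakf_le k s (w : C) : peak_ok s -> 0 < complex.Im w ->
  normc (peakf k s w) <= (100 * (peak_rad s w / (1 + peak_rad s w) ^+ 2)) ^+ k.
Proof.
move=> sc iw; set x := peak_rad s w; rewrite normcX.
have x0 : 0 <= x by rewrite mulr_ge0 ?normc_ge0// divr_ge0 ?ltW ?sc.1.
have nx : normc (peak_arg s w) = x by rewrite normc_peak_arg// ltW// sc.1.
have x1 : 0 < 1 + x by rewrite ltr_pwDl.
rewrite lerXn2r// ?nnegrE ?normc_ge0//.
  by apply: mulr_ge0 => //; apply: divr_ge0 => //; apply: exprn_ge0; exact: ltW.
have := peak_arg_bound sc iw; rewrite nx; move: (peak_arg s w) nx => u nx h.
rewrite !normcM normc4 normcV normcX nx.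
have n0 : 0 < normc (1 + u) by lra.
rewrite ler_pdivrMr ?exprn_gt0// -[4 * x]mulr1 (_ : 100 * _ * _ = 4 * x *
  (25 * normc (1 + u) ^+ 2 / (1 + x) ^+ 2)); last by ring.
apply: ler_wpM2l; first exact: mulr_ge0.
rewrite ler_pdivlMr ?exprn_gt0// mul1r.
rewrite (_ : 25 * _ = (5 * normc (1 + u)) ^+ 2); last by ring.
by rewrite lerXn2r// nnegrE; lra.
Qed.

Lemma peakf_decay k s (w : C) : peak_ok s -> 0 < complex.Im w ->
  normc (peakf k s w) <= 100 ^+ k * (1 + peak_rad s w) ^- k.
Proof.
move=> sc iw; rewrite (le_trans (peakf_le k sc iw))//.
set x := peak_rad s w; have x0 : 0 <= x by rewrite mulr_ge0 ?normc_ge0// divr_ge0 ?ltW ?sc.1.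
have x1 : 0 < 1 + x by rewrite ltr_pwDl.
rewrite exprMn; apply: ler_wpM2l; first exact: exprn_ge0.
rewrite -[leRHS]exprVn lerXn2r ?nnegrE ?divr_ge0 ?invr_ge0 ?exprn_ge0 ?(ltW x1)//.
by rewrite ler_pdivrMr ?exprn_gt0// expr2 mulKf ?gt_eqF// lerDr.
Qed.

Lemma peakf_axis k s y : 0 < s -> 0 < y ->
  normc (peakf k s (wst + (0 +i* y))) = hump (s * y / c) ^+ k.
Proof.
move=> s0 y0; have t0 : 0 <= s * y / c by rewrite divr_ge0 ?mulr_ge0 ?ltW.
have uE : peak_arg s (wst + (0 +i* y)) = (s * y / c)%:C.
  rewrite /peak_arg [wst + _]addrC addrK; apply/eqP; rewrite eq_complex/=.
  by apply/andP; split; apply/eqP; ring.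
rewrite normcX; congr (_ ^+ k); rewrite uE.
have aux (t : R) : 4 * t%:C / (1 + t%:C) ^+ 2 = (hump t)%:C :> R[i].
  have e4 : 4 = (4 : R)%:C :> R[i] by rewrite rmorph_nat.
  by rewrite e4 /hump fmorph_div rmorphM rmorphXn (rmorphD _ 1 t) rmorph1.
rewrite [X in normc X](aux (s * y / c)).
by rewrite normc_normr ger0_norm// hump_ge0.
Qed.

Lemma peakf_comp k s (mu : R) (w0 w : C) : mu%:C * wst + w0 = wst ->
  peakf k s (mu%:C * w + w0) = peakf k (mu * s) w.
Proof.
move=> hw; rewrite /peakf; congr ((4 * _ / (1 + _) ^+ 2) ^+ k);
  rewrite /peak_arg -{1}hw; case: w w0 wst hw => x y [a b] [d e] _;
  by apply/eqP; rewrite eq_complex/=; apply/andP; split; apply/eqP; ring.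
Qed.

Lemma analytic_peakf k s : peak_ok s -> analytic_on (@upper_half_plane R) (peakf k s).
Proof.
move=> sc w iw; apply: derivable_exprn.
pose a : C := 0 +i* (- (s / c)).
have d1 : derivable (fun w : C => 1 + peak_arg s w : C) w 1.
  have h := @derivable_linear a (1 - a * wst) w.
  rewrite (_ : (fun w => _) = (fun w : C => a * w + (1 - a * wst) : C))//.
  by apply/funext => z; rewrite /peak_arg -/a mulrBr addrCA.
have d2 : derivable (fun w : C => 4 * peak_arg s w : C) w 1.
  have h := @derivable_linear (4 * a) (- (4 * a * wst)) w.
  rewrite (_ : (fun w => _) = (fun w : C => 4 * a * w + (- (4 * a * wst)) : C))//.
  by apply/funext => z; rewrite /peak_arg -/a mulrA mulrBr.
have n0 : (1 + peak_arg s w) ^+ 2 != 0 by rewrite expf_neq0// peak_arg_neq.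
have h1 := @derivable_exprn (fun w : C => 1 + peak_arg s w : C) 2 w d1.
have h2 := @derivableV _ _ (fun w : C => (1 + peak_arg s w) ^+ 2 : C) w 1 n0 h1.
have h3 := derivableM d2 h2.
by refine h3.
Qed.

End peaks.

Section peak_norms.
Context {R : realType} (alpha : R).
Hypothesis alpha_ge : -1 <= alpha.
Notation C := (cplx R).
Notation V := (A2_space alpha).

Lemma decay_ge m (x y : R) : (1 + normc (x +i* y)) ^- (m + 2) <= decay m (x, y).
Proof.
rewrite /decay/=; set n := normc (x +i* y).
have xn : `|x| <= n by have := normr_Re_le (x +i* y).
have yn : `|y| <= n by have := normr_Im_le (x +i* y).
have n0 : 0 <= n by exact: normc_ge0.
have x1 : 0 < 1 + x ^+ 2 by rewrite ltr_wpDr ?sqr_ge0.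
have y1 : 0 < 1 + `|y| by rewrite ltr_pwDl.
have n1 : 0 < 1 + n by rewrite ltr_pwDl.
rewrite -invfM lef_pV2 ?posrE ?exprn_gt0 ?mulr_gt0 ?exprn_gt0//.
rewrite exprD mulrC; apply: ler_pM; rewrite ?exprn_ge0 ?(ltW x1) ?(ltW y1)//.
  by rewrite lerXn2r ?nnegrE ?(ltW y1) ?(ltW n1)// lerD2l.
have xx : `|x| ^+ 2 <= n ^+ 2 by rewrite lerXn2r ?nnegrE.
rewrite real_normK ?num_real// in xx.
by rewrite (_ : (1 + n) ^+ 2 = 1 + n ^+ 2 + 2 * n); [lra|ring].
Qed.

Lemma energy_decay : exists m : nat, forall (wst : C) (c S : R), 0 < c -> 0 <= S ->
  exists2 D : R, 0 < D & forall (phi : R * R -> R) (A s : R) k, (m <= k)%N -> nnp phi ->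
    0 <= A -> 0 < s -> s <= S ->
    (forall x y, 0 < y -> phi (x, y) <= A * (1 + peak_rad wst c s (x +i* y)) ^- k) ->
    (energy alpha phi <= (A * D * s `^ (- (alpha + 2)))%:E)%E.
Proof.
have [m [nd Ed]] := decay_fin alpha_ge.
exists (m + 2)%N => wst c S c0 S0.
have E0 : (0 <= energy alpha (decay m))%E by exact: energy_ge0.
pose e := fine (energy alpha (decay m)).
have e0 : 0 <= e by exact: fine_ge0.
have eE : energy alpha (decay m) = e%:E by rewrite fineK// ge0_fin_numE.
pose B := 1 + c + S * normc wst.
have B1 : 1 <= B.
  by rewrite /B -addrA lerDl addr_ge0 ?(ltW c0)// mulr_ge0 ?normc_ge0.
have B0 : 0 < B by rewrite (lt_le_trans _ B1).
pose D := B ^+ (m + 2) * (e + 1).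
exists D; first by rewrite mulr_gt0 ?exprn_gt0// ltr_wpDl.
move=> phi A s k mk np A0 s0 sS Hphi.
pose psi (p : R * R) : R := A * B ^+ (m + 2) * decay m (s * p.1 + 0, s * p.2).
have AB0 : 0 <= A * B ^+ (m + 2) by rewrite mulr_ge0// exprn_ge0// ltW.
have nds : nnp (fun p : R * R => decay m (s * p.1 + 0, s * p.2)).
  have := nnp_affine s 0 s 0 nd.
  by under [X in nnp X]eq_fun do rewrite [X in decay m (_, X)]addr0.
have npsi : nnp psi by exact: nnpZ.
apply: (@le_trans _ _ (energy alpha psi)).
  apply: le_energy => // x y y0; rewrite (le_trans (Hphi x y y0))// /psi/= addr0.
  rewrite -mulrA ler_wpM2l//.
  set r := peak_rad wst c s (x +i* y).
  have r0 : 0 <= r by rewrite mulr_ge0 ?normc_ge0// divr_ge0 ?ltW.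
  have r1 : 0 < 1 + r by rewrite ltr_pwDl.
  apply: (@le_trans _ _ ((1 + r) ^- (m + 2))).
    by rewrite lef_pV2 ?posrE ?exprn_gt0// ler_weXn2l// lerDl.
  have sw : normc ((s * x) +i* (s * y)) <= c * r + S * normc wst.
    have -> : (s * x) +i* (s * y) = s%:C * (x +i* y) :> C.
      by apply/eqP; rewrite eq_complex/=; apply/andP; split; apply/eqP; ring.
    rewrite normcM normc_normr ger0_norm ?(ltW s0)//.
    have -> : c * r = s * normc (x +i* y - wst) by rewrite /r /peak_rad; field; rewrite gt_eqF.
    have h := normcD (x +i* y - wst) wst; rewrite subrK in h.
    rewrite (le_trans (ler_wpM2l (ltW s0) h))// mulrDr lerD2l.
    by rewrite ler_wpM2r ?normc_ge0.
  have n0 := normc_ge0 ((s * x) +i* (s * y) : C).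
  have n1 : 0 < 1 + normc ((s * x) +i* (s * y)) by rewrite ltr_pwDl.
  apply: (@le_trans _ _ (B ^+ (m + 2) * (1 + normc ((s * x) +i* (s * y))) ^- (m + 2))).
    rewrite ler_pdivlMr ?exprn_gt0// mulrC ler_pdivrMr ?exprn_gt0// -exprMn.
    rewrite lerXn2r ?nnegrE ?(ltW n1)//; first by rewrite mulr_ge0 ?ltW.
    have Sw : 0 <= S * normc wst by rewrite mulr_ge0 ?normc_ge0.
    have : c * r + S * normc wst + 1 <= B * (1 + r); last by lra.
    rewrite /B; have : 0 <= r * (S * normc wst) by rewrite mulr_ge0.
    by nra.
  by rewrite ler_wpM2l ?exprn_ge0 ?(ltW B0)//; exact: decay_ge.
apply: (le_trans (energyZ alpha AB0 nds)).
have ABe : (0 <= (A * B ^+ (m + 2))%:E)%E by rewrite lee_fin.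
apply: (le_trans (lee_wpmul2l ABe (energy_scale alpha 0 s0 nd))).
rewrite eE -!EFinM lee_fin /D.
have sp : 0 <= s `^ (- (alpha + 2)) by rewrite powR_ge0.
rewrite (_ : A * (B ^+ (m + 2) * (e + 1)) * _ = A * B ^+ (m + 2) * (s `^ (- (alpha + 2)) * (e + 1))); last by ring.
by rewrite ler_wpM2l// ler_wpM2l// lerDl.
Qed.

Lemma nnp_mag (F : V) : nnp (fun p : R * R => normc (F (p.1 +i* p.2))).
Proof.
by split; [exact: (measurable_mag (A2_admissible F))|move=> p; exact: normc_ge0].
Qed.

Lemma nrm_le_sqrt (F : V) (B : R) : 0 <= B -> (energy alpha (sqmag F) <= B%:E)%E ->
  nrm F <= Num.sqrt B.
Proof. by move=> B0 h; apply: nrm_le; rewrite ?sqrtr_ge0// sqr_sqrtr. Qed.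

Lemma sqrt_powR (s : R) : Num.sqrt (s `^ (- (alpha + 2))) = s `^ (- ((alpha + 2) / 2)).
Proof.
rewrite (_ : - (alpha + 2) = - ((alpha + 2) / 2) * 2); last by field.
by rewrite powRrM powR_mulrn ?powR_ge0// sqrtr_sqr ger0_norm// powR_ge0.
Qed.

Lemma peak_family : exists m : nat, forall k, (m <= k)%N -> forall (wst : C) (c : R), 0 < c ->
  exists P : R -> V, [/\
    forall s, peak_ok wst c s -> forall w : C, 0 < complex.Im w -> P s w = peakf wst c k s w,
    forall S, 0 <= S -> exists2 D, 0 < D & forall s, peak_ok wst c s -> s <= S ->
      nrm (P s) <= D * s `^ (- ((alpha + 2) / 2)),
    forall S, 0 <= S -> exists2 D, 0 < D & forall s, peak_ok wst c s -> s <= S ->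
      (energy alpha (fun p => normc (P s (p.1 +i* p.2))) <= (D * s `^ (- (alpha + 2)))%:E)%E
  & complex.Im wst < 0 -> exists2 D, 0 < D & forall s, 0 < s -> nrm (P s) <= D * s ^- k].
Proof.
have [m Hm] := energy_decay; exists m => k mk wst c c0.
have m2k : (m <= k * 2)%N by rewrite (leq_trans mk)// leq_pmulr.
have sqm (F : C -> C) s : peak_ok wst c s ->
    (forall w : C, 0 < complex.Im w -> F w = peakf wst c k s w) ->
    forall x y, 0 < y -> sqmag F (x, y) <=
      (100 ^+ k) ^+ 2 * (1 + peak_rad wst c s (x +i* y)) ^- (k * 2).
  move=> sc HF x y y0; rewrite /sqmag/= HF//.
  have h := @peakf_decay R wst c c0 k s (x +i* y) sc y0.
  rewrite exprM -exprVn -exprMn lerXn2r ?nnegrE ?normc_ge0//.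
  exact: le_trans (normc_ge0 _) h.
have A0 : 0 <= (100 ^+ k) ^+ 2 :> R by rewrite !exprn_ge0.
have /choice[P HP] : forall s, exists F : V, peak_ok wst c s ->
    forall w : C, 0 < complex.Im w -> F w = peakf wst c k s w.
  move=> s; have [sc|nsc] := pselect (peak_ok wst c s); last by exists 0.
  have aG := admissible_ext0 (@analytic_peakf R wst c c0 k s sc).
  have [D D0 HD] := Hm wst c s c0 (ltW sc.1).
  have HG w : 0 < complex.Im w -> ext0 (peakf wst c k s) w = peakf wst c k s w.
    by move=> iw; rewrite ext0E.
  have h := HD _ _ s (k * 2)%N m2k (nnp_sqmag aG) A0 sc.1 (lexx s) (sqm _ _ sc HG).
  have [F HF] := A2_ex aG (le_lt_trans h (ltry _)).
  by exists F => _ w iw; rewrite HF HG.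
exists P; split => //.
- move=> S S0; have [D D0 HD] := Hm wst c S c0 S0.
  exists (Num.sqrt ((100 ^+ k) ^+ 2 * D)); first by rewrite sqrtr_gt0 mulr_gt0 ?exprn_gt0.
  move=> s sc sS; have h := HD _ _ s (k * 2)%N m2k (nnpF (P s)) A0 sc.1 sS (sqm _ _ sc (HP s sc)).
  have AD : 0 <= (100 ^+ k) ^+ 2 * D by rewrite mulr_ge0// ltW.
  have ADs : 0 <= (100 ^+ k) ^+ 2 * D * s `^ (- (alpha + 2)) by rewrite mulr_ge0 ?powR_ge0.
  by rewrite (le_trans (nrm_le_sqrt ADs h))// sqrtrM// sqrt_powR.
- move=> S S0; have [D D0 HD] := Hm wst c S c0 S0.
  exists (100 ^+ k * D) => [|s sc sS]; first by rewrite mulr_gt0 ?exprn_gt0.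
  apply: (HD _ _ s k mk (nnp_mag (P s)) _ sc.1 sS); first by rewrite exprn_ge0.
  by move=> x y y0 /=; rewrite HP//; exact: peakf_decay.
move=> wst0; set h := - complex.Im wst; have h0 : 0 < h by rewrite oppr_gt0.
have [D D0 HD] := Hm wst 1 1 ltr01 ler01.
pose B := 100 * c * (1 + h^-1).
have B0 : 0 < B by rewrite !mulr_gt0// addr_gt0 ?invr_gt0.
exists (B ^+ k * Num.sqrt D) => [|s s0]; first by rewrite mulr_gt0 ?exprn_gt0 ?sqrtr_gt0.
have sc : peak_ok wst c s.
  split => //; apply: (@le_trans _ _ 0); last by rewrite divr_ge0 ?ltW.
  by rewrite mulr_ge0_le0 ?ltW.
have Bs0 : 0 <= B / s by rewrite divr_ge0 ?ltW.
have Bsk : 0 <= ((B / s) ^+ k) ^+ 2 by rewrite !exprn_ge0.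
have := HD _ _ 1 (k * 2)%N m2k (nnpF (P s)) Bsk ltr01 (lexx 1).
rewrite powR1 mulr1 => H.
have {}H : (energy alpha (sqmag (P s)) <= (((B / s) ^+ k) ^+ 2 * D)%:E)%E.
  apply: H => x y y0; rewrite /sqmag/= HP//.
  have hp := @peakf_le R wst c c0 k s (x +i* y) sc y0.
  rewrite exprM -[X in _ <= _ * X]exprVn -exprMn lerXn2r ?nnegrE ?normc_ge0//.
    by rewrite mulr_ge0 ?exprn_ge0// invr_ge0 exprn_ge0// addr_ge0// mulr_ge0 ?normc_ge0// divr1.
  rewrite (le_trans hp)// -[X in _ <= _ * X]exprVn -exprMn.
  set z := normc (x +i* y - wst).
  have hz : h <= z.
    have := normr_Im_le (x +i* y - wst); rewrite -/z; apply: le_trans.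
    rewrite (_ : complex.Im _ = y + h); last by rewrite /h; case: (wst).
    by rewrite ger0_norm; lra.
  have z0 : 0 < z by rewrite (lt_le_trans h0).
  rewrite /peak_rad -/z divr1 mul1r.
  have x0 : 0 < s / c * z by rewrite mulr_gt0// divr_gt0.
  have x1 : 0 < 1 + s / c * z by rewrite addr_gt0.
  rewrite lerXn2r ?nnegrE//.
    by rewrite mulr_ge0// divr_ge0 ?exprn_ge0 ?ltW.
    by rewrite mulr_ge0// invr_ge0 addr_ge0// ltW.
  apply: (@le_trans _ _ (100 * (s / c * z)^-1)).
    apply: ler_wpM2l => //; move: x0 x1; set q := s / c * z => x0 x1.
    rewrite ler_pdivrMr ?exprn_gt0// ler_pdivlMl//.
    by rewrite -expr2 lerXn2r ?nnegrE ?(ltW x0) ?(ltW x1)// lerDr.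
  rewrite ler_pdivlMr ?addr_gt0//.
  rewrite (_ : B / s = 100 * (s / c * z)^-1 * (z * (1 + h^-1))); last first.
    by rewrite /B; field; rewrite !gt_eqF.
  rewrite ler_wpM2l ?mulr_ge0 ?invr_ge0 ?(ltW x0)//.
  rewrite mulrDr mulr1 addrC lerD2l ler_pdivlMr// mul1r//.
have BD : 0 <= ((B / s) ^+ k) ^+ 2 * D by rewrite mulr_ge0// ltW.
rewrite (le_trans (nrm_le_sqrt BD H))// sqrtrM// sqrtr_sqr ger0_norm ?exprn_ge0//.
by rewrite exprMn exprVn mulrAC.
Qed.

End peak_norms.

Lemma ndist_le n N : (n <= N)%N -> ndist n N = (N - n)%N.
Proof. rewrite /ndist; lia. Qed.

Lemma ndist_ge n N : (N <= n)%N -> ndist n N = (n - N)%N.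
Proof. rewrite /ndist; lia. Qed.

Definition tent (N n : nat) : nat := minn n (N + N - n).

Lemma tent_le N n : (tent N n <= N)%N.
Proof. rewrite /tent; lia. Qed.

Lemma tent_mid N : tent N N = N.
Proof. rewrite /tent; lia. Qed.

(** * The circle of radius mu^{-(alpha+2)/2} *)

Section circle.
Context {R : realType} (alpha : R).
Hypothesis alpha_ge : -1 <= alpha.
Notation C := (cplx R).
Notation V := (A2_space alpha).

Lemma exp_small_ge (q e : R) : 0 <= q -> q < 1 -> 0 < e ->
  exists n, forall k, (n <= k)%N -> q ^+ k <= e.
Proof.
move=> q0 q1 e0; have [n Hn] := exp_small q0 q1 e0; exists n => k nk.
by apply: le_trans Hn; apply: ler_wiXn2l => //; exact: ltW.
Qed.

Variables (nu : R) (wst : C) (c : R) (k : nat) (q : nat -> V) (D : R).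
Hypotheses (nu1 : 1 < nu) (c0 : 0 < c) (cw : `|complex.Im wst| <= c / 2).
Hypothesis k2 : (2 <= k)%N.
Hypothesis qE : forall n (w : C), 0 < complex.Im w -> q n w = peakf wst c k (nu ^- n) w.
Hypothesis qD : forall n, (energy alpha (fun p => normc (q n (p.1 +i* p.2))) <=
  (D * (nu ^- n) `^ (- (alpha + 2)))%:E)%E.
Hypothesis D0 : 0 < D.
Let s := (alpha + 2) / 2.
Hypothesis hk : nu `^ s * hump nu ^+ k <= 5^-1.
Variable kap : C.
Hypothesis nkap : normc kap = nu `^ (- s).

Let nu0 : 0 < nu. Proof. by rewrite (lt_trans ltr01). Qed.
Let nn0 n : 0 < nu ^+ n. Proof. exact: exprn_gt0. Qed.
Let s0 : 0 <= s. Proof. by have h := alpha_ge; rewrite divr_ge0//; lra. Qed.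
Let kap0 : 0 < normc kap. Proof. by rewrite nkap powR_gt0. Qed.

Let kap1 : normc kap <= 1.
Proof.
by rewrite nkap powRN invf_le1 ?powR_gt0// -[leLHS](powRr0 nu) ler_powR// ltW.
Qed.

Let ok n : peak_ok wst c (nu ^- n).
Proof.
split; first by rewrite invr_gt0.
have h : nu ^- n <= 1 by rewrite invf_le1// exprn_ege1// ltW.
have h0 : 0 <= nu ^- n by rewrite invr_ge0 ltW.
have := cw; rewrite ler_norml => /andP[_ hw].
by rewrite (le_trans (ler_wpM2l h0 hw))// ler_piMl// divr_ge0// ltW.
Qed.

Lemma sum_peaks_le M (w : C) : 0 < complex.Im w ->
  \sum_(n < M) normc (q n w) <= 100 ^+ k * (nu / (nu - 1)).
Proof.
move=> iw; pose x := normc (w - wst) / c.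
have x0 : 0 <= x by rewrite divr_ge0 ?normc_ge0 ?ltW.
have xn n : peak_rad wst c (nu ^- n) w = x / nu ^+ n.
  by rewrite /peak_rad /x; ring.
apply: (@le_trans _ _ (\sum_(n < M) 100 ^+ k * (x / nu ^+ n / (1 + x / nu ^+ n) ^+ 2))).
  apply: ler_sum => n _; rewrite qE// (le_trans (peakf_le c0 k (ok n) iw))// xn.
  set y := x / nu ^+ n; have y0 : 0 <= y by apply: divr_ge0 => //; exact: ltW.
  have y1 : 0 < 1 + y by rewrite ltr_pwDl.
  rewrite exprMn; apply: ler_wpM2l; first exact: exprn_ge0.
  set h := y / _; have h0 : 0 <= h by rewrite divr_ge0// exprn_ge0// ltW.
  have h1 : h <= 1 by rewrite ler_pdivrMr ?exprn_gt0// mul1r; nra.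
  by case: (k) k2 => // j _; rewrite exprS ler_piMr// exprn_ile1.
rewrite -mulr_sumr; apply: ler_wpM2l; first exact: exprn_ge0.
exact: sum_hump.
Qed.

Lemma energy_peaks n :
  (((normc kap ^+ n) ^+ 2)%:E * energy alpha (fun p => normc (q n (p.1 +i* p.2)))%R <= D%:E)%E.
Proof.
have k0 : (0 <= ((normc kap ^+ n) ^+ 2)%:E)%E by rewrite lee_fin sqr_ge0.
rewrite (le_trans (lee_wpmul2l k0 (qD n)))// -EFinM lee_fin nkap.
rewrite -!exprM -[_ ^+ (n * 2)]powR_mulrn ?powR_ge0// -powRrM.
rewrite -[nu ^- n]powR_inv1 ?(ltW (nn0 n))// -powRrM -[nu ^+ n]powR_mulrn ?(ltW nu0)// -powRrM.
rewrite mulrCA -powRD; last by rewrite (gt_eqF nu0) implybT.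
rewrite (_ : - s * _ + _ = 0); last by rewrite /s natrM; field.
by rewrite powRr0 mulr1.
Qed.

Definition peak_sum (b : nat -> R) M : V := \sum_(n < M) ((b n)%:C * kap ^+ n) *: q n.

Lemma peak_sumE b M w : peak_sum b M w = \sum_(n < M) (b n)%:C * kap ^+ n * q n w.
Proof. by rewrite /peak_sum A2_sum; apply: eq_bigr => n _; rewrite A2Z. Qed.

Lemma normc_peak_term b n w :
  normc ((b n)%:C * kap ^+ n * q n w) = `|b n| * normc kap ^+ n * normc (q n w).
Proof. by rewrite !normcM normc_normr normcX. Qed.

Lemma peak_sum_bound : exists2 B : R, 0 <= B & forall b M, (forall n, `|b n| <= 1) ->
  nrm (peak_sum b M) <= B * Num.sqrt M%:R.
Proof.
pose S := 100 ^+ k * (nu / (nu - 1)).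
have S0 : 0 <= S by rewrite mulr_ge0 ?exprn_ge0// divr_ge0 ?ltW// subr_gt0.
exists (Num.sqrt (S * D)) => [|b M b1]; first exact: sqrtr_ge0.
have SD : 0 <= S * D by rewrite mulr_ge0// ltW.
rewrite -sqrtrM//; apply: nrm_le_sqrt; first by rewrite mulr_ge0.
pose phi (n : 'I_M) (p : R * R) := (normc kap ^+ n) ^+ 2 * normc (q n (p.1 +i* p.2)).
have nphi n : nnp (phi n) by apply: nnpZ; [exact: sqr_ge0|exact: nnp_mag].
have nsum := nnp_sum (index_enum 'I_M) nphi.
apply: (@le_trans _ _ (energy alpha (fun p => S * \sum_n phi n p))).
  apply: le_energy; [exact: nnpF|exact: nnpZ|] => x y y0 /=.
  set w : C := x +i* y; rewrite /sqmag/= peak_sumE.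
  apply: (@le_trans _ _ ((\sum_(n < M) normc kap ^+ n * normc (q n w)) ^+ 2)).
    have h : normc (\sum_(n < M) (b n)%:C * kap ^+ n * q n w) <=
        \sum_(n < M) normc kap ^+ n * normc (q n w).
      rewrite (le_trans (normc_sum _ _ _))//; apply: ler_sum => n _.
      rewrite normc_peak_term ler_wpM2r ?normc_ge0// ler_piMl// exprn_ge0//.
      exact: normc_ge0.
    by rewrite lerXn2r// nnegrE ?normc_ge0// (le_trans (normc_ge0 _) h).
  apply: (le_trans (weighted_cauchy_schwarz _ _ _)).
  - by move=> n; exact: normc_ge0.
  - by move=> n; rewrite exprn_ge0// normc_ge0.
  apply: ler_wpM2r; last exact: sum_peaks_le.
  by apply: sumr_ge0 => n _; rewrite mulr_ge0 ?sqr_ge0 ?normc_ge0.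
apply: (le_trans (energyZ alpha S0 nsum)).
have S0' : (0 <= S%:E)%E by rewrite lee_fin.
apply: (le_trans (lee_wpmul2l S0' (energy_sum alpha _ nphi))).
apply: (@le_trans _ _ (S%:E * (D * M%:R)%:E)%E); last by rewrite -EFinM mulrA.
apply: lee_wpmul2l => //.
apply: (@le_trans _ _ (\sum_(n < M) D%:E)%E).
  apply: lee_sum => n _; apply: le_trans (energy_peaks n).
  by apply: energyZ; [exact: sqr_ge0|exact: nnp_mag].
by rewrite sumEFin lee_fin sumr_const card_ord mulr_natr.
Qed.

Lemma peak_sum_tent_pointwise (w : C) : 0 < complex.Im w -> exists B : R, forall N,
  normc (peak_sum (fun n => (tent N n)%:R) (N + N.+1) w) <= B.
Proof.
move=> iw; pose x := normc (w - wst) / c.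
have x0 : 0 <= x by rewrite divr_ge0 ?normc_ge0 ?ltW.
have n1 : 0 < nu - 1 by rewrite subr_gt0.
have nui : nu^-1 < 1 by rewrite invf_lt1.
have nui0 : 0 <= nu^-1 by rewrite invr_ge0 ltW.
have x100 : 0 <= (100 * x) ^+ k by apply: exprn_ge0; apply: mulr_ge0.
have x101 : 0 <= (100 * x) ^+ k / (nu - 1) by apply: divr_ge0 => //; exact: ltW.
exists ((100 * x) ^+ k / (nu - 1) / (1 - nu^-1)) => N.
rewrite peak_sumE (le_trans (normc_sum _ _ _))//.
have term n : normc ((tent N n)%:R%:C * kap ^+ n * q n w) <=
    (100 * x) ^+ k / (nu - 1) * nu^-1 ^+ n.
  rewrite (normc_peak_term (fun n => (tent N n)%:R)) normr_nat.
  have h1 : (tent N n)%:R * normc kap ^+ n <= n%:R.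
    rewrite -[leRHS]mulr1; apply: ler_pM => //.
    - by rewrite exprn_ge0// normc_ge0.
    - by rewrite ler_nat geq_minl.
    - by rewrite exprn_ile1// normc_ge0.
  rewrite (le_trans (ler_wpM2r (normc_ge0 _) h1))// qE//.
  have xn : peak_rad wst c (nu ^- n) w = x / nu ^+ n by rewrite /peak_rad /x; ring.
  have h2 : normc (peakf wst c k (nu ^- n) w) <= (100 * x) ^+ k * (nu ^- n) ^+ 2.
    rewrite (le_trans (peakf_le c0 k (ok n) iw))// xn.
    set y := x / nu ^+ n; have y0 : 0 <= y by apply: divr_ge0 => //; exact: ltW.
    have y1 : 1 <= 1 + y by rewrite lerDl.
    apply: (@le_trans _ _ ((100 * y) ^+ k)).
      have hy : y / (1 + y) ^+ 2 <= y.
        by rewrite ler_pdivrMr ?exprn_gt0 ?(lt_le_trans ltr01)// ler_peMr// exprn_ege1.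
      rewrite lerXn2r ?nnegrE//; first by rewrite mulr_ge0// divr_ge0// exprn_ge0// addr_ge0.
        by rewrite mulr_ge0.
      by rewrite ler_wpM2l.
    rewrite /y mulrA exprMn; apply: ler_wpM2l; first exact: x100.
    by apply: ler_wiXn2l => //; rewrite ?invr_ge0 ?(ltW (nn0 n))// invf_le1// exprn_ege1// ltW.
  rewrite (le_trans (ler_wpM2l (ler0n _ _) h2))// mulrCA -mulrA; apply: ler_wpM2l; first exact: x100.
  rewrite expr2 mulrA exprVn ler_wpM2r ?invr_ge0 ?(ltW (nn0 n))//.
  rewrite ler_pdivrMr// ler_pdivlMl//.
  have : 1 + n%:R * (nu - 1) <= nu ^+ n; last lra.
  elim: (n) => [|j IH]; first by rewrite expr0 mul0r addr0.
  rewrite exprS -natr1; have j0 : (0 : R) <= j%:R by [].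
  have := ler_wpM2l (ltW nu0) IH; have : 0 <= j%:R * (nu - 1) ^+ 2 by rewrite mulr_ge0 ?sqr_ge0.
  rewrite expr2; nra.
apply: (@le_trans _ _ (\sum_(n < N + N.+1) (100 * x) ^+ k / (nu - 1) * nu^-1 ^+ n)).
  by apply: ler_sum => n _; exact: term.
rewrite -mulr_sumr; apply: ler_wpM2l; first exact: x101.
exact: sum_geometric_le.
Qed.

Lemma peak_sum_tent_ge : exists2 d : R, 0 < d & forall N,
  d * N%:R <= nrm (peak_sum (fun n => (tent N n)%:R) (N + N.+1)).
Proof.
have [K K0 HK] := A2_point alpha.
have c20 : 0 < c / 2 by rewrite divr_gt0.
exists ((2 * K * (c / 2) `^ (- s))^-1).
  by rewrite invr_gt0 !mulr_gt0 ?powR_gt0.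
move=> N; set F := peak_sum _ _; pose p : C := wst + (0 +i* (c * nu ^+ N)).
have cnu : 0 < c * nu ^+ N by rewrite mulr_gt0.
have ipE : complex.Im p = complex.Im wst + c * nu ^+ N by rewrite /p; case: (wst).
have ipge : c / 2 * nu ^+ N <= complex.Im p.
  rewrite ipE; have nge : 1 <= nu ^+ N by rewrite exprn_ege1// ltW.
  have := cw; rewrite ler_norml => /andP[hw _].
  have : c / 2 * 1 <= c / 2 * nu ^+ N by rewrite ler_pM2l.
  by lra.
have ip : 0 < complex.Im p by rewrite (lt_le_trans _ ipge)// mulr_gt0.
have qp n : normc (q n p) <= (hump nu ^+ k) ^+ ndist n N.
  rewrite qE// peakf_axis ?invr_gt0//.
  rewrite exprAC lerXn2r ?nnegrE ?exprn_ge0 ?hump_ge0 ?(ltW nu0)//.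
    by apply: divr_ge0; [apply: mulr_ge0; [rewrite invr_ge0|]|]; exact: ltW.
  have -> : nu ^- n * (c * nu ^+ N) / c = nu ^+ N / nu ^+ n by field; rewrite !gt_eqF.
  have [nN|/ltnW Nn] := leqP n N.
    apply: hump_gap; [exact: ltW|by rewrite divr_gt0|left].
    have e : (ndist n N + n = N)%N by rewrite ndist_le// subnK.
    by rewrite ler_pdivlMr// -exprD e.
  apply: hump_gap; [exact: ltW|by rewrite divr_gt0|right].
  have e : (ndist n N + N = n)%N by rewrite ndist_ge// subnK.
  by rewrite invf_div ler_pdivlMr// -exprD e.
have qN : normc (q N p) = 1.
  rewrite qE// peakf_axis ?invr_gt0//.
  have -> : nu ^- N * (c * nu ^+ N) / c = 1 by field; rewrite !gt_eqF.
  by rewrite hump1 expr1n.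
pose x := nu `^ s * hump nu ^+ k.
have x0 : 0 <= x by rewrite mulr_ge0 ?powR_ge0// exprn_ge0// hump_ge0// ltW.
have kN : 0 < normc kap ^+ N by rewrite exprn_gt0.
have term n : (tent N n)%:R * normc kap ^+ n * normc (q n p) <=
    N%:R * normc kap ^+ N * x ^+ ndist n N.
  rewrite /x exprMn [leRHS]mulrA; apply: ler_pM; last exact: qp.
  - by rewrite mulr_ge0 ?exprn_ge0 ?normc_ge0.
  - exact: normc_ge0.
  - rewrite -mulrA; apply: ler_pM => //.
    + by rewrite exprn_ge0 ?normc_ge0.
    + by rewrite ler_nat tent_le.
    have kV : nu `^ s = (normc kap)^-1 by rewrite nkap powRN invrK.
    have [nN|/ltnW Nn] := leqP n N.
      rewrite ndist_le//.
      have kE : normc kap ^+ N = normc kap ^+ (N - n) * normc kap ^+ n by rewrite -exprD subnK.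
      by rewrite kV exprVn kE mulrAC mulfV ?mul1r// gt_eqF ?exprn_gt0.
    have kE : normc kap ^+ n = normc kap ^+ N * normc kap ^+ (n - N) by rewrite mulrC -exprD subnK.
    rewrite kE ler_pM2l//.
    apply: (@le_trans _ _ 1); first by rewrite exprn_ile1// normc_ge0.
    by rewrite exprn_ege1// kV invf_ge1.
have NN : (N < N + N.+1)%N by rewrite addnS ltnS leq_addr.
have lower : N%:R * normc kap ^+ N / 2 <= normc (F p).
  rewrite /F peak_sumE (bigD1 (Ordinal NN))//=; set S := \sum_(i | _) _.
  have Sle : normc S <= N%:R * normc kap ^+ N / 2.
    rewrite (le_trans (normc_sum _ _ _))//.
    apply: (@le_trans _ _ (\sum_(n < N + N.+1 | n != Ordinal NN) N%:R * normc kap ^+ N * x ^+ ndist n N)).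
      apply: ler_sum => n _; rewrite (normc_peak_term (fun n => (tent N n)%:R)) normr_nat.
      exact: term.
    rewrite -mulr_sumr ler_wpM2l ?mulr_ge0 ?(ltW kN)//.
    have x1 : x < 1 by have := hk; rewrite -/x; lra.
    have := sum_ndist N x0 x1; rewrite (bigD1 (Ordinal NN))//=.
    rewrite ndist_le// subnn expr0.
    rewrite lerD2l => /le_trans; apply.
    rewrite ler_pdivrMr ?subr_gt0//; have := hk; rewrite -/x; lra.
  pose u : C := ((tent N N)%:R)%:C * kap ^+ N * q N p; rewrite -/u.
  have uE : normc u = N%:R * normc kap ^+ N.
    rewrite /u (normc_peak_term (fun n => (tent N n)%:R) N p) normr_nat qN mulr1.
    by rewrite tent_mid.
  by have := normcD (u + S) (- S); rewrite addrK normcN uE; lra.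
have upper : normc (F p) <= K * (c / 2) `^ (- s) * normc kap ^+ N * nrm F.
  have pE : p = complex.Re p +i* complex.Im p by case: (p).
  rewrite pE (le_trans (HK F _ _ ip))//.
  rewrite ler_wpM2r ?nrm_ge0// -mulrA ler_pM2l//.
  have cp : (c / 2 * nu ^+ N) `^ (- s) = (c / 2) `^ (- s) * normc kap ^+ N.
    by rewrite powRM ?(ltW c20) ?(ltW (nn0 N))// powR_exp ?(ltW nu0)// nkap.
  rewrite -cp !powRN lef_pV2 ?posrE ?powR_gt0 ?mulr_gt0//.
  by rewrite ge0_ler_powR ?nnegrE ?(ltW ip)// mulr_ge0 ?ltW.
have := le_trans lower upper.
have B0 : 0 < 2 * K * (c / 2) `^ (- s) by rewrite !mulr_gt0 ?powR_gt0.
rewrite ler_pdivrMl//; set B := _ `^ _ in B0 *.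
rewrite (_ : N%:R * _ / 2 = normc kap ^+ N * (N%:R / 2)); last by ring.
rewrite (_ : K * B * _ * _ = normc kap ^+ N * (K * B * nrm F)); last by ring.
by rewrite ler_pM2l//; lra.
Qed.

End circle.

Lemma tent_succ N n : (tent N n.+1 <= (tent N n).+1)%N /\ (tent N n <= (tent N n.+1).+1)%N.
Proof. rewrite /tent; lia. Qed.

Lemma tent0 N : tent N 0 = 0%N.
Proof. rewrite /tent; lia. Qed.

Lemma tent_end N n : (N + N <= n)%N -> tent N n = 0%N.
Proof. rewrite /tent; lia. Qed.

Lemma tent_step (R : realType) N n : `|(tent N n.+1)%:R - (tent N n)%:R| <= 1 :> R.
Proof.
have [h1 h2] := tent_succ N n.
have r1 : (tent N n.+1)%:R <= (tent N n)%:R + 1 :> R by rewrite natr1 ler_nat.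
have r2 : (tent N n)%:R <= (tent N n.+1)%:R + 1 :> R by rewrite natr1 ler_nat.
by rewrite ler_norml; apply/andP; split; lra.
Qed.

Section shifts.
Context {R : realType} {V : normedModType R[i]}.
Variables (T : V -> V) (q : nat -> V).
Hypothesis lT : linear T.

Lemma shift_down (a : nat -> R[i]) M : (forall n, T (q n.+1) = q n) -> a 0%N = 0 ->
  T (\sum_(n < M.+1) a n *: q n) = \sum_(n < M) a n.+1 *: q n.
Proof.
move=> Tq a0; rewrite (lin_sum lT) big_ord_recl/= a0 scale0r (lin0 lT) add0r.
by apply: eq_bigr => n _; rewrite (linZ lT) Tq.
Qed.

Lemma shift_up (a : nat -> R[i]) M : (forall n, T (q n) = q n.+1) -> a M = 0 ->
  T (\sum_(n < M.+1) a n *: q n) = \sum_(n < M) a n *: q n.+1.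
Proof.
move=> Tq aM; rewrite (lin_sum lT) big_ord_recr/= aM scale0r (lin0 lT) addr0.
by apply: eq_bigr => n _; rewrite (linZ lT) Tq.
Qed.

End shifts.

Section fixed_point.
Context {R : realType}.
Notation C := (cplx R).
Variables (mu : R) (w0 : C).
Hypotheses (mu0 : 0 < mu) (mu1 : mu != 1).

Definition fixpt : C := ((1 - mu)^-1)%:C * w0.

Lemma fixptE : mu%:C * fixpt + w0 = fixpt.
Proof.
have m1 : (1 - mu) != 0 by rewrite subr_eq0 eq_sym.
have e : (mu * (1 - mu)^-1)%:C + 1 = ((1 - mu)^-1)%:C :> R[i].
  by apply/eqP; rewrite eq_complex/= addr0 eqxx andbT; apply/eqP; field.
have aux (p q r : R[i]) : p * (q * r) + r = (p * q + 1) * r by ring.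
by rewrite /fixpt aux -rmorphM e.
Qed.

Lemma Im_fixpt : complex.Im fixpt = complex.Im w0 / (1 - mu).
Proof. by rewrite /fixpt; case: w0 => a b /=; ring. Qed.

End fixed_point.

Lemma peak_ok_inv (R : realType) (wst : cplx R) (c nu : R) n : 1 < nu -> 0 < c ->
  `|complex.Im wst| <= c / 2 -> peak_ok wst c (nu ^- n).
Proof.
move=> nu1 c0; rewrite ler_norml => /andP[_ hw].
have nn : 0 < nu ^+ n by rewrite exprn_gt0// (lt_trans ltr01).
split; first by rewrite invr_gt0.
have h : nu ^- n <= 1 by rewrite invf_le1// exprn_ege1// ltW.
have h0 : 0 <= nu ^- n by rewrite invr_ge0 ltW.
by rewrite (le_trans (ler_wpM2l h0 hw))// ler_piMl// divr_ge0// ltW.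
Qed.

Section circle_case.
Context {R : realType} (alpha : R).
Hypothesis alpha_ge : -1 <= alpha.
Notation C := (cplx R).
Notation V := (A2_space alpha).
Variables (mu : R) (w0 : C) (T : V -> V) (lam : R[i]).
Hypotheses (mu0 : 0 < mu) (mu1 : mu != 1) (w00 : 0 <= complex.Im w0).
Hypothesis HT : comp_rel mu w0 T.

Lemma comp_sub_bounded : bounded_operator (fun F => T F - lam *: F).
Proof.
have bT := comp_bounded alpha_ge mu0 w00 HT; have lT := bT.1.
have [M M0 HM] := bounded_operator_nrm bT.
apply: (@operator_nrm_bounded _ _ _ (M + normc lam)).
  move=> c u v; rewrite lT scalerDr scalerA mulrC -scalerA opprD addrACA scalerBr.
  by [].
by move=> v; rewrite (le_trans (nrmB _ _))// mulrDl nrmZ lerD2r.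
Qed.

(* A Fredholm operator is bounded below up to a finite-dimensional error, which
   the bounds at points control. *)
Lemma unbounded_not_fredholm (f : nat -> V) (B d : R) : 0 < d ->
  (forall N, nrm (T (f N) - lam *: f N) <= B) -> bounded_at_points f ->
  (forall N, d * Num.sqrt N%:R <= nrm (f N)) ->
  ~ fredholm (fun F => T F - lam *: F).
Proof.
move=> d0 UfB fb fge fU; have [M HM] := fredholm_bounded alpha_ge comp_sub_bounded fU UfB fb.
have M0 : 0 <= M by apply: le_trans (HM 0%N); exact: nrm_ge0.
pose N := (Num.truncn ((M / d) ^+ 2)).+1.
have hN : (M / d) ^+ 2 < N%:R.
  by have /andP[_] := truncn_itv (sqr_ge0 (M / d)).
have := le_trans (fge N) (HM N); rewrite leNgt => /negP; apply.
rewrite -ltr_pdivrMl// mulrC -(@ltr_pXn2r _ 2)// ?nnegrE ?sqrtr_ge0 ?divr_ge0 ?(ltW d0)//.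
by rewrite sqr_sqrtr.
Qed.

Lemma circle_not_fredholm : normc lam = mu `^ (- ((alpha + 2) / 2)) ->
  ~ fredholm (fun F => T F - lam *: F).
Proof.
move=> nlam; have lT := comp_linear HT.
set s := (alpha + 2) / 2 in nlam *.
pose wst := fixpt mu w0; have wstE : mu%:C * wst + w0 = wst := fixptE w0 mu1.
have mui : 0 < mu^-1 by rewrite invr_gt0.
have lam0 : lam != 0 by rewrite -normc_gt0 nlam powR_gt0.
pose nu := if 1 < mu then mu else mu^-1.
have nu1 : 1 < nu.
  rewrite /nu; case: ifPn => //; rewrite -leNgt => h.
  by rewrite invf_gt1// lt_neqAle mu1.
have nu0 : 0 < nu by rewrite (lt_trans ltr01).
pose c := 2 * `|complex.Im wst| + 1.
have c0 : 0 < c by rewrite ltr_wpDl// mulr_ge0.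
have cw : `|complex.Im wst| <= c / 2 by rewrite /c; lra.
have [m Hm] := peak_family alpha_ge.
have h0 : 0 <= hump nu by rewrite hump_ge0// ltW.
have e0 : 0 < 5^-1 / nu `^ s by rewrite divr_gt0// powR_gt0.
have [k1 Hk1] := exp_small_ge h0 (hump_lt1 nu1) e0.
pose k := maxn m (maxn 2 k1).
have mk : (m <= k)%N by rewrite leq_maxl.
have k2 : (2 <= k)%N by rewrite /k !leq_max leqnn orbT.
have kk1 : (k1 <= k)%N by rewrite /k !leq_max leqnn !orbT.
have hk : nu `^ s * hump nu ^+ k <= 5^-1.
  by have := Hk1 k kk1; rewrite ler_pdivlMr ?powR_gt0// mulrC.
have [P [PE _ PD _]] := Hm k mk wst c c0.
pose q n := P (nu ^- n).
have ok n := peak_ok_inv n nu1 c0 cw.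
have qE n (w : C) : 0 < complex.Im w -> q n w = peakf wst c k (nu ^- n) w.
  exact: PE.
have [D D0 HD] := PD 1 ler01.
have qD n : (energy alpha (fun p => normc (q n (p.1 +i* p.2))) <=
    (D * (nu ^- n) `^ (- (alpha + 2)))%:E)%E.
  by apply: HD => //; rewrite invf_le1 ?exprn_gt0// exprn_ege1// ltW.
pose kap : R[i] := if 1 < mu then lam else lam^-1.
have nkap : normc kap = nu `^ (- s).
  rewrite /kap /nu; case: ifPn => // _; rewrite normcV nlam.
  have muV : (mu `^ (- s)) * (mu^-1 `^ (- s)) = 1.
    by rewrite -powRM ?(ltW mu0) ?(ltW mui)// mulfV ?gt_eqF// powR1.
  apply: (@mulfI _ (mu `^ (- s))); first by rewrite gt_eqF ?powR_gt0.
  by rewrite muV mulfV// gt_eqF ?powR_gt0.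
have Tq n n' : mu * nu ^- n = nu ^- n' -> T (q n) = q n'.
  move=> e; apply: A2_ext => z iz; rewrite HT// qE; last exact: Im_affine_gt0.
  by rewrite (qE _ _ iz) (peakf_comp _ _ _ _ wstE) e.
have [B B0 HB] := peak_sum_bound nu1 c0 cw k2 qE qD D0 nkap.
have [d d0 Hd] := peak_sum_tent_ge alpha_ge nu1 c0 cw qE hk nkap.
pose F N := peak_sum q kap (fun n => (tent N n)%:R) (N + N.+1).
have UF N : exists2 b : nat -> R, (forall n, `|b n| <= 1) &
    T (F N) - lam *: F N = lam *: peak_sum q kap b (N + N.+1).
  rewrite /F /peak_sum addnS.
  pose a n : R[i] := ((tent N n)%:R : R)%:C * kap ^+ n.
  have [m1|m1] := boolP (1 < mu).
    have kl : kap = lam by rewrite /kap m1.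
    exists (fun n => (tent N n.+1)%:R - (tent N n)%:R); first by move=> n; exact: tent_step.
    rewrite (@shift_down _ _ T q lT a); last 2 first.
    - move=> n; apply: Tq; rewrite /nu m1 exprS invfM mulVKf// gt_eqF//.
    - by rewrite /a tent0 rmorph0 mul0r.
    rewrite scaler_sumr [RHS]scaler_sumr; apply/eqP; rewrite subr_eq -big_split/= eq_sym.
    rewrite (eq_bigr (fun n : 'I_(N + N).+1 => a n.+1 *: q n)); last first.
      move=> n _; rewrite !scalerA -scalerDl; congr (_ *: _).
      rewrite /a exprS kl rmorphB.
      have aux (x y l p : R[i]) : l * ((x - y) * p) + l * (y * p) = x * (l * p) by ring.
      exact: aux.
    by rewrite big_ord_recr/= /a tent_end// rmorph0 mul0r scale0r addr0.
  have kl : lam * kap = 1 by rewrite /kap (negbTE m1) mulfV.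
  exists (fun n => (tent N n.-1)%:R - (tent N n)%:R).
    by case=> [|n]; rewrite /= ?subrr ?normr0// distrC; exact: tent_step.
  rewrite (@shift_up _ _ T q lT a); last 2 first.
  - move=> n; apply: Tq; rewrite /nu (negbTE m1) !exprVn !invrK exprS//.
  - by rewrite /a tent_end// rmorph0 mul0r.
  rewrite scaler_sumr [RHS]scaler_sumr; apply/eqP; rewrite subr_eq -big_split/= eq_sym.
  rewrite (eq_bigr (fun n : 'I_(N + N).+1 => (lam * (((tent N n.-1)%:R : R)%:C * kap ^+ n)) *: q n)); last first.
    move=> n _; rewrite !scalerA -scalerDl; congr (_ *: _).
    rewrite rmorphB.
    have aux (x y l p : R[i]) : l * ((x - y) * p) + l * (y * p) = l * (x * p) by ring.
    exact: aux.
  rewrite big_ord_recl/= tent0 rmorph0 mul0r mulr0 scale0r add0r.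
  apply/eqP; apply: eq_bigr => n _; congr (_ *: _); rewrite /a/= add0n exprS.
  have aux (x l k' p : R[i]) : l * (x * (k' * p)) = l * k' * (x * p) by ring.
  by rewrite aux kl mul1r.
pose f N := (((Num.sqrt N.+1%:R)^-1)%:C : R[i]) *: F N.+1.
have sq0 N : 0 < Num.sqrt N.+1%:R :> R by rewrite sqrtr_gt0.
have nsq N : normc ((Num.sqrt N.+1%:R)^-1)%:C = (Num.sqrt N.+1%:R)^-1 :> R.
  by rewrite normc_normr ger0_norm// invr_ge0 ltW.
apply: (@unbounded_not_fredholm f (normc lam * B * Num.sqrt 3) d d0).
- move=> N; rewrite /f (linZ lT) scalerA mulrC -scalerA -scalerBr nrmZ nsq.
  have [b b1 ->] := UF N.+1; rewrite nrmZ ler_pdivrMl//.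
  rewrite (le_trans (ler_wpM2l (normc_ge0 _) (HB b _ b1)))// mulrCA mulrA.
  rewrite [leRHS](_ : _ = B * normc lam * (Num.sqrt 3 * Num.sqrt N.+1%:R)); last by ring.
  rewrite ler_wpM2l ?mulr_ge0 ?normc_ge0// -sqrtrM// ler_wsqrtr//.
  rewrite natrD -!natr1; have : (0 : R) <= N%:R by []. lra.
- move=> w iw.
  have [B' HB'] := peak_sum_tent_pointwise alpha_ge nu1 c0 cw k2 qE nkap iw.
  exists B' => N; rewrite /f A2Z normcM nsq ler_pdivrMl// (le_trans (HB' N.+1))//.
  have B'0 : 0 <= B' by apply: le_trans (HB' 0%N); exact: normc_ge0.
  by rewrite ler_peMl// -[leLHS]sqrtr1 ler_wsqrtr// ler1n.
- move=> N; rewrite /f nrmZ nsq ler_pdivlMl// (le_trans _ (Hd N.+1))//.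
  rewrite mulrCA ler_pM2l//.
  have h : Num.sqrt N%:R <= Num.sqrt N.+1%:R :> R by rewrite ler_wsqrtr// ler_nat.
  rewrite (le_trans (ler_wpM2l (ltW (sq0 N)) h))// -expr2 sqr_sqrtr//.
Qed.

End circle_case.

(** * The open disc *)

Section zero_case.
Context {R : realType} (alpha : R).
Hypothesis alpha_ge : -1 <= alpha.
Notation C := (cplx R).
Notation V := (A2_space alpha).

Lemma normc_addi (z : C) (e : R) : 0 <= complex.Im z -> 0 <= e ->
  normc z <= normc (z + (0 +i* e)).
Proof.
case: z => a b /= b0 e0; rewrite addr0 ler_wsqrtr// lerD2l.
by rewrite lerXn2r ?nnegrE ?addr_ge0// lerDl.
Qed.

Lemma inv_decay (h z : R) k : 0 < h -> h <= z -> z ^- k <= (1 + h^-1) ^+ k * (1 + z) ^- k.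
Proof.
move=> h0 hz; have z0 : 0 < z by rewrite (lt_le_trans h0).
have z1 : 0 < 1 + z by rewrite addr_gt0.
rewrite -!exprVn -exprMn lerXn2r ?nnegrE ?invr_ge0 ?(ltW z0)//.
  by rewrite mulr_ge0 ?invr_ge0 ?addr_ge0 ?invr_ge0 ?(ltW z0) ?(ltW h0).
rewrite ler_pdivlMr// mulrDr mulr1 mulVf ?gt_eqF// addrC lerD2l.
by rewrite lef_pV2 ?posrE.
Qed.

(* Poles at -ie: their norms blow up as e tends to 0, while composition with tau
   moves the half-plane away from them. *)
Definition pole (k : nat) (e : R) (w : C) : C := ((w + (0 +i* e))^-1) ^+ k.

Lemma pole_neq (w : C) (e : R) : 0 < complex.Im w -> 0 <= e -> w + (0 +i* e) != 0.
Proof.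
move=> iw e0; rewrite -normc_gt0 (lt_le_trans _ (normc_addi (ltW iw) e0))//.
by rewrite normc_gt0; apply/eqP => w0; rewrite w0 ltxx in iw.
Qed.

Lemma analytic_pole k e : 0 <= e -> analytic_on (@upper_half_plane R) (pole k e).
Proof.
move=> e0 w iw.
have h := @derivable_linear R 1 (0 +i* e) w.
have h1 : derivable (fun w : C => w + (0 +i* e) : C) w 1.
  by rewrite (_ : (fun w => _) = (fun w : C => 1 * w + (0 +i* e) : C))//; apply/funext => z; rewrite mul1r.
have h2 := @derivableV _ _ (fun w : C => w + (0 +i* e) : C) w 1 (pole_neq iw e0) h1.
exact: (@derivable_exprn R (fun w : C => (w + (0 +i* e))^-1 : C) k w h2).
Qed.

Lemma normc_pole k e (w : C) : normc (pole k e w) = normc (w + (0 +i* e)) ^- k.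
Proof. by rewrite /pole normcX normcV exprVn. Qed.

Variables (mu : R) (w0 : C) (T : V -> V).
Hypotheses (mu0 : 0 < mu) (w00 : 0 < complex.Im w0).
Hypothesis HT : comp_rel mu w0 T.

Lemma zero_not_fredholm : ~ fredholm (fun F => T F - (0 : R[i]) *: F).
Proof.
have [m Hm] := energy_decay alpha_ge.
set s := (alpha + 2) / 2.
have al := alpha_ge; have s0 : 0 <= s by rewrite divr_ge0//; lra.
pose k := (m + (Num.truncn s).+2)%N.
have mk : (m <= k * 2)%N by rewrite (leq_trans (leq_addr _ _) (leq_pmulr _ _)).
have sk : s + 1 <= k%:R.
  have /andP[_ /ltW] := truncn_itv s0.
  rewrite /k natrD -(natr1 (Num.truncn s).+1); have : (0 : R) <= m%:R by []. lra.
pose e N : R := N.+1%:R^-1.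
have e0 N : 0 < e N by rewrite invr_gt0.
have /choice[f Hf] : forall N, exists F : V, forall w : C, 0 < complex.Im w -> F w = pole k (e N) w.
  move=> N; have aG := admissible_ext0 (@analytic_pole k _ (ltW (e0 N))).
  have [D D0 HD] := Hm (0 -i* e N) 1 1 ltr01 ler01.
  have A0 : 0 <= (1 + (e N)^-1) ^+ (k * 2) by rewrite exprn_ge0// addr_ge0// invr_ge0 ltW.
  have := HD _ _ 1 (k * 2)%N mk (nnp_sqmag aG) A0 ltr01 (lexx 1).
  have [|h] := pselect (forall x y : R, 0 < y -> sqmag (ext0 (pole k (e N))) (x, y) <=
      (1 + (e N)^-1) ^+ (k * 2) * (1 + peak_rad (0 -i* e N) 1 1 (x +i* y)) ^- (k * 2)).
    move=> h /(_ h) H; have [F HF] := A2_ex aG (le_lt_trans H (ltry _)).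
    by exists F => w iw; rewrite HF ext0E.
  case: h => x y y0; rewrite /sqmag/= ext0E// normc_pole -exprVn -exprM exprVn.
  rewrite /peak_rad divr1 mul1r.
  rewrite (_ : x +i* y - (0 -i* e N) = x +i* y + (0 +i* e N) :> C); last first.
    by apply/eqP; rewrite eq_complex/= opprK oppr0 !eqxx.
  apply: inv_decay => //; have := normr_Im_le ((x +i* y : C) + (0 +i* e N)).
  apply: le_trans; have ye : e N <= y + e N by rewrite lerDr ltW.
  by rewrite /= ger0_norm// (le_trans _ ye)// ltW.
have [K K0 HK] := A2_point alpha.
have [D D0 HD] := Hm (- ((mu^-1)%:C * w0)) 1 mu ltr01 (ltW mu0).
pose b := complex.Im w0; have b0 : 0 < b by [].
pose A : R := (1 + b^-1) ^+ (k * 2).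
have A0 : 0 <= A by rewrite exprn_ge0// addr_ge0// invr_ge0 ltW.
have bT := comp_bounded alpha_ge mu0 (ltW w00) HT.
have Tf N : nrm (T (f N)) <= Num.sqrt (A * D * mu `^ (- (alpha + 2))).
  apply: nrm_le_sqrt; first by rewrite mulr_ge0 ?powR_ge0// mulr_ge0// ltW.
  apply: (HD _ _ _ (k * 2)%N mk (nnpF (T (f N))) A0 mu0 (lexx mu)) => x y y0.
  have iw : 0 < complex.Im (x +i* y : C) by [].
  rewrite /sqmag/= HT// Hf; last by apply: Im_affine_gt0 => //; exact: ltW.
  rewrite normc_pole -exprVn -exprM exprVn.
  have -> : peak_rad (- ((mu^-1)%:C * w0)) 1 mu (x +i* y) = normc (mu%:C * (x +i* y) + w0).
    rewrite /peak_rad divr1 opprK -{1}[mu](ger0_norm (ltW mu0)) -normc_normr -normcM.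
    rewrite mulrDr [_ * (_ * w0)]mulrA -rmorphM mulfV ?gt_eqF// rmorph1 mul1r//.
  set z : C := mu%:C * (x +i* y) + w0.
  have bz : b <= complex.Im z by rewrite /z Im_affine/= lerDr mulr_ge0 ?ltW.
  have z0 : 0 <= complex.Im z by rewrite (le_trans _ bz)// ltW.
  have bn : b <= normc z.
    by rewrite (le_trans bz)// (le_trans (ler_norm _))// normr_Im_le.
  apply: le_trans (inv_decay _ b0 bn).
  have nz : 0 < normc z by rewrite (lt_le_trans w00).
  have h := normc_addi z0 (ltW (e0 N)).
  by rewrite lef_pV2 ?posrE ?exprn_gt0 ?(lt_le_trans nz)// lerXn2r ?nnegrE ?normc_ge0.
have d0 : 0 < (K * 2 ^+ k)^-1 by rewrite invr_gt0 mulr_gt0// exprn_gt0.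
apply: (@unbounded_not_fredholm R alpha alpha_ge mu w0 T 0 mu0 (ltW w00) HT f
  (Num.sqrt (A * D * mu `^ (- (alpha + 2)))) _ d0).
- by move=> N; rewrite scale0r subr0.
- move=> w iw; exists (normc w ^- k) => N; rewrite Hf// normc_pole.
  have nw : 0 < normc w by rewrite normc_gt0; apply/eqP => h; rewrite h ltxx in iw.
  have h := normc_addi (ltW iw) (ltW (e0 N)).
  by rewrite lef_pV2 ?posrE ?exprn_gt0 ?(lt_le_trans nw)// lerXn2r ?nnegrE ?normc_ge0.
- move=> N; rewrite ler_pdivrMl ?mulr_gt0 ?exprn_gt0//.
  have := HK (f N) 0 (e N) (e0 N); rewrite Hf/= ?e0// normc_pole.
  rewrite (_ : (0 +i* e N) + (0 +i* e N) = 0 +i* (2 * e N) :> C); last first.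
    by apply/eqP; rewrite eq_complex/= addr0 eqxx/=; apply/eqP; ring.
  rewrite normc_imag ger0_norm ?mulr_ge0 ?(ltW (e0 N))// exprMn invfM => h.
  have N0 : 0 < N.+1%:R :> R by [].
  have h1 : e N ^- k = N.+1%:R ^+ k by rewrite /e exprVn invrK.
  have h2 : e N `^ (- s) = N.+1%:R `^ s.
    have := @powRM R (e N) N.+1%:R s (ltW (e0 N)) (ltW N0).
    rewrite /e mulVf ?gt_eqF// powR1 powRN => /esym h2.
    have x0 : N.+1%:R^-1 `^ s != 0 :> R by rewrite gt_eqF// powR_gt0// invr_gt0.
    by apply: (mulfI x0); rewrite mulfV// h2.
  rewrite h1 h2 in h.
  have {}h : N.+1%:R ^+ k <= 2 ^+ k * (K * N.+1%:R `^ s * nrm (f N)).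
    by rewrite -ler_pdivrMl ?exprn_gt0.
  have h3 : N.+1%:R `^ s * N.+1%:R <= N.+1%:R ^+ k :> R.
    rewrite -[X in _ * X <= _]powRr1 ?(ltW N0)// -powRD; last by rewrite (gt_eqF N0) implybT.
    by rewrite -powR_mulrn ?(ltW N0)// ler_powR// ler1n.
  have ps : 0 < N.+1%:R `^ s :> R by rewrite powR_gt0.
  have {h3}h := le_trans h3 h.
  have {}h : N.+1%:R <= K * 2 ^+ k * nrm (f N).
    rewrite -(ler_pM2l ps) (le_trans h)//.
    by rewrite le_eqVlt; apply/orP; left; apply/eqP; ring.
  apply: le_trans h; have h4 : Num.sqrt N%:R <= Num.sqrt (N.+1%:R ^+ 2) :> R.
    rewrite ler_wsqrtr// -natrX ler_nat (leq_trans (leqnSn N))//.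
    by rewrite expnS expn1 leq_pmull.
  by rewrite (le_trans h4)// sqrtr_sqr ger0_norm.
Qed.

End zero_case.

Lemma exponent_gap n i j m N : (i <= n)%N -> (j <= n)%N -> i != j \/ m != N ->
  (ndist m N + 1 + (2 * i + 2 * (n + 2) * m) <= 2 * j + 2 * (n + 2) * N)%N \/
  (ndist m N + 2 + (2 * j + 2 * (n + 2) * N) <= 2 * i + 2 * (n + 2) * m)%N.
Proof.
move=> hi hj h; have [mN|Nm|mN] := ltngtP m N.
- left; rewrite ndist_le ?(ltnW mN)//; have [d d0 ->] : exists2 d, (0 < d)%N & N = (m + d)%N.
    by exists (N - m)%N; rewrite ?subn_gt0// subnKC// ltnW.
  by rewrite addKn mulnDr; nia.
- right; rewrite ndist_ge ?(ltnW Nm)//; have [d d0 ->] : exists2 d, (0 < d)%N & m = (N + d)%N.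
    by exists (m - N)%N; rewrite ?subn_gt0// subnKC// ltnW.
  by rewrite addKn mulnDr; nia.
- rewrite mN ndist_le// subnn; case: h => [/eqP h|]; last by rewrite mN eqxx.
  have [ij|ij|//] := ltngtP i j; [left|right]; lia.
Qed.

Lemma lattice_root (R : realType) n (nu : R) : 1 < nu ->
  exists2 t : R, 1 < t & t ^+ (2 * (n + 2)) = nu.
Proof.
move=> nu1; have nu0 : 0 < nu by rewrite (lt_trans ltr01).
pose t := nu `^ ((2 * (n + 2))%:R^-1).
have n0 : (2 * (n + 2))%:R != 0 :> R by rewrite pnatr_eq0 muln_eq0 addn_eq0 andbF.
have tE : t ^+ (2 * (n + 2)) = nu.
  by rewrite -powR_mulrn ?powR_ge0// -powRrM mulVf// powRr1// ltW.
exists t => //; rewrite ltNge; apply/negP => h; have := nu1.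
by rewrite -tE ltNge exprn_ile1// powR_ge0.
Qed.

Lemma powRVN (R : realType) (x s : R) : 0 < x -> x^-1 `^ (- s) = x `^ s.
Proof. by move=> x0; rewrite -[x^-1]powR_inv1 ?ltW// -powRrM mulrNN mul1r. Qed.

Section gaps.
Context {R : realType}.
Variables (t : R) (n : nat).
Hypothesis t1 : 1 < t.
Let nu := t ^+ (2 * (n + 2)).

Let t0 : 0 < t. Proof. by rewrite (lt_trans ltr01). Qed.

(* The peaks sit at the points t^{2i} nu^m; they are compared at e t^{2j} nu^N
   with a displacement e smaller than the gap t. *)
Lemma hump_lattice (i j m N : nat) (e : R) : (i <= n)%N -> (j <= n)%N ->
  1 <= e -> e <= t -> i != j \/ m != N ->
  hump (e * t ^+ (2 * j) * (nu ^+ N / nu ^+ m) / t ^+ (2 * i)) <= hump t ^+ (ndist m N).+1.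
Proof.
move=> hi hj e1 et h.
have e0 : 0 < e by rewrite (lt_le_trans ltr01).
set x := _ / _.
have xE : x = e * t ^+ (2 * j + 2 * (n + 2) * N) / t ^+ (2 * i + 2 * (n + 2) * m).
  have aux (a b c d : R) : e * b * (c / d) / a = e * (b * c) / (a * d).
    by rewrite invfM; ring.
  have nuX p : nu ^+ p = t ^+ (2 * (n + 2) * p) by rewrite -exprM.
  by rewrite /x !nuX aux -!exprD.
have tX p : 0 < t ^+ p by rewrite exprn_gt0.
have x0 : 0 < x by rewrite xE !(divr_gt0, mulr_gt0).
apply: hump_gap => //; first exact: ltW.
have [hh|hh] := exponent_gap hi hj h; [left|right].
  rewrite xE ler_pdivlMr// -exprD -addn1.
  rewrite (@le_trans _ _ (t ^+ (2 * j + 2 * (n + 2) * N)))//.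
    by rewrite ler_weXn2l// ltW.
  by rewrite ler_peMl// ltW.
rewrite xE invf_div ler_pdivlMr ?mulr_gt0// mulrCA -exprD.
rewrite (@le_trans _ _ (t * t ^+ ((ndist m N).+1 + (2 * j + 2 * (n + 2) * N))))//.
  by rewrite ler_wpM2r// ltW.
rewrite addn2 in hh; rewrite -exprS; apply: ler_weXn2l; [exact: ltW|exact: hh].
Qed.

Lemma sum_lattice_le (L q : R) N : 1 <= L -> 0 <= q -> L * q <= 4^-1 ->
  \sum_(m < N + N.+1) L ^+ ndist m N * q ^+ (ndist m N).+1 <= 2 * q.
Proof.
move=> L1 q0 Lq; have Lq0 : 0 <= L * q by rewrite mulr_ge0//; lra.
under eq_bigr do rewrite exprS mulrCA -exprMn.
rewrite -mulr_sumr mulrC ler_wpM2r//.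
have Lq1 : L * q < 1 by lra.
rewrite (le_trans (sum_ndist N Lq0 Lq1))//.
suff : 2 * (L * q) / (1 - L * q) <= 1 by lra.
by rewrite ler_pdivrMr ?subr_gt0//; lra.
Qed.

End gaps.

Lemma coef_ndist (R : realType) (lam : R[i]) a b : lam != 0 ->
  normc (lam ^+ a / lam ^+ b) <= Num.max (normc lam) (normc lam)^-1 ^+ ndist a b.
Proof.
move=> lam0; have nl : 0 < normc lam by rewrite normc_gt0.
have L0 : 0 <= Num.max (normc lam) (normc lam)^-1 by rewrite le_max (ltW nl).
rewrite normcM normcV !normcX; have [mN|/ltnW Nm] := leqP a b.
  rewrite ndist_le// -{1}(subnK mN) exprD invfM mulrCA mulfV ?mulr1 ?expf_neq0 ?gt_eqF//.
  by rewrite -exprVn lerXn2r ?nnegrE ?invr_ge0 ?(ltW nl)// le_max lexx orbT.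
rewrite ndist_ge// -{1}(subnK Nm) exprD mulfK ?expf_neq0 ?gt_eqF//.
by rewrite lerXn2r ?nnegrE ?(ltW nl)// le_max lexx.
Qed.

Section kernel_case.
Context {R : realType} (alpha : R).
Hypothesis alpha_ge : -1 <= alpha.
Notation C := (cplx R).
Notation V := (A2_space alpha).
Variables (mu : R) (w0 : C) (T : V -> V) (lam : R[i]).
Hypotheses (mu1 : 1 < mu) (w00 : 0 < complex.Im w0).
Hypothesis HT : comp_rel mu w0 T.

Lemma chain_defect (h : nat -> V) M : linear T -> (forall n, T (h n.+1) = lam *: h n) ->
  T (\sum_(n < M.+1) h n) - lam *: (\sum_(n < M.+1) h n) = T (h 0%N) - lam *: h M.
Proof.
move=> lT Th; rewrite (lin_sum lT) big_ord_recl/= big_ord_recr/= scalerDr scaler_sumr.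
rewrite (eq_bigr (fun n : 'I_M => lam *: h n)); last by move=> n _; rewrite Th.
by rewrite opprD addrA addrK.
Qed.

(* [\sum_m lam^m P(mu^{-m} s)] is a formal eigenvector; the defect of a truncation
   is small at one end because |lam| < mu^{-s}, with s = (alpha + 2)/2, and at the
   other because wst lies below the real axis. *)
Lemma kernel_not_fredholm : lam != 0 -> normc lam < mu `^ (- ((alpha + 2) / 2)) ->
  ~ fredholm (fun F => T F - lam *: F).
Proof.
move=> lam0 lamr; have lT := comp_linear HT.
have mu0 : 0 < mu by rewrite (lt_trans ltr01).
have mun1 : mu != 1 by rewrite gt_eqF.
have muX p : 0 < mu ^+ p by rewrite exprn_gt0.
set s := (alpha + 2) / 2 in lamr *.
have al := alpha_ge; have s0 : 0 <= s by rewrite divr_ge0//; lra.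
have nl : 0 < normc lam by rewrite normc_gt0.
pose wst := fixpt mu w0; have wstE : mu%:C * wst + w0 = wst := fixptE w0 mun1.
have Iw : complex.Im wst < 0.
  by rewrite Im_fixpt pmulr_rlt0// invr_lt0 subr_lt0.
pose c := 2 * `|complex.Im wst| + 1.
have c0 : 0 < c by rewrite ltr_wpDl// mulr_ge0.
have ok x : 0 < x -> peak_ok wst c x.
  move=> x0; split => //; apply: (@le_trans _ _ 0); last by rewrite divr_ge0 ?ltW.
  by rewrite mulr_ge0_le0 ?ltW.
have [m0 Hm] := peak_family alpha_ge.
pose L := Num.max (normc lam) (normc lam)^-1.
have L1 : 1 <= L.
  rewrite le_max; have [//|h] := leP 1 (normc lam).
  by rewrite /= invf_ge1// ltW.
have L0 : 0 < L by rewrite (lt_le_trans ltr01).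
apply: (infinite_kernel alpha_ge (comp_sub_bounded alpha_ge lam mu0 (ltW w00) HT)) => n.
have [t t1 tE] := lattice_root n mu1.
have t0 : 0 < t by rewrite (lt_trans ltr01).
have tX p : 0 < t ^+ p by rewrite exprn_gt0.
have h0 : 0 <= hump t by rewrite hump_ge0// ltW.
have e10 : 0 < (4 * n.+1%:R)^-1 :> R by rewrite invr_gt0 mulr_gt0.
have [k1 Hk1] := exp_small_ge h0 (hump_lt1 t1) e10.
have e20 : 0 < (4 * L)^-1 by rewrite invr_gt0 mulr_gt0.
have [k2 Hk2] := exp_small_ge h0 (hump_lt1 t1) e20.
have e30 : 0 < normc lam / 2 by rewrite divr_gt0.
have mui0 : 0 <= mu^-1 by rewrite invr_ge0 ltW.
have mui1 : mu^-1 < 1 by rewrite invf_lt1.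
have [k3 Hk3] := exp_small_ge mui0 mui1 e30.
pose k := maxn m0 (maxn k1 (maxn k2 k3)).
have km : (m0 <= k)%N by rewrite leq_maxl.
have {}Hk1 : hump t ^+ k <= (4 * n.+1%:R)^-1 by apply: Hk1; rewrite /k !leq_max leqnn orbT.
have {}Hk2 : hump t ^+ k <= (4 * L)^-1 by apply: Hk2; rewrite /k !leq_max leqnn !orbT.
have {}Hk3 : mu^-1 ^+ k <= normc lam / 2 by apply: Hk3; rewrite /k !leq_max leqnn !orbT.
set q := hump t ^+ k in Hk1 Hk2.
have q0 : 0 <= q by rewrite exprn_ge0.
have Lq : L * q <= 4^-1.
  by move: Hk2; rewrite invfM ler_pdivlMr// mulrC.
have [P [PE PN _ PB]] := Hm k km wst c c0.
have TP x : 0 < x -> T (P x) = P (mu * x).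
  move=> x0; have mx : 0 < mu * x by rewrite mulr_gt0.
  apply: A2_ext => z iz; rewrite HT// PE; [|exact: ok|exact: Im_affine_gt0 (ltW w00) iz].
  by rewrite (PE _ (ok _ mx) _ iz); exact: peakf_comp.
pose p (j : 'I_n.+1) : C := wst + (0 +i* (c * t ^+ (2 * j))).
have pj j : 0 < complex.Im (p j).
  have : complex.Im (p j) = complex.Im wst + c * t ^+ (2 * j) by rewrite /p; case: (wst).
  have : c * 1 <= c * t ^+ (2 * j) by rewrite ler_pM2l// exprn_ege1// ltW.
  have := ler_norm (- complex.Im wst); rewrite normrN /c; have := normr_ge0 (complex.Im wst); lra.
exists p => // eps eps0.
pose sc N (i : 'I_n.+1) m : R := mu ^+ N / mu ^+ m / t ^+ (2 * i).
have sc0 N i m : 0 < sc N i m by rewrite /sc !divr_gt0.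
pose h N (i : 'I_n.+1) m : V := (lam ^+ m / lam ^+ N) *: P (sc N i m).
have Th N i m : T (h N i m.+1) = lam *: h N i m.
  rewrite /h (linZ lT) TP// scalerA exprS -mulrA; congr (_ *: P _).
  by rewrite /sc exprS; field; rewrite !gt_eqF.
pose E N i : V := \sum_(m < N + N.+1) h N i m.
have Pp x j : 0 < x -> normc (P x (p j)) = hump (x * t ^+ (2 * j)) ^+ k.
  move=> x0; rewrite PE//; last exact: ok.
  rewrite peakf_axis ?mulr_gt0//; congr (hump _ ^+ k).
  by field; rewrite gt_eqF.
have lamN a b : normc (lam ^+ a / lam ^+ b) = normc lam ^+ a / normc lam ^+ b.
  by rewrite normcM normcV !normcX.
have term N i j m : i != j \/ m != N -> normc (h N i m (p j)) <= L ^+ ndist m N * q ^+ (ndist m N).+1.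
  move=> hij; rewrite /h A2Z normcM; apply: ler_pM; rewrite ?normc_ge0 ?coef_ndist//.
  rewrite Pp// /q exprAC lerXn2r ?nnegrE ?exprn_ge0// ?hump_ge0//.
    by rewrite mulr_ge0 ?(ltW (sc0 _ _ _)) ?(ltW (tX _)).
  have hi : (i <= n)%N by rewrite -ltnS.
  have hj : (j <= n)%N by rewrite -ltnS.
  have hij' : (i : nat) != j \/ m != N by case: hij; [left|right].
  have := hump_lattice t1 hi hj (lexx 1) (ltW t1) hij'; rewrite tE mul1r.
  have -> : sc N i m * t ^+ (2 * j) = t ^+ (2 * j) * (mu ^+ N / mu ^+ m) / t ^+ (2 * i).
    by rewrite /sc; ring.
  by [].
have offsum : forall N i j (A : pred 'I_(N + N.+1)), (forall m, A m -> i != j \/ (m : nat) != N) ->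
    \sum_(m < N + N.+1 | A m) normc (h N i m (p j)) <= 2 * q.
  move=> N i j A HA; apply: le_trans (sum_lattice_le N L1 q0 Lq).
  rewrite big_mkcond/=; apply: ler_sum => m _; case: ifPn => [/HA|_]; first exact: term.
  by rewrite mulr_ge0 ?exprn_ge0// ltW.
have [D1 D10 HD1] := PB Iw.
have [D2 D20 HD2] := PN 1 ler01.
pose A := t ^+ (2 * n).
have A0 : 0 < A by rewrite exprn_gt0.
have iA (i : 'I_n.+1) : t ^+ (2 * i) <= A.
  by rewrite ler_weXn2l ?(ltW t1)// leq_mul2l /= -ltnS.
have mus : normc lam * mu `^ s < 1.
  by move: lamr; rewrite powRN -ltr_pdivlMr ?powR_gt0// mul1r.
have ls0 : 0 <= normc lam * mu `^ s by rewrite mulr_ge0 ?powR_ge0 ?normc_ge0.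
pose B1 := D1 * A ^+ k; have B10 : 0 <= B1 by rewrite mulr_ge0 ?exprn_ge0 ?ltW.
pose B2 := normc lam * D2 * A `^ s.
have B20 : 0 <= B2 by rewrite !mulr_ge0 ?powR_ge0 ?normc_ge0 ?ltW.
have UE N i : nrm (T (E N i) - lam *: E N i) <= B1 * 2^-1 ^+ N + B2 * (normc lam * mu `^ s) ^+ N.
  rewrite /E addnS (chain_defect _ lT (Th N i)) (le_trans (nrmB _ _))//; apply: lerD.
    rewrite /h (linZ lT) TP// nrmZ lamN expr0 mul1r.
    have x0 : 0 < mu * sc N i 0%N by rewrite mulr_gt0.
    rewrite ler_pdivrMl ?exprn_gt0// (le_trans (HD1 _ x0))// /B1.
    rewrite /sc expr0 divr1.
    have -> : (mu * (mu ^+ N / t ^+ (2 * i))) ^- k = (mu^-1 ^+ k) ^+ N.+1 * (t ^+ (2 * i)) ^+ k.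
      rewrite mulrA -exprS expr_div_n invf_div mulrC; congr (_ * _).
      by rewrite -exprM mulnC exprM -exprVn -exprVn.
    have hN : (mu^-1 ^+ k) ^+ N.+1 <= normc lam ^+ N * 2^-1 ^+ N.
      rewrite -exprMn (@le_trans _ _ ((mu^-1 ^+ k) ^+ N))//.
        by apply: ler_wiXn2l => //; [exact: exprn_ge0|rewrite exprn_ile1// ltW].
      by rewrite lerXn2r ?nnegrE ?exprn_ge0// mulr_ge0 ?normc_ge0.
    have hA : (t ^+ (2 * i)) ^+ k <= A ^+ k.
      by rewrite lerXn2r ?nnegrE ?(ltW A0) ?(ltW (tX _))// iA.
    have h1 : 0 <= (mu^-1 ^+ k) ^+ N.+1 by rewrite !exprn_ge0.
    have h2 : 0 <= (t ^+ (2 * i)) ^+ k by rewrite exprn_ge0// ltW.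
    have hh := ler_wpM2l (ltW D10) (ler_pM h1 h2 hN hA).
    by rewrite (le_trans hh)// le_eqVlt; apply/orP; left; apply/eqP; ring.
  rewrite nrmZ /h nrmZ lamN exprD mulfK ?expf_neq0 ?gt_eqF//.
  have scE : sc N i (N + N)%N = (mu ^+ N * t ^+ (2 * i))^-1.
    by rewrite /sc exprD !invfM; field; rewrite !gt_eqF.
  have sc1 : sc N i (N + N)%N <= 1.
    by rewrite scE invf_le1 ?mulr_gt0// mulr_ege1// exprn_ege1// ltW.
  have hP := HD2 _ (ok _ (sc0 N i (N + N)%N)) sc1.
  rewrite scE powRVN ?mulr_gt0// powRM ?(ltW (muX _)) ?(ltW (tX _))// powR_exp ?(ltW mu0)// -scE in hP.
  have hA : (t ^+ (2 * i)) `^ s <= A `^ s.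
    by rewrite ge0_ler_powR ?nnegrE ?(ltW A0) ?(ltW (tX _))// iA.
  have mN : 0 <= D2 * (mu `^ s) ^+ N by rewrite mulr_ge0 ?exprn_ge0 ?powR_ge0 ?(ltW D20).
  have lN : 0 <= normc lam * normc lam ^+ N by rewrite mulr_ge0 ?exprn_ge0 ?normc_ge0.
  have hh := ler_wpM2l mN hA.
  rewrite mulrA (le_trans (ler_wpM2l lN hP))//.
  rewrite [X in _ * X]mulrA (le_trans (ler_wpM2l lN hh))//.
  by rewrite /B2 exprMn le_eqVlt; apply/orP; left; apply/eqP; ring.
have eB1 : 0 < eps / 2 / (B1 + 1) by rewrite !divr_gt0// ltr_wpDl.
have eB2 : 0 < eps / 2 / (B2 + 1) by rewrite !divr_gt0// ltr_wpDl.
have half0 : (0 : R) <= 2^-1 by rewrite invr_ge0.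
have half1 : (2^-1 : R) < 1 by rewrite invf_lt1 ?ltr1n.
have [N1 HN1] := exp_small_ge half0 half1 eB1.
have [N2 HN2] := exp_small_ge ls0 mus eB2.
pose N := maxn N1 N2; exists (E N) => [i|j].
  rewrite (le_trans (UE N i))//.
  have h1 := HN1 N (leq_maxl _ _); have h2 := HN2 N (leq_maxr _ _).
  rewrite ler_pdivlMr ?ltr_wpDl// in h1; rewrite ler_pdivlMr ?ltr_wpDl// in h2.
  have p1 : 0 <= 2^-1 ^+ N :> R by rewrite exprn_ge0.
  have p2 : 0 <= (normc lam * mu `^ s) ^+ N by rewrite exprn_ge0.
  rewrite mulrDr mulr1 in h1; rewrite mulrDr mulr1 in h2.
  by lra.
have NN : (N < N + N.+1)%N by rewrite addnS ltnS leq_addr.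
have Ei i : i != j -> normc (E N i (p j)) <= 2 * q.
  move=> ij; rewrite /E A2_sum (le_trans (normc_sum _ _ _))//.
  by apply: (offsum N i j xpredT) => m _; left.
have Ej : 1 <= normc (E N j (p j)) + 2 * q.
  rewrite /E A2_sum (bigD1 (Ordinal NN))//=; set S := \sum_(i | _) _.
  have SN : normc S <= 2 * q.
    rewrite (le_trans (normc_sum _ _ _))//.
    apply: (offsum N j j (fun m => m != Ordinal NN)) => m mN; right.
    by apply: contra mN => /eqP mN; apply/eqP/val_inj.
  have hN : normc (h N j N (p j)) = 1.
    rewrite /h A2Z normcM mulfV ?expf_neq0// normc1 mul1r Pp//.
    by rewrite /sc mulfV ?gt_eqF// mul1r mulVf ?gt_eqF// hump1 expr1n.
  have := normcD (h N j N (p j) + S) (- S); rewrite addrK normcN hN.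
  by move/le_trans; apply; rewrite lerD2l.
have Es : \sum_(i | i != j) normc (E N i (p j)) <= n%:R * (2 * q).
  have -> : n%:R * (2 * q) = \sum_(i < n.+1 | i != j) 2 * q.
    by rewrite sumr_const cardC1 card_ord mulr_natl.
  by apply: ler_sum => i; exact: Ei.
have hq : (n%:R + 1) * (4 * q) <= 1.
  have := Hk1; rewrite -[leRHS]mul1r ler_pdivlMr ?mulr_gt0// natr1 => h1.
  by rewrite (le_trans _ h1)// le_eqVlt; apply/orP; left; apply/eqP; ring.
by lra.
Qed.

End kernel_case.

Section differences.
Context {R : realType}.
Notation C := (cplx R).
Implicit Types (F : C -> C) (v h : C).

Lemma Im_add (v h : C) : complex.Im (v + h) = complex.Im v + complex.Im h.
Proof. by case: v h => a b [c d]. Qed.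

Fixpoint dif (J : nat) F v h : C :=
  if J is j.+1 then dif j F (v + h) h - dif j F v h else F v.

Lemma dif_le J F v h (B : R) : (forall j, (j <= J)%N -> normc (F (v + j%:R * h)) <= B) ->
  normc (dif J F v h) <= 2 ^+ J * B.
Proof.
elim: J v => [|J IH] v HB; first by have := HB 0%N isT; rewrite mul0r addr0 expr0 mul1r.
rewrite /= (le_trans (normcD _ _))// normcN exprS -mulrA mulr_natl mulr2n lerD//.
  apply: IH => j jJ; have := HB j.+1 jJ.
  by rewrite -natr1 mulrDl mul1r addrA (addrAC v).
by apply: IH => j jJ; apply: HB; exact: leqW.
Qed.

Lemma dif_main J F v h (B : R) :
  (forall j, (0 < j)%N -> (j <= J)%N -> normc (F (v + j%:R * h)) <= B) ->
  0 <= B -> normc (dif J F v h - (-1) ^+ J * F v) <= 2 ^+ J * B.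
Proof.
elim: J v => [|J IH] v HB B0; first by rewrite /= expr0 mul1r subrr normc0 expr0 mul1r.
have aux (p q r : R[i]) : p - q - - r = p - (q - r) by ring.
rewrite /= exprS mulN1r mulNr aux (le_trans (normcD _ _))// normcN.
rewrite exprS -mulrA mulr_natl mulr2n lerD//.
  apply: dif_le => j jJ; have := HB j.+1 isT jJ.
  by rewrite -natr1 mulrDl mul1r addrA (addrAC v).
by apply: IH => // j j0 jJ; apply: HB => //; exact: leqW.
Qed.

Lemma analytic_dif J F h : analytic_on (@upper_half_plane R) F -> 0 <= complex.Im h ->
  analytic_on (@upper_half_plane R) (fun v => dif J F v h).
Proof.
move=> aF h0; elim: J => [//|J IH] w iw.
have ih : upper_half_plane (w + h).
  by rewrite /upper_half_plane/= Im_add ltr_wpDr.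
apply/derivable_cderivP.
have [D1 H1] := analytic_cderiv IH iw.
have [D2 H2] := analytic_cderiv IH ih.
have H3 : has_cderiv (fun v => dif J F (1 * v + h) h) w (D2 * 1).
  by apply: (@has_cderiv_affine R (fun v => dif J F v h) 1 h w D2); rewrite mul1r.
exists (D2 * 1 - D1); have := has_cderivB H3 H1.
by rewrite (_ : (fun w => _) = (fun v => dif J.+1 F v h))//; apply/funext => v; rewrite mul1r.
Qed.

Lemma dif_cauchy J F h (x0 y0 rho tau M : R) : analytic_on (@upper_half_plane R) F ->
  0 <= complex.Im h -> 0 < tau -> normc h <= tau -> rho + 2 * tau * J%:R < y0 ->
  (forall x y, `|x - x0| <= rho + 2 * tau * J%:R -> `|y - y0| <= rho + 2 * tau * J%:R ->
     normc (F (x +i* y)) <= M) ->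
  forall x y, `|x - x0| <= rho -> `|y - y0| <= rho ->
    normc (dif J F (x +i* y) h) <= (16 / tau * normc h) ^+ J * M.
Proof.
move=> aF h0 t0 ht; elim: J rho => [|J IH] rho ry FM x y xr yr.
  by rewrite expr0 mul1r; apply: FM; rewrite mulr0 addr0.
have JE : 2 * tau * J.+1%:R = 2 * tau + 2 * tau * J%:R by rewrite -natr1; ring.
have J0 : 0 <= 2 * tau * J%:R by rewrite mulr_ge0// mulr_ge0// ltW.
have y2 : 2 * tau < y by move: yr; rewrite ler_distl => /andP[? ?]; lra.
have HJ x' y' : `|x' - x| <= 2 * tau -> `|y' - y| <= 2 * tau ->
    normc (dif J F (x' +i* y') h) <= (16 / tau * normc h) ^+ J * M.
  move=> xx yy; apply: (IH (rho + 2 * tau)).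
  - by rewrite -addrA -JE.
  - by move=> u v hu hv; apply: FM; rewrite JE addrA.
  - rewrite (_ : x' - x0 = (x' - x) + (x - x0)); last by ring.
    by rewrite (le_trans (ler_normD _ _))//; lra.
  - rewrite (_ : y' - y0 = (y' - y) + (y - y0)); last by ring.
    by rewrite (le_trans (ler_normD _ _))//; lra.
have := cauchy_lipschitz (analytic_dif (J := J) aF h0) t0 y2 HJ ht.
rewrite /= => /le_trans; apply; rewrite le_eqVlt; apply/orP; left; apply/eqP.
by rewrite exprS; ring.
Qed.

End differences.

Lemma powRN_anti (R : realType) (x y s : R) : 0 <= s -> 0 < x -> x <= y ->
  y `^ (- s) <= x `^ (- s).
Proof.
move=> s0 x0 xy; have y0 : 0 < y by rewrite (lt_le_trans x0).
rewrite !powRN lef_pV2 ?posrE ?powR_gt0//; apply: ge0_ler_powR => //.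
- by rewrite nnegrE ltW.
- by rewrite nnegrE ltW.
Qed.

Section codimension_case.
Context {R : realType} (alpha : R).
Hypothesis alpha_ge : -1 <= alpha.
Notation C := (cplx R).
Notation V := (A2_space alpha).
Implicit Types F G : V.

Lemma dif_linear J (c : R[i]) F G v h :
  dif J (c *: F + G : V) v h = c * dif J F v h + dif J G v h.
Proof.
elim: J v => [//|J IH] v; rewrite /= !IH.
have aux (k p q r t : R[i]) : k * p + r - (k * q + t) = k * (p - q) + (r - t) by ring.
exact: aux.
Qed.

Lemma dif_comp (mu : R) (w0 : C) (T : V -> V) J F v h : 0 < mu -> 0 <= complex.Im w0 ->
  comp_rel mu w0 T -> 0 < complex.Im v -> 0 <= complex.Im h ->
  dif J (T F) v h = dif J F (mu%:C * v + w0) (mu%:C * h).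
Proof.
move=> mu0 w00 HT v0 h0; elim: J v v0 => [|J IH] v v0; first exact: HT.
have vh : 0 < complex.Im (v + h).
  by rewrite Im_add ltr_wpDr.
rewrite /= !IH//; congr (dif J F _ _ - _).
have aux (m p q r : R[i]) : m * (p + q) + r = m * p + r + m * q by ring.
exact: aux.
Qed.

Variables (mu : R) (w0 : C) (T : V -> V) (lam : R[i]).
Hypotheses (mu0 : 0 < mu) (mu1 : mu < 1) (w00 : 0 < complex.Im w0).
Hypothesis HT : comp_rel mu w0 T.

Let wst := fixpt mu w0.

Let mun1 : mu != 1. Proof. by rewrite lt_eqF. Qed.

Let Iw : 0 < complex.Im wst.
Proof. by rewrite Im_fixpt divr_gt0// subr_gt0. Qed.

(* The difference operator makes the values on the axis [O(y ^+ J)] near wst. *)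
Definition axis_dif J (d : R) (y : R) F : C :=
  dif J F (wst + (0 +i* y)) (0 +i* (d * y)).

Lemma axis_dif_comp J d y F : 0 <= d -> 0 < y ->
  axis_dif J d y (T F) = axis_dif J d (mu * y) F.
Proof.
move=> d0 y0; have iv : 0 < complex.Im (wst + (0 +i* y)).
  by move: Iw; case: (wst) => a b /= b0; rewrite addr_gt0.
have ih : 0 <= complex.Im (0 +i* (d * y) : C) by rewrite /= mulr_ge0// ltW.
rewrite /axis_dif (dif_comp J F mu0 (ltW w00) HT iv ih).
have := fixptE w0 mun1; rewrite -/wst => e.
have aux (m p q r : R[i]) : m * (p + q) + r = m * p + r + m * q by ring.
have e1 : mu%:C * (0 +i* y) = 0 +i* (mu * y) :> C.
  by apply/eqP; rewrite eq_complex/=; apply/andP; split; apply/eqP; ring.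
have e2 : mu%:C * (0 +i* (d * y)) = 0 +i* (d * (mu * y)) :> C.
  by apply/eqP; rewrite eq_complex/=; apply/andP; split; apply/eqP; ring.
by rewrite aux e e1 e2.
Qed.

Lemma axis_dif_linear J d y c F G :
  axis_dif J d y (c *: F + G) = c * axis_dif J d y F + axis_dif J d y G.
Proof. exact: dif_linear. Qed.

Lemma axis_point d (y : R) j :
  wst + (0 +i* y) + j%:R * (0 +i* (d * y)) = wst + (0 +i* ((1 + j%:R * d) * y)) :> C.
Proof.
have -> : j%:R = (j%:R : R)%:C :> R[i] by rewrite rmorph_nat.
by case: (wst) => u v; apply/eqP; rewrite eq_complex/=; apply/andP; split; apply/eqP; ring.
Qed.

Let s := (alpha + 2) / 2.
Let s0 : 0 <= s. Proof. by have h := alpha_ge; rewrite divr_ge0//; lra. Qed.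

Lemma axis_dif_far J d : 0 <= d -> exists2 B : R, 0 <= B & forall F y, 0 < y ->
  normc (axis_dif J d y F) <= B * y `^ (- s) * nrm F.
Proof.
move=> d0; have [K K0 HK] := A2_point alpha.
exists (2 ^+ J * K) => [|F y y0]; first by rewrite mulr_ge0 ?exprn_ge0// ltW.
rewrite -!mulrA [K * _]mulrA; apply: dif_le => j _; rewrite axis_point.
set w : C := wst + _.
have yw : y <= complex.Im w.
  rewrite /w; move: Iw; case: (wst) => a b /= b0.
  have : 0 <= j%:R * d * y by rewrite mulr_ge0 ?mulr_ge0// ltW.
  by lra.
have w1 : 0 < complex.Im w by rewrite (lt_le_trans y0).
have -> : w = complex.Re w +i* complex.Im w by case: (w).
rewrite (le_trans (HK F _ _ w1))// ler_wpM2r ?nrm_ge0// ler_pM2l//.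
by apply: powRN_anti.
Qed.

Lemma axis_dif_near J d : 0 <= d -> exists y1, 0 < y1 /\ exists2 B : R, 0 <= B &
  forall F y, 0 < y -> y <= y1 -> normc (axis_dif J d y F) <= B * y ^+ J * nrm F.
Proof.
move=> d0; have [K K0 HK] := A2_point alpha.
set y0 := complex.Im wst; have y00 : 0 < y0 by [].
pose tau := y0 / (8 * J.+1%:R).
have t0 : 0 < tau by rewrite divr_gt0 ?mulr_gt0.
have d1 : 0 < d + 1 by rewrite ltr_wpDl.
pose y1 := Num.min (y0 / 4) (tau / (d + 1)).
exists y1; split; first by rewrite lt_min !divr_gt0.
exists ((16 / tau * d) ^+ J * (K * (y0 / 2) `^ (- s))).
  apply: mulr_ge0; last by rewrite mulr_ge0 ?powR_ge0// ltW.
  by apply: exprn_ge0; apply: mulr_ge0 => //; rewrite divr_ge0// ltW.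
move=> F y yp; rewrite le_min => /andP[y4 yt].
have nh : normc (0 +i* (d * y) : C) = d * y by rewrite normc_imag ger0_norm// mulr_ge0// ltW.
have ht : normc (0 +i* (d * y) : C) <= tau.
  rewrite nh; move: yt; rewrite ler_pdivlMr// mulrC; apply: le_trans.
  by rewrite ler_wpM2r ?ltW// ltrDl.
have ih : 0 <= complex.Im (0 +i* (d * y) : C) by rewrite /= mulr_ge0// ltW.
have tJ : 2 * tau * J%:R <= y0 / 4.
  rewrite /tau (_ : 2 * _ * _ = y0 / 4 * (J%:R / J.+1%:R)); last by rewrite invfM; move: (J.+1%:R^-1) => z; field.
  by rewrite ler_piMr ?divr_ge0 ?(ltW y00)// ler_pdivrMr// mul1r ler_nat.
have ry : y0 / 4 + 2 * tau * J%:R < y0 by lra.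
have FM (x v : R) : `|x - complex.Re wst| <= y0 / 4 + 2 * tau * J%:R ->
    `|v - y0| <= y0 / 4 + 2 * tau * J%:R ->
    normc (F (x +i* v)) <= K * (y0 / 2) `^ (- s) * nrm F.
  move=> _; rewrite ler_distl => /andP[v1 v2].
  have v0 : y0 / 2 <= v by lra.
  have vp : 0 < v by lra.
  rewrite (le_trans (HK F _ _ vp))// ler_wpM2r ?nrm_ge0// ler_pM2l//.
  by apply: powRN_anti => //; rewrite divr_gt0.
have aF := (A2_admissible F).1.
have := dif_cauchy aF ih t0 ht ry FM.
move=> /(_ (complex.Re wst) (y0 + y)).
rewrite subrr normr0 addrAC subrr add0r (gtr0_norm yp) => /(_ _ y4).
have y40 : 0 <= y0 / 4 by rewrite divr_ge0// ltW.
move=> /(_ y40); rewrite nh /axis_dif.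
have -> : complex.Re wst +i* (y0 + y) = wst + (0 +i* y) :> C.
  by rewrite /y0; case: (wst) => a b; apply/eqP; rewrite eq_complex/= addr0 !eqxx.
move/le_trans; apply; rewrite le_eqVlt; apply/orP; left; apply/eqP.
rewrite (_ : 16 / tau * (d * y) = 16 / tau * d * y); last by ring.
by rewrite [(_ * y) ^+ J]exprMn; move: ((16 / tau * d) ^+ J) (y ^+ J) => p r; ring.
Qed.

(* [\sum_m lam^{-m} F(wst + iy mu^m)] formally annihilates the range of T - lam. It
   converges as m tends to -oo because |lam| < mu^{-s}, and as m tends to +oo
   after replacing F by a difference of high order. *)
Lemma codimension_not_fredholm : lam != 0 -> normc lam < mu `^ (- s) ->
  ~ fredholm (fun F => T F - lam *: F).
Proof.
move=> lam0 lamr.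
have nl : 0 < normc lam by rewrite normc_gt0.
pose nu := mu^-1; have nu0 : 0 < nu by rewrite invr_gt0.
have nu1 : 1 < nu by rewrite invf_gt1.
have nuX p : 0 < nu ^+ p by rewrite exprn_gt0.
have wstE : mu%:C * wst + w0 = wst := fixptE w0 mun1.
pose c := 2 * complex.Im wst + 1.
have c0 : 0 < c by rewrite addr_gt0// mulr_gt0.
have ok x : 0 < x -> x <= 1 -> peak_ok wst c x.
  move=> x0 x1; split => //; apply: (@le_trans _ _ (complex.Im wst)).
    by rewrite ler_piMl// ltW.
  by rewrite /c; lra.
pose L := Num.max (normc lam) (normc lam)^-1.
have L1 : 1 <= L.
  rewrite le_max; have [//|h] := leP 1 (normc lam).
  by rewrite /= invf_ge1// ltW.
have L0 : 0 < L by rewrite (lt_le_trans ltr01).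
have e30 : 0 < normc lam / 2 by rewrite divr_gt0.
have [J HJ] := exp_small (ltW mu0) mu1 e30.
have [m0 Hm] := peak_family alpha_ge.
apply: (infinite_codimension (comp_sub_bounded alpha_ge lam mu0 (ltW w00) HT)) => n.
have [t t1 tE] := lattice_root n nu1.
have t0 : 0 < t by rewrite (lt_trans ltr01).
have tX p : 0 < t ^+ p by rewrite exprn_gt0.
pose d := (t - 1) / J.+1%:R.
have d0 : 0 < d by rewrite divr_gt0// subr_gt0.
have ed j : (j <= J)%N -> 1 + j%:R * d <= t.
  move=> jJ; suff : j%:R * d <= t - 1 by lra.
  rewrite /d mulrCA ler_piMr//; first by lra.
  by rewrite ler_pdivrMr// mul1r ler_nat leqW.
pose th := 1 + d; have th1 : 1 < th by rewrite /th; lra.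
have tht : th <= t.
  suff : d <= t - 1 by rewrite /th; lra.
  rewrite /d ler_pdivrMr// ler_peMr ?ler1n//; lra.
have h0 : 0 <= hump th by rewrite hump_ge0//; lra.
have e10 : 0 < (2 ^+ J * (8 * n.+1%:R))^-1 :> R by rewrite invr_gt0 !mulr_gt0// exprn_gt0.
have [k1 Hk1] := exp_small_ge h0 (hump_lt1 th1) e10.
have e20 : 0 < (4 * L)^-1 by rewrite invr_gt0 mulr_gt0.
have [k2 Hk2] := exp_small_ge h0 (hump_lt1 th1) e20.
pose k := maxn m0 (maxn k1 k2).
have km : (m0 <= k)%N by rewrite leq_maxl.
have {}Hk1 : hump th ^+ k <= (2 ^+ J * (8 * n.+1%:R))^-1 by apply: Hk1; rewrite /k !leq_max leqnn orbT.
have {}Hk2 : hump th ^+ k <= (4 * L)^-1 by apply: Hk2; rewrite /k !leq_max leqnn !orbT.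
set q := hump th ^+ k in Hk1 Hk2.
have q0 : 0 <= q by rewrite exprn_ge0.
have Lq : L * q <= 4^-1 by move: Hk2; rewrite invfM ler_pdivlMr// mulrC.
have ht0 : 0 <= hump t by rewrite hump_ge0// ltW.
have qt : hump t <= hump th by apply: hump_ni => //; exact: ltW.
have [P [PE _ _ _]] := Hm k km wst c c0.
pose G (i : 'I_n.+1) : V := P (t ^- (2 * i)).
have ti i : 0 < t ^- (2 * i) :> R by rewrite invr_gt0.
have ti1 i : t ^- (2 * i) <= 1 by rewrite invf_le1// exprn_ege1// ltW.
pose yy (j : 'I_n.+1) N m : R := c * t ^+ (2 * j) * (nu ^+ N / nu ^+ m).
have yy0 j N m : 0 < yy j N m by rewrite /yy !mulr_gt0// invr_gt0.
have Gp i j N m e : 0 < e -> normc (G i (wst + (0 +i* (e * yy j N m)))) =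
    hump (e * t ^+ (2 * j) * (nu ^+ N / nu ^+ m) / t ^+ (2 * i)) ^+ k.
  move=> e0; have ey : 0 < e * yy j N m by rewrite mulr_gt0.
  rewrite /G PE; last 2 first.
  - exact: ok.
  - by move: Iw; case: (wst) => u v /= v0; rewrite addr_gt0.
  rewrite peakf_axis//; congr (hump _ ^+ k); rewrite /yy.
  have aux (A B C' : R) : A^-1 * (e * (c * B * C')) / c = e * B * C' / A * (c / c) by ring.
  by rewrite aux mulfV ?mulr1// gt_eqF.
pose ell (j : 'I_n.+1) N F : R[i] := \sum_(m < N + N.+1) lam ^+ N / lam ^+ m * axis_dif J d (yy j N m) F.
have dge0 : 0 <= d by exact: ltW.
exists G, ell; split.
- move=> j N a F F'; rewrite /ell mulr_sumr -big_split/=; apply: eq_bigr => m _.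
  by rewrite axis_dif_linear mulrDr mulrCA.
- move=> j F eps eps0.
  have muy N m : mu * yy j N m = yy j N m.+1.
    rewrite /yy exprS invfM mulrCA; congr (_ * _); rewrite /nu invrK.
    by rewrite mulrCA.
  pose b N m : R[i] := lam * (lam ^+ N / lam ^+ m) * axis_dif J d (yy j N m) F.
  have ellU N : ell j N (T F - lam *: F) = b N (N + N.+1)%N - b N 0%N.
    rewrite -(telescope_sumr _ (leq0n (N + N.+1))) big_mkord; apply: eq_bigr => m _.
    have -> : T F - lam *: F = (- lam) *: F + T F by rewrite scaleNr addrC.
    rewrite axis_dif_linear axis_dif_comp// muy /b exprS.
    have aux (p r x y l : R[i]) : l * l^-1 = 1 ->
        p / r * (- l * x + y) = l * (p / (l * r)) * y - l * (p / r) * x.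
      move=> hl; rewrite invfM (_ : l * (p * (l^-1 * r^-1)) = l * l^-1 * (p / r)); last by ring.
      by rewrite hl; ring.
    by apply: aux; rewrite mulfV.
  have [B1 B10 HB1] := axis_dif_far J dge0.
  have [y1 [y10 [B2 B20 HB2]]] := axis_dif_near J dge0.
  pose A := c * t ^+ (2 * n); have A0 : 0 < A by rewrite mulr_gt0.
  have jA : c * t ^+ (2 * j) <= A.
    by rewrite ler_pM2l// ler_weXn2l ?(ltW t1)// leq_mul2l /= -ltnS.
  have [N0 HN0] := exp_small_ge (ltW mu0) mu1 (divr_gt0 y10 A0).
  pose x := normc lam * mu `^ s.
  have x0 : 0 <= x by rewrite mulr_ge0 ?normc_ge0 ?powR_ge0.
  have x1 : x < 1 by move: lamr; rewrite powRN -ltr_pdivlMr ?powR_gt0// mul1r.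
  pose D1 := normc lam * B1 * c `^ (- s) * nrm F.
  have D10 : 0 <= D1 by rewrite !mulr_ge0 ?normc_ge0 ?powR_ge0 ?nrm_ge0.
  pose D2 := B2 * A ^+ J * nrm F.
  have D20 : 0 <= D2 by rewrite !mulr_ge0 ?exprn_ge0 ?nrm_ge0// ltW.
  have far N : normc (b N 0%N) <= D1 * x ^+ N.
    rewrite /b expr0 divr1 !normcM normcX.
    have yc : c * nu ^+ N <= yy j N 0%N.
      rewrite /yy expr0 divr1 -mulrA ler_pM2l// ler_peMl ?(ltW (nuX _))//.
      by rewrite exprn_ege1// ltW.
    have cn : 0 < c * nu ^+ N by rewrite mulr_gt0.
    have hy := powRN_anti s0 cn yc.
    rewrite powRM ?(ltW c0) ?(ltW (nuX _))// powR_exp ?(ltW nu0)// /nu powRVN// in hy.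
    have h1 := HB1 F _ (yy0 j N 0%N).
    have h2 : normc (axis_dif J d (yy j N 0%N) F) <= B1 * (c `^ (- s) * (mu `^ s) ^+ N) * nrm F.
      by rewrite (le_trans h1)// ler_wpM2r ?nrm_ge0// ler_wpM2l.
    have l0 : 0 <= normc lam * normc lam ^+ N by rewrite mulr_ge0 ?exprn_ge0 ?normc_ge0.
    rewrite (le_trans (ler_wpM2l l0 h2))// /D1 /x exprMn.
    by rewrite le_eqVlt; apply/orP; left; apply/eqP; ring.
  have near_ N : (N0 <= N)%N -> normc (b N (N + N.+1)%N) <= D2 * 2^-1 ^+ N.
    move=> /HN0 hN.
    have bE : b N (N + N.+1)%N = (lam ^+ N)^-1 * axis_dif J d (yy j N (N + N.+1)) F.
      rewrite /b exprD exprS; congr (_ * _).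
      have aux (l p : R[i]) : l * l^-1 = 1 -> p / p = 1 -> l * (p / (p * (l * p))) = p^-1.
        move=> hl hp; rewrite !invfM (_ : l * (p * (p^-1 * (l^-1 * p^-1))) = l * l^-1 * (p / p) * p^-1); last by ring.
        by rewrite hl hp !mul1r.
      by apply: aux; rewrite mulfV ?expf_neq0.
    have yE : yy j N (N + N.+1)%N = c * t ^+ (2 * j) * mu ^+ N.+1.
      have nn : nu ^+ N / nu ^+ (N + N.+1) = mu ^+ N.+1.
        by rewrite exprD invfM mulrA mulfV ?gt_eqF// mul1r /nu exprVn invrK.
      by rewrite /yy nn.
    have yA : yy j N (N + N.+1)%N <= A * mu ^+ N.
      rewrite yE ler_pM ?mulr_ge0 ?exprn_ge0 ?(ltW c0) ?(ltW t0) ?(ltW mu0)//.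
      by apply: ler_wiXn2l => //; exact: ltW.
    have yy1 : yy j N (N + N.+1)%N <= y1.
      by rewrite (le_trans yA)// mulrC -ler_pdivlMr.
    have h1 := HB2 F _ (yy0 j N (N + N.+1)%N) yy1.
    rewrite bE normcM normcV normcX ler_pdivrMl ?exprn_gt0// (le_trans h1)// /D2.
    have h2 : yy j N (N + N.+1)%N ^+ J <= A ^+ J * (normc lam ^+ N * 2^-1 ^+ N).
      rewrite (@le_trans _ _ ((A * mu ^+ N) ^+ J))//.
        by rewrite lerXn2r ?nnegrE ?(ltW (yy0 _ _ _))// mulr_ge0 ?exprn_ge0 ?ltW.
      rewrite exprMn ler_wpM2l ?exprn_ge0 ?(ltW A0)// exprAC -exprMn.
      by rewrite lerXn2r ?nnegrE ?exprn_ge0 ?(ltW mu0)// mulr_ge0 ?normc_ge0.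
    have h3 := ler_wpM2r (nrm_ge0 F) (ler_wpM2l B20 h2).
    by rewrite (le_trans h3)// le_eqVlt; apply/orP; left; apply/eqP; ring.
  have eB1 : 0 < eps / 2 / (D1 + 1) by rewrite !divr_gt0// ltr_wpDl.
  have eB2 : 0 < eps / 2 / (D2 + 1) by rewrite !divr_gt0// ltr_wpDl.
  have [N1 HN1] := exp_small_ge x0 x1 eB1.
  have half0 : (0 : R) <= 2^-1 by rewrite invr_ge0.
  have half1 : (2^-1 : R) < 1 by rewrite invf_lt1// ltr1n.
  have [N2 HN2] := exp_small_ge half0 half1 eB2.
  exists (maxn N0 (maxn N1 N2)) => N; rewrite !geq_max => /and3P[n0 n1 n2].
  rewrite ellU (le_trans (normcD _ _))// normcN.
  have hf := far N; have hn := near_ N n0.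
  have h1 := HN1 N n1; have h2 := HN2 N n2.
  rewrite ler_pdivlMr ?ltr_wpDl// mulrDr mulr1 in h1.
  rewrite ler_pdivlMr ?ltr_wpDl// mulrDr mulr1 in h2.
  have p1 : 0 <= x ^+ N by rewrite exprn_ge0.
  have p2 : 0 <= 2^-1 ^+ N :> R by rewrite exprn_ge0.
  move: hf hn h1 h2 p1 p2; move: (x ^+ N) (2^-1 ^+ N) => X Y hf hn h1 h2 p1 p2.
  rewrite [X * D1]mulrC in h1; rewrite [Y * D2]mulrC in h2.
  by lra.
move=> j N; pose Q := 2 ^+ J * (2 * q).
have e1 jj : 1 <= 1 + jj%:R * d by rewrite lerDl mulr_ge0.
have e0 jj : 0 < 1 + jj%:R * d by rewrite (lt_le_trans ltr01).
have hj (i : 'I_n.+1) : (i <= n)%N by rewrite -ltnS.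
have off i m jj : (jj <= J)%N -> i != j \/ m != N ->
    normc (G i (wst + (0 +i* ((1 + jj%:R * d) * yy j N m)))) <= q ^+ (ndist m N).+1.
  move=> jJ ij; rewrite Gp// /q exprAC lerXn2r ?nnegrE ?exprn_ge0//.
    by rewrite hump_ge0// !mulr_ge0 ?invr_ge0 ?exprn_ge0 ?(ltW t0) ?(ltW nu0) ?(ltW (e0 _)).
  have ij' : (i : nat) != j \/ m != N by case: ij; [left|right].
  have := hump_lattice t1 (hj i) (hj j) (e1 jj) (ed jj jJ) ij'; rewrite tE => /le_trans; apply.
  by rewrite lerXn2r ?nnegrE.
have term i m : i != j \/ m != N ->
    normc (lam ^+ N / lam ^+ m * axis_dif J d (yy j N m) (G i)) <=
    2 ^+ J * (L ^+ ndist m N * q ^+ (ndist m N).+1).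
  move=> ij; rewrite normcM mulrCA; apply: ler_pM; rewrite ?normc_ge0//.
    by have := @coef_ndist R lam N m lam0; rewrite /ndist addnC.
  by apply: dif_le => jj jJ; rewrite axis_point; exact: off.
have offsum : forall i (A : pred 'I_(N + N.+1)), (forall m, A m -> i != j \/ (m : nat) != N) ->
    \sum_(m < N + N.+1 | A m) normc (lam ^+ N / lam ^+ m * axis_dif J d (yy j N m) (G i)) <= Q.
  move=> i A HA; have J2 : 0 <= 2 ^+ J :> R by rewrite exprn_ge0.
  apply: (le_trans _ (ler_wpM2l J2 (sum_lattice_le N L1 q0 Lq))).
  rewrite mulr_sumr big_mkcond/=; apply: ler_sum => m _; case: ifPn => [/HA|_]; first exact: term.
  by rewrite !mulr_ge0 ?exprn_ge0// ltW.
have NN : (N < N + N.+1)%N by rewrite addnS ltnS leq_addr.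
have Ei i : i != j -> normc (ell j N (G i)) <= Q.
  move=> ij; rewrite /ell (le_trans (normc_sum _ _ _))//.
  by apply: (offsum i xpredT) => m _; left.
have Ej : 1 <= normc (ell j N (G j)) + Q + 2 ^+ J * q.
  rewrite /ell (bigD1 (Ordinal NN))//=; set S := \sum_(i | _) _.
  have SN : normc S <= Q.
    rewrite (le_trans (normc_sum _ _ _))//.
    apply: (offsum j (fun m => m != Ordinal NN)) => m mN; right.
    by apply: contra mN => /eqP mN; apply/eqP/val_inj.
  rewrite mulfV ?expf_neq0// mul1r; set u := axis_dif _ _ _ _.
  have main := @dif_main R J (G j) (wst + (0 +i* yy j N N)) (0 +i* (d * yy j N N)) q.
  have {}main : normc (u - (-1) ^+ J * G j (wst + (0 +i* yy j N N))) <= 2 ^+ J * q.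
    apply: main => // jj jj0 jJ; rewrite axis_point Gp// mulfV ?gt_eqF// mulr1 mulfK ?gt_eqF//.
    rewrite lerXn2r ?nnegrE//; first by rewrite hump_ge0// ltW.
    apply: hump_ni; [exact: ltW|rewrite /th lerD2l ler_peMl// ler1n//].
  have v1 : normc ((-1) ^+ J * G j (wst + (0 +i* yy j N N))) = 1.
    rewrite normcM normcX normcN normc1 expr1n mul1r -{1}[yy j N N]mul1r Gp//.
    by rewrite mulfV ?gt_eqF// mulr1 mul1r mulfV ?gt_eqF// hump1 expr1n.
  set v := (-1) ^+ J * _ in main v1.
  have h1 := normcD (u + S) (- S); rewrite addrK normcN in h1.
  have h2 := normcD (v - u) u; rewrite subrK v1 normcB in h2.
  by lra.
have Es : \sum_(i | i != j) normc (ell j N (G i)) <= n%:R * Q.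
  have -> : n%:R * Q = \sum_(i < n.+1 | i != j) Q.
    by rewrite sumr_const cardC1 card_ord mulr_natl.
  by apply: ler_sum => i; exact: Ei.
have hq : 2 ^+ J * q * (8 * (n%:R + 1)) <= 1.
  have := Hk1; rewrite -[leRHS]mul1r ler_pdivlMr ?mulr_gt0 ?exprn_gt0// natr1 => h1.
  by rewrite (le_trans _ h1)// le_eqVlt; apply/orP; left; apply/eqP; ring.
have n0 : (0 : R) <= n%:R by [].
have Q0 : 0 <= 2 ^+ J * q by rewrite mulr_ge0 ?exprn_ge0.
have QE : Q = 2 * (2 ^+ J * q) by rewrite /Q; ring.
rewrite QE in Ej Es; move: Q0 hq Es Ej; move: (2 ^+ J * q) => X X0 hX Es Ej.
have nX : 0 <= n%:R * X by rewrite mulr_ge0.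
have hX' : 8 * (n%:R * X) + 8 * X <= 1.
  by rewrite (le_trans _ hX)// le_eqVlt; apply/orP; left; apply/eqP; ring.
have Es' : \sum_(i | i != j) normc (ell j N (G i)) <= 2 * (n%:R * X).
  by rewrite (le_trans Es)// le_eqVlt; apply/orP; left; apply/eqP; ring.
move: Es' Ej hX' nX X0; move: (\sum_(i | _) _) (normc _) (n%:R * X) => u v z; lra.
Qed.

End codimension_case.

Section not_fredholm.
Context {R : realType} (alpha : R).
Hypothesis alpha_ge : -1 <= alpha.
Notation V := (A2_space alpha).
Variables (mu : R) (w0 : R[i]) (T : V -> V).
Hypotheses (mu0 : 0 < mu) (mu1 : mu != 1).
Hypothesis HT : comp_rel mu w0 T.

Lemma disc_not_fredholm (lam : R[i]) : 0 < complex.Im w0 ->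
  normc lam <= mu `^ (- ((alpha + 2) / 2)) -> ~ fredholm (fun F => T F - lam *: F).
Proof.
move=> w00; rewrite le_eqVlt => /orP[/eqP|] lamr.
  exact: (circle_not_fredholm alpha_ge mu0 mu1 (ltW w00) HT lamr).
have [->|lam0] := eqVneq lam 0; first exact: (zero_not_fredholm alpha_ge mu0 w00 HT).
have [mlt|mgt|meq] := ltgtP mu 1.
- exact: (codimension_not_fredholm alpha_ge mu0 mlt w00 HT lam0 lamr).
- exact: (kernel_not_fredholm alpha_ge mgt w00 HT lam0 lamr).
- by have := mu1; rewrite meq eqxx.
Qed.

End not_fredholm.

Theorem theoremB (R : realType) (mu : R) (w0 : R[i]) (alpha : R)
    (mu_gt0 : 0 < mu) (mu_neq1 : mu != 1)
    (w0_ge0 : 0 <= complex.Im w0) (alpha_ge : -1 <= alpha) :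
  exists C_tau : A2_space alpha -> A2_space alpha,
    [/\ bounded_operator C_tau,
        composition_operator (fun w => mu%:C * w + w0) C_tau,
        complex.Im w0 = 0 ->
          spectrum C_tau =
            [set l : R[i] | `|l| = (mu `^ (- ((alpha + 2) / 2)))%:C],
        0 < complex.Im w0 ->
          spectrum C_tau =
            [set l : R[i] | `|l| <= (mu `^ (- ((alpha + 2) / 2)))%:C]
      & essential_spectrum C_tau = spectrum C_tau].
Proof.
have [T HT] := A2_comp_ex alpha_ge mu_gt0 w0_ge0.
set r := mu `^ (- ((alpha + 2) / 2)).
have ess_sub l : essential_spectrum T l -> spectrum T l.
  by move=> nf inv; apply: nf; exact: invertible_fredholm.
have outer l : spectrum T l -> normc l <= r.
  move=> sp; rewrite leNgt; apply/negP => rl; apply: sp.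
  exact: (spectrum_outer alpha_ge mu_gt0 w0_ge0 HT rl).
have real_case : complex.Im w0 = 0 ->
    (forall l, spectrum T l -> normc l = r) /\ (forall l, normc l = r -> essential_spectrum T l).
  move=> w00; split=> l sp; last exact: (circle_not_fredholm alpha_ge mu_gt0 mu_neq1 w0_ge0 HT sp).
  apply/eqP; rewrite eq_le outer//= leNgt; apply/negP => lr; apply: sp.
  exact: (spectrum_inner alpha_ge mu_gt0 w00 HT lr).
have upper_case : 0 < complex.Im w0 -> forall l, normc l <= r -> essential_spectrum T l.
  by move=> w00 l lr; exact: (disc_not_fredholm alpha_ge mu_gt0 mu_neq1 HT w00 lr).
exists T; split.
- exact: (comp_bounded alpha_ge mu_gt0 w0_ge0 HT).
- by move=> F w iw; exact: HT.
- move=> w00; have [s1 s2] := real_case w00; apply/seteqP; split => l /=.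
    by move=> /s1 <-.
  by case=> /s2/ess_sub.
- move=> w00; apply/seteqP; split => l /=; rewrite normcR lecR; first exact: outer.
  by move=> lr; apply: ess_sub; exact: upper_case.
- apply/seteqP; split => l; first exact: ess_sub.
  have [w00|w00] := eqVneq (complex.Im w0) 0.
    by have [s1 s2] := real_case w00 => /s1/s2.
  by move=> /outer; apply: upper_case; rewrite lt_neqAle eq_sym w00.
Qed.
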